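(* Let $f\colon(\mathbb{R}^n,0)\to(\mathbb{R}^p,0)$ be a finitely $\mathscr{K}$-determined smooth germ with $p<n$ and $T_0f\equiv0$. If $p>1$, or if $p=1$ and $j^2f=0$, then $MC(\mathscr{K}_f)$ is at most $1$-dimensional; and in the case $p=1$ (with $j^2f=0$) it is $0$-dimensional.
   Context: All germs are $C^\infty$. The group $\mathscr{K}$ consists of the diffeomorphism germs $H$ of $(\mathbb{R}^n\times\mathbb{R}^p,(0,0))$ of the form $H(x,y)=(H_0(x),h(x,y))$ with $h(x,0)=0$, where $H_0$ is a diffeomorphism germ of $(\mathbb{R}^n,0)$. It acts on germs $(\mathbb{R}^n,0)\to(\mathbb{R}^p,0)$ by: $H\cdot f=g$ if $(\mathrm{id},f)\circ H_0=H\circ(\mathrm{id},g)$. $\mathscr{K}_f=\{H\in\mathscr{K}:H\cdot f=f\}$. $f$ is finitely $\mathscr{K}$-determined if for some $k$ every germ $g$ with $j^kg=j^kf$ lies in the $\mathscr{K}$-orbit of $f$. $T_0f$ is the derivative of $f$ at $0$ and $j^2f$ the $2$-jet of $f$ at $0$. A compact subgroup of $\mathscr{K}$ is a subgroup which is conjugate in $\mathscr{K}$ to a compact subgroup of $GL_n(\mathbb{R})\times GL_p(\mathbb{R})<\mathscr{K}$; its dimension is the dimension of that compact Lie group. A compact subgroup of $\mathscr{K}_f$ is a subgroup of $\mathscr{K}_f$ that is a compact subgroup of $\mathscr{K}$; it is maximal compact if every compact subgroup of $\mathscr{K}_f$ is conjugate in $\mathscr{K}_f$ to a subgroup of it. For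 finitely $\mathscr{K}$-determined $f$ such a group exists and is unique up to conjugation in $\mathscr{K}_f$; $MC(\mathscr{K}_f)$ denotes any representative. *)

(* Defs.v *)
From HB Require Import structures.
From mathcomp Require Import all_boot all_order all_algebra.
From mathcomp Require Import all_classical all_reals all_analysis.

Set Implicit Arguments.
Unset Strict Implicit.
Unset Printing Implicit Defensive.

Import Order.TTheory GRing.Theory Num.Theory.
Import numFieldNormedType.Exports.

Local Open Scope classical_set_scope.
Local Open Scope ring_scope.

(* A germ at 0 is represented by any total function inducing it, and two        *)
(* functions are the same germ when they satisfy germ_eq.                       *)
(* Spaces of germs (orbits, subgroups of K) are sets of representatives; every  *)
(* subgroup considered below is closed under germ_eq.                           *)

Section Germs.
Context {R : realType}.

Definition germ_eq (V W : normedModType R) (f g : V -> W) : Prop :=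
  \forall x \near (0 : V), f x = g x.

Definition iter_derive (V W : normedModType R) (vs : seq V) (f : V -> W) :
  V -> W := foldr (fun v g => 'D_v g) f vs.

(* In finite dimension this is C^oo on a neighbourhood of 0: all iterated       *)
(* directional derivatives exist there and are differentiable, hence continuous *)
Definition smooth_germ (V W : normedModType R) (f : V -> W) : Prop :=
  \forall x \near (0 : V), forall vs : seq V,
    differentiable (iter_derive vs f) x.

Definition smooth_germ0 (V W : normedModType R) (f : V -> W) : Prop :=
  smooth_germ f /\ f 0 = 0.

(* The k-jet at 0, as the Taylor polynomial of degree k                         *)
Definition jet (V W : normedModType R) (k : nat) (f : V -> W) : V -> W :=
  fun x => \sum_(i < k.+1) (i`!%:R)^-1 *: iter_derive (nseq i x) f 0.

Definition inverse_germs (V : normedModType R) (F F' : V -> V) : Prop :=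
  germ_eq (F' \o F) id /\ germ_eq (F \o F') id.

Definition diffeo_germ (V : normedModType R) (F : V -> V) : Prop :=
  smooth_germ0 F /\ exists2 F' : V -> V, smooth_germ0 F' & inverse_germs F F'.

Definition conj_germs (V : normedModType R) (F F' : V -> V)
    (G : set (V -> V)) : set (V -> V) :=
  [set H | exists2 g, G g & germ_eq H (F \o g \o F')].

End Germs.

Section ContactGroup.
Context {R : realType} (n p : nat).

Definition source_germ (H : 'rV[R]_n * 'rV[R]_p -> 'rV[R]_n * 'rV[R]_p) :
  'rV[R]_n -> 'rV[R]_n := fun x => (H (x, 0)).1.

(* H (x, y) = (H_0 x, h (x, y)) with h (x, 0) = 0; necessarily                  *)
(* H_0 = source_germ H and h = snd \o H                                         *)
Definition contact_group : set ('rV[R]_n * 'rV[R]_p -> 'rV[R]_n * 'rV[R]_p) :=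
  [set H | [/\ diffeo_germ H,
               diffeo_germ (source_germ H),
               germ_eq (fst \o H) (source_germ H \o fst) &
               germ_eq (fun x => (H (x, 0)).2) (cst 0)]].

(* H . f = g, that is, (id, f) \o H_0 = H \o (id, g)                            *)
Definition contact_act (H : 'rV[R]_n * 'rV[R]_p -> 'rV[R]_n * 'rV[R]_p)
    (f g : 'rV[R]_n -> 'rV[R]_p) : Prop :=
  germ_eq ((fun x => (x, f x)) \o source_germ H) (H \o (fun x => (x, g x))).

Definition contact_stab (f : 'rV[R]_n -> 'rV[R]_p) :
    set ('rV[R]_n * 'rV[R]_p -> 'rV[R]_n * 'rV[R]_p) :=
  [set H | contact_group H /\ contact_act H f f].

Definition finitely_K_determined (f : 'rV[R]_n -> 'rV[R]_p) : Prop :=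
  exists k : nat, forall g : 'rV[R]_n -> 'rV[R]_p,
    smooth_germ0 g -> jet k g = jet k f ->
    exists2 H, contact_group H & contact_act H f g.

Definition compact_linear_group (C : set ('M[R]_n * 'M[R]_p)) : Prop :=
  [/\ forall c, C c -> c.1 \in unitmx /\ c.2 \in unitmx,
      C (1%:M, 1%:M),
      forall c c', C c -> C c' -> C (c.1 *m c'.1, c.2 *m c'.2),
      forall c, C c -> C (invmx c.1, invmx c.2) &
      compact C].

(* Matrices act on row vectors from the right, so products are reversed; this   *)
(* does not affect which sets of maps are compact subgroups, nor their dimension *)
Definition linear_germ (c : 'M[R]_n * 'M[R]_p) :
  'rV[R]_n * 'rV[R]_p -> 'rV[R]_n * 'rV[R]_p := fun z => (z.1 *m c.1, z.2 *m c.2).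

(* C is an embedded C^oo submanifold of dimension d. For a compact subgroup of  *)
(* GL_n x GL_p this holds for exactly one d (closed subgroup theorem), its      *)
(* dimension as a Lie group                                                     *)
Definition submanifold_dim (C : set ('M[R]_n * 'M[R]_p)) (d : nat) : Prop :=
  forall c, C c ->
    exists Phi : 'M[R]_n * 'M[R]_p -> 'M[R]_n * 'M[R]_p,
    exists U : {vspace ('M[R]_n * 'M[R]_p)%type},
      [/\ diffeo_germ Phi, \dim U = d &
          \forall X \near (0 : 'M[R]_n * 'M[R]_p), C (c + X) <-> Phi X \in U].

Definition conjugate_to_linear
    (G : set ('rV[R]_n * 'rV[R]_p -> 'rV[R]_n * 'rV[R]_p))
    (C : set ('M[R]_n * 'M[R]_p)) : Prop :=
  exists F F' : 'rV[R]_n * 'rV[R]_p -> 'rV[R]_n * 'rV[R]_p,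
    [/\ contact_group F, contact_group F', inverse_germs F F' &
        G = conj_germs F F' (linear_germ @` C)].

Definition compact_subgroup
    (G : set ('rV[R]_n * 'rV[R]_p -> 'rV[R]_n * 'rV[R]_p)) : Prop :=
  exists2 C, compact_linear_group C & conjugate_to_linear G C.

Definition compact_subgroup_dim
    (G : set ('rV[R]_n * 'rV[R]_p -> 'rV[R]_n * 'rV[R]_p)) (d : nat) : Prop :=
  exists C, [/\ compact_linear_group C, conjugate_to_linear G C &
                submanifold_dim C d].

Definition maximal_compact (f : 'rV[R]_n -> 'rV[R]_p)
    (G : set ('rV[R]_n * 'rV[R]_p -> 'rV[R]_n * 'rV[R]_p)) : Prop :=
  [/\ compact_subgroup G, G `<=` contact_stab f &
      forall G', compact_subgroup G' -> G' `<=` contact_stab f ->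
        exists F F' : 'rV[R]_n * 'rV[R]_p -> 'rV[R]_n * 'rV[R]_p,
          [/\ contact_stab f F, contact_stab f F', inverse_germs F F' &
              conj_germs F F' G' `<=` G]].

End ContactGroup.

(* Main.v *)
(* A compact subgroup of K_f becomes, after conjugation, a compact group C of
   linear pairs (a, b), and the N-jet F of the conjugated germ satisfies
   F (x a) = F (x) b; by an invariant inner product C may be taken orthogonal, so
   its Lie algebra consists of skew pairs (A, B) with F'(x) (x A) = F (x) B.

   Tangent space.  If h is a polynomial germ of degree N whose coefficients are
   algebraically independent over those of F, finite determinacy makes F + h
   equivalent to F.  Applying to this equivalence a derivation of R that kills
   the coefficients of F and has prescribed values on those of h shows that the
   tangent space of F contains every term of degree N, modulo degree N + 1.

   Two independent skew pairs force n <= p.  Let W be a subspace of the source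
   with W A = 0, let W' contain the values of F on W, and let q be a polynomial
   with q(A) = 0 and q(B) <> 0.  On W the Jacobian J of F satisfies A J = J B, so
   J q(B) = 0, and applying q(B) to the tangent space condition on W leaves only
   the module generated by F: the components of F in W' generate all monomials
   of degree N, and hence dim W <= dim W', since an ideal with this property has
   at least as many generators as there are variables.  For a commuting pair this
   is applied to the sum of the joint weight spaces along each line; otherwise
   there is a raising operator E and it is applied to the subspaces
   ker E :&: im (E ^+ a), whose dimensions add up to n.  A suitable q exists because
   the largest weight of the target is at least twice that of the source.  For
   p = 1 the only weight of the target is 0, which excludes a single pair. *)
Require Import Defs.
From HB Require Import structures.
From mathcomp Require Import all_boot all_order all_algebra.
From mathcomp Require Import zify ring lra.
From mathcomp Require mpoly spectral complex.
Set Implicit Arguments.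
Unset Strict Implicit.
Unset Printing Implicit Defensive.
Import Order.TTheory GRing.Theory Num.Theory.
Local Open Scope ring_scope.

(** Finite determinacy supplies some [H] for each [g] separately; nothing says how [H] varies with
    [g], so no family of equivalences can be differentiated. A derivation of the field of reals acts
    instead on the coefficients of one equivalence, and it can move the coefficients of the
    perturbation freely because they are algebraically independent over the others. Germs enter only
    through polynomials that approximate them up to o(|x|^N). The polynomial q of the overview is
    present by its effect alone: a column [z] != 0 with J z = 0 whenever A J = J B. For a single
    pair it comes from the gap d >= 2w between the largest weights d of [B] and w of [A]. If d < 2w,
    then [F] vanishes on the highest weight lines of [A], the tangent space condition there forces B
    = 0, and the Hessians of two components act on the highest weight space so that every nonzero
    combination is invertible. Over a closed field this is impossible, a contradiction if p > 1; for
    p = 1 the 2-jet, and with it the Hessian, is 0. For a raising operator, a power of E that is 0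
    on the source but not on the target yields [z]. *)

Module Derivations.
From mathcomp Require Import boolp classical_sets.

Definition derivation (K : comNzRingType) (D : K -> K) :=
  (forall x y, D (x + y) = D x + D y) /\ (forall x y, D (x * y) = D x * y + x * D y).

(** * Extending derivations from a subring to the whole field *)

Section PartialDerivation.
Variable K : numFieldType.
Implicit Types G : K -> K -> Prop.

(* The graph of a derivation from a subring of K to K, seen as a subring of the
   dual numbers over K. *)
Definition dual_subring G :=
  [/\ G 1 0, forall a a' b b', G a a' -> G b b' -> G (a - b) (a' - b') &
     forall a a' b b', G a a' -> G b b' -> G (a * b) (a' * b + a * b')].

(** Differences of pairs stay in a [dual_subring], so the value at 0 decides whether the graph is
    single-valued. *)
Definition functional G := forall b, G 0 b -> b = 0.

Section Polys.
Variable G : K -> K -> Prop.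
Hypothesis dG : dual_subring G.

Let G1 : G 1 0. Proof. by case: dG. Qed.
Let GB a a' b b' : G a a' -> G b b' -> G (a - b) (a' - b'). Proof. by case: dG => _ h _; apply: h. Qed.
Let GM a a' b b' : G a a' -> G b b' -> G (a * b) (a' * b + a * b'). Proof. by case: dG => _ _ h; apply: h. Qed.
Let G0 : G 0 0. Proof. by have := GB G1 G1; rewrite !subrr. Qed.
Let GN a a' : G a a' -> G (- a) (- a'). Proof. by move=> h; have := GB G0 h; rewrite !sub0r. Qed.
Let GD a a' b b' : G a a' -> G b b' -> G (a + b) (a' + b').
Proof. by move=> h /GN h'; have := GB h h'; rewrite !opprK. Qed.

Let Gsum (I : Type) (r : seq I) (f f' : I -> K) : (forall i, G (f i) (f' i)) ->
  G (\sum_(i <- r) f i) (\sum_(i <- r) f' i).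
Proof. by move=> h; elim: r => [|i r IH]; rewrite ?big_nil ?big_cons //; apply: GD. Qed.

Definition Gpoly (p p1 : {poly K}) := forall i, G p`_i p1`_i.

Let PB p p1 q q1 : Gpoly p p1 -> Gpoly q q1 -> Gpoly (p - q) (p1 - q1).
Proof. by move=> h h' i; rewrite !coefB; apply: GB. Qed.

Let PM p p1 q q1 : Gpoly p p1 -> Gpoly q q1 -> Gpoly (p * q) (p1 * q + p * q1).
Proof.
move=> h h' i; rewrite coefD !coefM -big_split /=; apply: Gsum => j; exact: GM.
Qed.

Let PC a a' : G a a' -> Gpoly a%:P a'%:P.
Proof. by move=> h i; rewrite !coefC; case: ifP. Qed.

Let PXn n : Gpoly 'X^n 0.
Proof. by move=> i; rewrite coefXn coef0; case: eqP. Qed.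

Let PX : Gpoly 'X 0. Proof. by rewrite -['X]expr1; apply: PXn. Qed.

Let P' p p1 : Gpoly p p1 -> Gpoly p^`() p1^`().
Proof.
move=> h i; rewrite !coef_deriv; have := h i.+1; move: (p`_i.+1) (p1`_i.+1) => x x' hx.
elim: i.+1 => [|n IH]; first by rewrite !mulr0n.
by rewrite !mulrS; apply: GD.
Qed.

(** The image of the polynomials over [G] under evaluation at the dual number a + a' epsilon: the
    derivation is extended to the ring generated by [a], with value [a'] at [a]. *)
Definition adjoin a a' x x' :=
  exists p p1, [/\ Gpoly p p1, x = p.[a] & x' = p1.[a] + p^`().[a] * a'].

Lemma adjoin_dual_subring a a' : dual_subring (adjoin a a').
Proof.
split.
- exists 1%:P, 0%:P; split; [exact: PC|by rewrite hornerC|].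
  by rewrite derivC !hornerE.
- move=> _ _ _ _ [p [p1 [h -> ->]]] [q [q1 [h' -> ->]]].
  exists (p - q), (p1 - q1); rewrite derivB !hornerE; split=> //; first exact: PB.
  by ring.
move=> _ _ _ _ [p [p1 [h -> ->]]] [q [q1 [h' -> ->]]].
exists (p * q), (p1 * q + p * q1); rewrite derivM !hornerE; split=> //; first exact: PM.
by ring.
Qed.

Lemma sub_adjoin a a' x x' : G x x' -> adjoin a a' x x'.
Proof.
by move=> h; exists x%:P, x'%:P; rewrite derivC !hornerE; split=> //; apply: PC.
Qed.

Lemma mem_adjoin a a' : adjoin a a' a a'.
Proof. by exists 'X, 0; rewrite derivX !hornerE; split. Qed.

Hypothesis fG : functional G.

Lemma adjoin_transcendental a a' :
  (forall p p1, Gpoly p p1 -> p.[a] = 0 -> p = 0) -> functional (adjoin a a').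
Proof.
move=> tr _ [p [p1 [h e ->]]]; have p0 := tr _ _ h (esym e).
have p10 : p1 = 0.
  by apply/polyP => i; have := h i; rewrite p0 coef0 => /fG.
by rewrite p0 p10 derivC !hornerE.
Qed.

(** If [a] satisfies a polynomial m over the domain, the value at [a] is forced by differentiating
    m(a) = 0. For m of least degree m'(a) != 0, as the characteristic is 0, and every other relation
    follows from m by pseudo-division. If no nonzero polynomial vanishes at [a], any value is
    allowed. *)
Lemma adjoin_functional a : exists a', functional (adjoin a a').
Proof.
have [tr|] := pselect (forall p p1, Gpoly p p1 -> p.[a] = 0 -> p = 0).
  by exists 0; apply: adjoin_transcendental.
move=> ntr.
have [k [m [m1 [hm ma m0 sm]]]] : exists k m m1, 
    [/\ Gpoly m m1, m.[a] = 0, m != 0 & size m = k].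
  apply: contrapT => h; apply: ntr => p p1 hp pa; apply/eqP; apply: contraT => p0.
  by case: h; exists (size p), p, p1.
have [{m m1 hm ma m0 sm} k0 /asboolP[m [m1 [hm ma m0 sm]]] kmin] :=
  ex_minnP (ex_intro (fun k => `[< exists m m1, 
    [/\ Gpoly m m1, m.[a] = 0, m != 0 & size m = k] >]) k (asboolT (ex_intro _ m (ex_intro _ m1 (And4 hm ma m0 sm))))).
have small p p1 : Gpoly p p1 -> p.[a] = 0 -> (size p < size m)%N -> p = 0.
  move=> hp pa lt; apply/eqP; apply: contraT => p0.
  have /kmin : `[< exists m m1, [/\ Gpoly m m1, m.[a] = 0, m != 0 & size m = size p] >].
    by apply/asboolP; exists p, p1.
  by rewrite leqNgt -sm lt.
have m'a : m^`().[a] != 0.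
  apply/eqP => e; have m'0 := small _ _ (P' hm) e (lt_size_deriv m0).
  have szm : (size m <= 1)%N.
    apply/leq_sizeP => -[//|j] _; have := congr1 (fun q : {poly K} => q`_j) m'0.
    by rewrite coef_deriv coef0 => /eqP; rewrite mulrn_eq0 /= => /eqP.
  have mc := size1_polyC szm; move: ma m0; rewrite mc hornerC polyC_eq0 => ->.
  by rewrite eqxx.
exists (- (m1.[a] / m^`().[a])) => _ [p [p1 [hp e ->]]].
set a' := - _; have ma' : m1.[a] + m^`().[a] * a' = 0.
  by rewrite /a' mulrN mulrC divfK // subrr.
have [s] := ubnP (size p); elim: s p p1 hp e => // s IH p p1 hp e; rewrite ltnS => szp.
have [lt|ge] := ltnP (size p) (size m).
  have p0 := small _ _ hp (esym e) lt.
  have p10 : p1 = 0.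
    by apply/polyP => i; have := hp i; rewrite p0 coef0 => /fG.
  by rewrite p0 p10 derivC !hornerE.
(* The coefficients form only a ring, so p is multiplied by the leading coefficient [l] of m before
   a multiple of m cancels its top term; [l] is nonzero and is divided out in [K] at the end. *)
pose l := lead_coef m; pose l1 := m1`_(size m).-1.
have gl : G l l1 by apply: hm.
pose c := lead_coef p; pose c1 := p1`_(size p).-1.
have gc : G c c1 by apply: hp.
pose X := 'X^(size p - size m) : {poly K}.
have := PB (PM (PC gl) hp) (PM (PM (PC gc) (PXn (size p - size m))) hm).
rewrite -/X => hq.
have qa : 0 = (l%:P * p - c%:P * X * m).[a] by rewrite !hornerE ma -e !mulr0 subrr.
have l0 : l != 0 by rewrite lead_coef_eq0.
have szm : (0 < size m)%N by rewrite size_poly_gt0.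
have p0 : (0 < size p)%N by apply: leq_trans ge.
have lt : (size (l%:P * p - c%:P * X * m)%R < s)%N.
  apply: leq_trans szp; rewrite -(prednK p0) ltnS; apply/leq_sizeP => j.
  rewrite leq_eqVlt => /orP[/eqP <-|].
    rewrite coefB -mulrA !coefCM coefXnM.
    have -> : ((size p).-1 < size p - size m)%N = false.
      by apply/negbTE; rewrite -leqNgt; move: szm p0 ge; clear; move: (size m) (size p) => x y; lia.
    have -> : ((size p).-1 - (size p - size m) = (size m).-1)%N.
      by move: szm p0 ge; clear; move: (size m) (size p) => x y; lia.
    by rewrite -!lead_coefE -/l -/c mulrC subrr.
  rewrite prednK // => hj; rewrite coefB -mulrA !coefCM coefXnM nth_default // mulr0 sub0r.
  case: ifP => _; first by rewrite mulr0 oppr0.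
  rewrite nth_default ?mulr0 ?oppr0 //.
  by move: hj szm ge; clear; move: (size m) (size p) => x y; lia.
have := IH _ _ hq qa lt.
have -> : (l%:P * p - c%:P * X * m)^`() = l%:P * p^`() - (c%:P * X)^`() * m - c%:P * X * m^`().
  by rewrite derivB !derivM !derivC mul0r !add0r opprD addrA.
rewrite !hornerE ma -e => E.
have {}E : l * (p1.[a] + p^`().[a] * a') - c * a ^+ (size p - size m) * (m1.[a] + m^`().[a] * a') = 0.
  by rewrite -[RHS]E; ring.
by move/eqP: E; rewrite ma' mulr0 subr0 mulf_eq0 (negPf l0) => /eqP.
Qed.
End Polys.

Theorem derivation_extension G : dual_subring G -> functional G ->
  exists2 D : K -> K, derivation D & forall a a', G a a' -> D a = a'.
Proof.
move=> dG fG.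
pose gr (X : set (K * K)) a a' := X (a, a').
pose good (X : set (K * K)) := [/\ dual_subring (gr X), functional (gr X) &
   forall a a', G a a' -> X (a, a')].
have [X [PX Xmax]] : exists X, (X = set0 \/ good X) /\
    forall B, (X `<` B)%classic -> ~ (B = set0 \/ good B).
  apply: (@Zorn_bigcup _ (fun X => X = set0 \/ good X)) => F FP Ftot.
  have [[Y FY gY]|nog] := pselect (exists2 Y, F Y & good Y); last first.
    left; apply/seteqP; split => // z [Y FY Yz].
    have [Y0|gY] := FP _ FY; first by rewrite Y0 in Yz.
    by case: nog; exists Y.
  right.
  have up Y1 Y2 z1 z2 : F Y1 -> F Y2 -> Y1 z1 -> Y2 z2 ->
      exists Z, [/\ F Z, good Z, Z z1 & Z z2].
    move=> F1 F2 y1 y2; have gd Y0 z : F Y0 -> Y0 z -> good Y0.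
      by move=> F0 h; case: (FP _ F0) => // E; rewrite E in h.
    have [s|s] := Ftot _ _ F1 F2.
      by exists Y2; split => //; [apply: gd F2 y2|apply: s].
    by exists Y1; split => //; [apply: gd F1 y1|apply: s].
  have [[Y1 _ _] _ GY] := gY.
  split.
  - split.
    + by exists Y.
    + move=> a a' b b' [Y1' F1 y1] [Y2 F2 y2].
      have [Z [FZ [[_ h _] _ _] z1 z2]] := up _ _ _ _ F1 F2 y1 y2.
      by exists Z => //; apply: h.
    move=> a a' b b' [Y1' F1 y1] [Y2 F2 y2].
    have [Z [FZ [[_ _ h] _ _] z1 z2]] := up _ _ _ _ F1 F2 y1 y2.
    by exists Z => //; apply: h.
  - move=> b [Y1' F1 y1]; have [Z [FZ [_ h _] z1 _]] := up _ _ _ _ F1 F1 y1 y1.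
    exact: h.
  by move=> a a' /GY; exists Y.
have [dX fX GX] : good X.
  case: PX => // X0; case: (Xmax [set z : K * K | G z.1 z.2]%classic); last first.
    by right; split.
  rewrite X0; split=> // h; apply: (h (1, 0)); by case: dG.
(* A maximal graph is defined at every [a]: adjoining [a] with a value from [adjoin_functional]
   cannot enlarge it. *)
have tot a : exists a', X (a, a').
  have [a' fa] := adjoin_functional dX fX a.
  exists a'; apply: contrapT => nXa.
  case: (Xmax [set z : K * K | adjoin (gr X) a a' z.1 z.2]%classic).
    split; first by move=> [x x'] h; apply: sub_adjoin.
    by move=> h; apply: nXa; apply: (h (a, a')); apply: mem_adjoin.
  right; split => //; first exact: adjoin_dual_subring.
  by move=> x x' /GX h; apply: sub_adjoin.
have [D hD] := choice tot.
have uniq a a' : X (a, a') -> D a = a'.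
  move=> h; apply/eqP; rewrite -subr_eq0; apply/eqP; apply: fX.
  by rewrite /gr -(subrr a); case: dX => _ hB _; apply: hB.
case: (dX) => X1 XB XM.
have XD a a' b b' : X (a, a') -> X (b, b') -> X (a + b, a' + b').
  move=> h1 h2; have h0 := XB _ _ _ _ X1 X1; rewrite !subrr in h0.
  by have := XB _ _ _ _ h1 (XB _ _ _ _ h0 h2); rewrite !sub0r !opprK.
exists D; last by move=> a a' /GX; apply: uniq.
split=> x y; apply: uniq; first exact: XD.
exact: XM.
Qed.
End PartialDerivation.

End Derivations.
Import Derivations.

Module JetAlgebra.
From mathcomp Require Import mpoly.

(** * Order of vanishing and substitution *)

Section Order.
Variables (n : nat) (K : comNzRingType).
Implicit Types (p q : {mpoly K[n]}) (m : 'X_{1..n}).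

(** Membership in the d-th power of the maximal ideal at the origin; congruence modulo terms of
    degree > N is written [ordge N.+1 (p - q)]. *)
Definition ordge d p := forall m, (mdeg m < d)%N -> p@_m = 0.

(** Identities between ring morphisms and derivations need only be checked on generators; this
    induction spares computations with monomials. *)
Lemma mpoly_gen_ind (P : {mpoly K[n]} -> Prop) :
  (forall c, P c%:MP) -> (forall i, P 'X_i) ->
  (forall p q, P p -> P q -> P (p + q)) ->
  (forall p q, P p -> P q -> P (p * q)) -> forall p, P p.
Proof.
move=> PC PX PD PM; elim/mpolyind => [|c m p _ _ Pp].
  by rewrite -mpolyC0.
apply: PD => //; rewrite -mul_mpolyC; apply: (PM) => //.
rewrite mpolyXE_id; elim/big_ind: _ => // [|i _].
  by rewrite -mpolyC1; apply: PC.
elim: (m i) => [|k IH]; first by rewrite expr0 -mpolyC1.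
by rewrite exprS; apply: PM.
Qed.

Lemma ordge0 d : ordge d 0.
Proof. by move=> m _; rewrite mcoeff0. Qed.

Lemma ordgeD d p q : ordge d p -> ordge d q -> ordge d (p + q).
Proof. by move=> hp hq m lt; rewrite mcoeffD hp // hq // addr0. Qed.

Lemma ordgeN d p : ordge d p -> ordge d (- p).
Proof. by move=> hp m lt; rewrite mcoeffN hp // oppr0. Qed.

Lemma ordgeB d p q : ordge d p -> ordge d q -> ordge d (p - q).
Proof. by move=> hp hq; apply/ordgeD/ordgeN. Qed.

Lemma ordge_sum d (I : Type) (r : seq I) (P : pred I) (F : I -> {mpoly K[n]}) :
  (forall i, P i -> ordge d (F i)) -> ordge d (\sum_(i <- r | P i) F i).
Proof. by move=> h; elim/big_ind: _ => //; [exact: ordge0|exact: ordgeD]. Qed.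

Lemma ordgeW d e p : (e <= d)%N -> ordge d p -> ordge e p.
Proof. by move=> le hp m lt; apply: hp; apply: leq_trans le. Qed.

Lemma ordge0n p : ordge 0 p. Proof. by []. Qed.

Lemma ordgeM a b p q : ordge a p -> ordge b q -> ordge (a + b) (p * q).
Proof.
move=> hp hq m lt; rewrite mcoeffM big1 // => -[[m1 h1] [m2 h2]] /= /eqP e.
case: (ltnP (mdeg m1) a) => [/hp ->|le1]; first by rewrite mul0r.
case: (ltnP (mdeg m2) b) => [/hq ->|le2]; first by rewrite mulr0.
by move: lt; rewrite e mdegD ltnNge leq_add.
Qed.

Lemma ordgeMl d p q : ordge d p -> ordge d (p * q).
Proof. by move=> hp; rewrite -[d]addn0; apply: ordgeM. Qed.

Lemma ordgeMr d p q : ordge d q -> ordge d (p * q).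
Proof. by rewrite mulrC; apply: ordgeMl. Qed.

Lemma ordgeZ d c p : ordge d p -> ordge d (c *: p).
Proof. by move=> hp m lt; rewrite mcoeffZ hp ?mulr0. Qed.

Lemma ordgeXn d p k : ordge d p -> ordge (d * k) (p ^+ k).
Proof.
move=> hp; elim: k => [|k IH]; first by rewrite muln0; apply: ordge0n.
by rewrite exprS mulnS; apply: ordgeM.
Qed.

Lemma ordge_prod (I : Type) (r : seq I) (d : I -> nat) (F : I -> {mpoly K[n]}) :
  (forall i, ordge (d i) (F i)) -> ordge (\sum_(i <- r) d i) (\prod_(i <- r) F i).
Proof.
move=> h; elim: r => [|i r IH]; first by rewrite !big_nil.
by rewrite !big_cons; apply: ordgeM.
Qed.

Lemma ordgeX m : ordge (mdeg m) 'X_[m].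
Proof. by move=> m'; rewrite mcoeffX; case: eqP => // ->; rewrite ltnn. Qed.

Lemma ordgeX1 i : ordge 1 'X_i.
Proof. by rewrite -(mdeg1 i); apply: ordgeX. Qed.

Lemma ordge_mderiv d p i : ordge d.+1 p -> ordge d p^`M(i).
Proof.
by move=> hp m lt; rewrite mcoeff_deriv hp ?mul0rn// mdegD mdeg1 addn1.
Qed.

Lemma ordge1E p : ordge 1 p <-> p@_0%MM = 0.
Proof.
split=> [->//|h m]; first by rewrite mdeg0.
by rewrite ltnS leqn0 mdeg_eq0 => /eqP ->.
Qed.

(** The bound is strict: the terms of degree at most N are kept by [mtrunc N.+1]. *)
Definition mtrunc d p := \sum_(m <- msupp p | (mdeg m < d)%N) p@_m *: 'X_[m].

Lemma mcoeff_trunc d p m : (mtrunc d p)@_m = if (mdeg m < d)%N then p@_m else 0.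
Proof.
rewrite /mtrunc raddf_sum /=; under eq_bigr do rewrite mcoeffZ mcoeffX.
case: (boolP (m \in msupp p)) => [mp|mNp].
  rewrite big_mkcond (bigD1_seq m) ?msupp_uniq //= eqxx mulr1 big1 ?addr0 //.
  by move=> i /negPf ne; case: ifP => // _; rewrite ne mulr0.
rewrite big_seq_cond big1 => [|i /andP[ip _]].
  by rewrite memN_msupp_eq0 // if_same.
by case: eqP => [E|]; rewrite ?mulr0//; move: mNp; rewrite -E ip.
Qed.

Lemma ordge_trunc d p : ordge d (p - mtrunc d p).
Proof. by move=> m lt; rewrite mcoeffB mcoeff_trunc lt subrr. Qed.

Lemma msize_trunc d p : (msize (mtrunc d p) <= d)%N.
Proof.
rewrite mmeasureE; apply/bigmax_leqP_seq => m.
by rewrite mcoeff_msupp mcoeff_trunc; case: ifP => //; rewrite eqxx.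
Qed.

End Order.

Section Subst.
Variables (n r : nat) (K : comNzRingType).
Variable (h : 'I_n -> {mpoly K[r]}).
Implicit Types (p q : {mpoly K[n]}) (m : 'X_{1..n}).

Definition msub (p : {mpoly K[n]}) : {mpoly K[r]} := mmap (@mpolyC r K) h p.

HB.instance Definition _ := GRing.RMorphism.copy msub (mmap (@mpolyC r K) h).

Lemma msubC c : msub c%:MP = c%:MP.
Proof. by rewrite /msub mmapC. Qed.

Lemma msubX i : msub 'X_i = h i.
Proof. by rewrite /msub mmapX mmap1U. Qed.

Lemma msub_sum (I : Type) (s : seq I) (P : pred I) (E : I -> {mpoly K[n]}) :
  msub (\sum_(i <- s | P i) E i) = \sum_(i <- s | P i) msub (E i).
Proof. exact: raddf_sum. Qed.

Lemma msubXm m : msub 'X_[m] = \prod_i h i ^+ m i.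
Proof. by rewrite /msub mmapX. Qed.

Lemma msubZ c p : msub (c *: p) = c *: msub p.
Proof. by rewrite -!mul_mpolyC rmorphM /= msubC. Qed.

Lemma msubE p : msub p = \sum_(m <- msupp p) p@_m *: \prod_i h i ^+ m i.
Proof.
rewrite {1}(mpolyE p) raddf_sum /=; apply: eq_bigr => m _.
by rewrite msubZ msubXm.
Qed.

Lemma ordge_msub d p : (forall i, ordge 1 (h i)) -> ordge d p -> ordge d (msub p).
Proof.
move=> h1 hp; rewrite msubE big_seq; apply: ordge_sum => m mp.
apply: ordgeZ; have: (d <= mdeg m)%N.
  by rewrite leqNgt; apply/negP => /hp /eqP; rewrite mcoeff_eq0 mp.
move=> /ordgeW; apply; rewrite mdegE; apply: ordge_prod => i.
by rewrite -{1}[m i]mul1n; apply: ordgeXn.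
Qed.

Lemma mderiv_msub p j :
  (msub p)^`M(j) = \sum_i msub p^`M(i) * (h i)^`M(j).
Proof.
elim/mpoly_gen_ind: p => [c|i|p q IHp IHq|p q IHp IHq].
- rewrite msubC mderivC big1 // => i _; by rewrite mderivC rmorph0 mul0r.
- rewrite msubX (bigD1 i) //= mderivX mnm1E eqxx scale1r.
  have ->: (U_(i) - U_(i) = 0)%MM by apply/mnmP => k; rewrite mnmBE subnn mnm0E.
  rewrite mpolyX0 rmorph1 mul1r big1 ?addr0 // => k ne.
  by rewrite mderivX mnm1E eq_sym (negPf ne) scale0r rmorph0 mul0r.
- rewrite rmorphD mderivD IHp IHq -big_split /=; apply: eq_bigr => i _.
  by rewrite mderivD rmorphD mulrDl.
rewrite rmorphM mderivM IHp IHq big_distrl big_distrr -big_split /=.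
apply: eq_bigr => i _; rewrite mderivM rmorphD !rmorphM /= mulrDl.
by congr (_ + _); rewrite -!mulrA //; congr (_ * _); rewrite mulrC.
Qed.

Lemma meval_msub (v : 'I_r -> K) p : (msub p).@[v] = p.@[fun i => (h i).@[v]].
Proof.
elim/mpoly_gen_ind: p => [c|i|p q IHp IHq|p q IHp IHq].
- by rewrite msubC !mevalC.
- by rewrite msubX mevalXU.
- by rewrite rmorphD !mevalD IHp IHq.
by rewrite rmorphM !mevalM IHp IHq.
Qed.
End Subst.

Lemma eq_msub n r (K : comNzRingType) (h h' : 'I_n -> {mpoly K[r]}) p :
  h =1 h' -> msub h p = msub h' p.
Proof.
move=> e; elim/mpoly_gen_ind: p => [c|i|p q IHp IHq|p q IHp IHq].
- by rewrite !msubC.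
- by rewrite !msubX.
- by rewrite !rmorphD /= IHp IHq.
by rewrite !rmorphM /= IHp IHq.
Qed.

Lemma msub_comp n r s (K : comNzRingType) (h : 'I_n -> {mpoly K[r]})
   (k : 'I_r -> {mpoly K[s]}) p : msub k (msub h p) = msub (msub k \o h) p.
Proof.
elim/mpoly_gen_ind: p => [c|i|p q IHp IHq|p q IHp IHq].
- by rewrite !msubC.
- by rewrite !msubX.
- by rewrite !rmorphD /= IHp IHq.
by rewrite !rmorphM /= IHp IHq.
Qed.

Lemma msub_id n (K : comNzRingType) (p : {mpoly K[n]}) : msub (fun i => 'X_i) p = p.
Proof.
elim/mpoly_gen_ind: p => [c|i|p q IHp IHq|p q IHp IHq].
- by rewrite !msubC.
- by rewrite !msubX.
- by rewrite !rmorphD /= IHp IHq.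
by rewrite !rmorphM /= IHp IHq.
Qed.

Lemma ordge_msubB n r (K : comNzRingType) d (h h' : 'I_n -> {mpoly K[r]}) p :
  (forall i, ordge d (h i - h' i)) -> ordge d (msub h p - msub h' p).
Proof.
move=> e; elim/mpoly_gen_ind: p => [c|i|p q IHp IHq|p q IHp IHq].
- by rewrite !msubC subrr; apply: ordge0.
- by rewrite !msubX.
- by rewrite !rmorphD /= opprD addrACA; apply: ordgeD.
rewrite !rmorphM /=.
have -> : msub h p * msub h q - msub h' p * msub h' q =
  (msub h p - msub h' p) * msub h q + msub h' p * (msub h q - msub h' q).
  by rewrite mulrBl mulrBr addrA subrK.
by apply: ordgeD; [apply: ordgeMl|apply: ordgeMr].
Qed.

(** * Restriction of polynomials to curves *)

Section Curve.
Variables (n : nat) (K : comNzRingType) (g : 'I_n -> {poly K}).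
Implicit Types (p q : {mpoly K[n]}).

Definition mcurve (p : {mpoly K[n]}) : {poly K} := mmap (@polyC K) g p.

HB.instance Definition _ := GRing.RMorphism.copy mcurve (mmap (@polyC K) g).

Lemma mcurveC c : mcurve c%:MP = c%:P.
Proof. by rewrite /mcurve mmapC. Qed.

Lemma mcurveX i : mcurve 'X_i = g i.
Proof. by rewrite /mcurve mmapX mmap1U. Qed.

Lemma mcurveXm m : mcurve 'X_[m] = \prod_i g i ^+ m i.
Proof. by rewrite /mcurve mmapX. Qed.

Lemma mcurveZ c p : mcurve (c *: p) = c *: mcurve p.
Proof. by rewrite -!mul_mpolyC rmorphM /= mcurveC mul_polyC. Qed.

Lemma deriv_mcurve p : (mcurve p)^`() = \sum_i mcurve p^`M(i) * (g i)^`().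
Proof.
elim/mpoly_gen_ind: p => [c|i|p q IHp IHq|p q IHp IHq].
- rewrite mcurveC derivC big1 // => i _; by rewrite mderivC rmorph0 mul0r.
- rewrite mcurveX (bigD1 i) //= mderivX mnm1E eqxx scale1r.
  have ->: (U_(i) - U_(i) = 0)%MM by apply/mnmP => k; rewrite mnmBE subnn mnm0E.
  rewrite mpolyX0 rmorph1 mul1r big1 ?addr0 // => k ne.
  by rewrite mderivX mnm1E eq_sym (negPf ne) scale0r rmorph0 mul0r.
- rewrite rmorphD derivD IHp IHq -big_split /=; apply: eq_bigr => i _.
  by rewrite mderivD rmorphD mulrDl.
rewrite rmorphM derivM IHp IHq big_distrl big_distrr -big_split /=.
apply: eq_bigr => i _; rewrite mderivM rmorphD !rmorphM /= mulrDl.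
by congr (_ + _); rewrite -!mulrA //; congr (_ * _); rewrite mulrC.
Qed.

Lemma horner_mcurve t p : (mcurve p).[t] = p.@[fun i => (g i).[t]].
Proof.
elim/mpoly_gen_ind: p => [c|i|p q IHp IHq|p q IHp IHq].
- by rewrite mcurveC hornerC mevalC.
- by rewrite mcurveX mevalXU.
- by rewrite rmorphD hornerD mevalD IHp IHq.
by rewrite rmorphM /= hornerM mevalM IHp IHq.
Qed.
End Curve.

Lemma horner_eq0 (K : numDomainType) (p : {poly K}) :
  (forall x, p.[x] = 0) -> p = 0.
Proof.
move=> h; apply/eqP; apply: contraT => nz.
have /(_ [seq i%:R | i <- iota 0 (size p)]) := max_poly_roots nz.
rewrite size_map size_iota ltnn; apply.
- by apply/allP => x _; apply/rootP.
- by rewrite map_inj_in_uniq ?iota_uniq // => a b _ _ /eqP; rewrite eqr_nat => /eqP.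
Qed.

(** By induction on the degree every partial derivative is 0: it takes only the value 0 because [p]
    vanishes along lines parallel to the axes. In characteristic 0 this leaves the constant term,
    which is the value at the origin. *)
Lemma meval_eq0 n (K : numDomainType) (p : {mpoly K[n]}) :
  (forall v : 'I_n -> K, p.@[v] = 0) -> p = 0.
Proof.
have [k] := ubnP (msize p); elim: k p => // k IH p; rewrite ltnS => szp hp.
have dp i : p^`M(i) = 0.
  have [->|nz] := eqVneq p 0; first exact: mderiv0.
  apply: IH => [|v].
    apply: leq_trans szp; rewrite -(mlead_deg nz) ltnS mmeasureE.
    apply/bigmax_leqP_seq => m; rewrite mcoeff_msupp mcoeff_deriv => mp _.
    have: p@_(m + U_(i)) != 0 by apply: contraNneq mp => ->; rewrite mul0rn.
    rewrite -mcoeff_msupp => /msize_mdeg_lt.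
    by rewrite mdegD mdeg1 addn1 -(mlead_deg nz).
  pose g j : {poly K} := (v j)%:P + (j == i)%:R *: 'X.
  have g0 : mcurve g p = 0 by apply: horner_eq0 => t; rewrite horner_mcurve.
  have := deriv_mcurve g p; rewrite g0 deriv0 => /(congr1 (horner^~ 0)).
  rewrite horner0 horner_sum (bigD1 i) //= big1 => [|j /negPf ne].
    rewrite addr0 hornerM horner_mcurve /g eqxx scale1r derivD derivC derivX.
    rewrite add0r hornerC mulr1 => e; rewrite [RHS]e; apply: meval_eq => j.
    by rewrite hornerD hornerC hornerZ hornerX mulr0 addr0.
  by rewrite /g ne scale0r addr0 derivC mulr0 horner0.
apply/mpolyP => m; rewrite mcoeff0.
have [->|] := eqVneq m 0%MM.
  have h := hp (fun=> 0); rewrite {1}(mpolyE p) raddf_sum /= in h.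
  have [p0|p0] := boolP (0%MM \in msupp p); last exact: memN_msupp_eq0.
  rewrite -[RHS]h (bigD1_seq 0%MM) ?msupp_uniq //= big1 => [|m' ne].
    rewrite addr0 mevalZ mevalX big1 ?mulr1 // => i _; by rewrite mnm0E.
  rewrite mevalZ mevalX.
  have /existsP[i mi] : [exists i, m' i != 0%N].
    apply: contraNT ne; rewrite negb_exists => /forallP hm.
    by apply/eqP/mnmP => i; rewrite mnm0E; apply/eqP; move: (hm i); rewrite negbK.
  by rewrite (bigD1 i) //= expr0n (negPf mi) mul0r mulr0.
move=> ne.
have /existsP[i mi] : [exists i, m i != 0%N].
  apply: contraNT ne; rewrite negb_exists => /forallP hm.
  by apply/eqP/mnmP => i; rewrite mnm0E; apply/eqP; move: (hm i); rewrite negbK.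
have := congr1 (mcoeff (m - U_(i))%MM) (dp i).
rewrite mcoeff_deriv mcoeff0 submK; last by rewrite lep1mP.
by move=> /eqP; rewrite mulrn_eq0 /= => /eqP.
Qed.

(** * Height of an ideal containing all monomials of a degree *)

Lemma mnm_split n (m : 'X_{1..n}) k : (k <= mdeg m)%N ->
  exists m1 m2, m = (m1 + m2)%MM /\ mdeg m1 = k.
Proof.
elim: k => [|k IH] le; first by exists 0%MM, m; rewrite add0m mdeg0.
have [m1 [m2 [e d1]]] := IH (ltnW le).
have /existsP[i mi] : [exists i, m2 i != 0%N].
  apply: contraT; rewrite negb_exists => /forallP hm.
  have e2 : m2 = 0%MM.
    by apply/mnmP => i; rewrite mnm0E; apply/eqP; move: (hm i); rewrite negbK.
  by move: le; rewrite e e2 addm0 d1 ltnn.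
exists (m1 + U_(i))%MM, (m2 - U_(i))%MM; split; last by rewrite mdegD mdeg1 d1 addn1.
by rewrite e -addmA [(U_(i) + _)%MM]addmC submK // lep1mP.
Qed.

Section Count.
Variables (K : fieldType) (r r' N : nat) (g : 'I_r' -> {mpoly K[r]}).
Hypothesis g1 : forall l, ordge 1 (g l).
Hypothesis gN : forall m, mdeg m = N ->
  exists Q : 'I_r' -> {mpoly K[r]}, ordge N.+1 ('X_[m] - \sum_l Q l * g l).

Let Idl d P := exists Q : 'I_r' -> {mpoly K[r]}, ordge d (P - \sum_l Q l * g l).

Let Idl0 d P : ordge d P -> Idl d P.
Proof. by exists (fun=> 0); rewrite big1 ?subr0 // => i _; rewrite mul0r. Qed.

Let IdlD d P P' : Idl d P -> Idl d P' -> Idl d (P + P').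
Proof.
move=> [Q hQ] [Q' hQ']; exists (fun l => Q l + Q' l).
under eq_bigr do rewrite mulrDl.
by rewrite big_split opprD addrACA; apply: ordgeD.
Qed.

Let IdlM e d P P' : ordge e P' -> Idl d P -> Idl (e + d) (P' * P).
Proof.
move=> h [Q hQ]; exists (fun l => P' * Q l).
under eq_bigr do rewrite -mulrA.
by rewrite -mulr_sumr -mulrBr; apply: ordgeM.
Qed.

(** Each monomial of degree D >= N has a factor of degree N, which lies in the ideal up to terms of
    one degree more. *)
Let ideal_step D P : (N <= D)%N -> ordge D P -> Idl D.+1 P.
Proof.
move=> le hP; rewrite -(subrK (mtrunc D.+1 P) P); apply: IdlD.
  by apply: Idl0; apply: ordge_trunc.
rewrite /mtrunc big_seq_cond.
elim/big_ind: _ => [|p q|m /andP[mP mD]]; [|exact: IdlD|].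
  by apply: Idl0; apply: ordge0.
have mdegm : mdeg m = D.
  apply/eqP; rewrite eqn_leq -ltnS mD /= leqNgt; apply/negP => /hP /eqP.
  by rewrite mcoeff_eq0 mP.
have [m1 [m2 [e m1N]]] := @mnm_split _ m N (leq_trans le (eq_leq (esym mdegm))).
rewrite e addmC mpolyXD -mul_mpolyC mulrA.
have <- : (mdeg m2 + N.+1 = D.+1)%N by rewrite -mdegm e mdegD m1N; lia.
apply: IdlM; last exact: gN.
by apply: ordgeMr; apply: ordgeX.
Qed.

Let ideal_iter d P : ordge N P -> Idl (N + d) P.
Proof.
move=> hP; elim: d => [|d [Q hQ]]; first by rewrite addn0; apply: Idl0.
rewrite addnS -(subrK (\sum_l Q l * g l) P); apply: IdlD.
  by apply: ideal_step => //; apply: leq_addr.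
by exists Q; rewrite subrr; apply: ordge0.
Qed.

Variable D : nat.
(** Index set of a spanning family: products of powers of the [g l] with monomials of bounded
    exponents, (D+1)^r' (N+1)^r of them. *)
Let I : finType := ({ffun 'I_r' -> 'I_D.+1} * {ffun 'I_r -> 'I_N.+1})%type.
Let G (i : I) := \prod_l g l ^+ i.1 l * 'X_[[multinom (i.2 k : nat) | k < r]].
Let Sp P := exists c : I -> K, ordge D.+1 (P - \sum_i c i *: G i).

Let SpD P P' : Sp P -> Sp P' -> Sp (P + P').
Proof.
move=> [c hc] [c' hc']; exists (fun i => c i + c' i).
under eq_bigr do rewrite scalerDl.
by rewrite big_split opprD addrACA; apply: ordgeD.
Qed.

Let Sp0 P : ordge D.+1 P -> Sp P.
Proof. by exists (fun=> 0); rewrite big1 ?subr0 // => i _; rewrite scale0r. Qed.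

Let Sp_sum (J : Type) (s : seq J) (Q : pred J) F :
  (forall i, Q i -> Sp (F i)) -> Sp (\sum_(i <- s | Q i) F i).
Proof.
by move=> h; elim/big_ind: _ => //; apply: Sp0; apply: ordge0.
Qed.

(** Splitting off [mtrunc N P] leaves an element of order N, which lies in the ideal up to high
    order and so acquires one more factor [g l]. Once there are more than D factors the product has
    order > D; k bounds the factors still missing. *)
Let span_all k (a : 'I_r' -> nat) P :
  (D < \sum_l a l + k)%N -> Sp (\prod_l g l ^+ a l * P).
Proof.
elim: k a P => [|k IH] a P lt.
  apply: Sp0; apply: ordgeMl; rewrite addn0 in lt; apply: ordgeW lt _.
  by apply: ordge_prod => l; rewrite -{1}[a l]mul1n; apply: ordgeXn.
have [lt'|le] := ltnP D (\sum_l a l).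
  apply: Sp0; apply: ordgeMl; apply: ordgeW lt' _.
  by apply: ordge_prod => l; rewrite -{1}[a l]mul1n; apply: ordgeXn.
have al l : (a l < D.+1)%N.
  by rewrite ltnS; apply: leq_trans le; rewrite (bigD1 l) //= leq_addr.
rewrite -(subrK (mtrunc N P) P) mulrDr; apply: SpD.
  have [Q hQ] := @ideal_iter D.+1 _ (@ordge_trunc _ _ N P).
  rewrite -(subrK (\sum_l Q l * g l) (P - _)) mulrDr; apply: SpD.
    by apply: Sp0; apply: ordgeMr; apply: ordgeW hQ; rewrite leq_addl.
  rewrite mulr_sumr; apply: Sp_sum => l _.
  have -> : \prod_l0 g l0 ^+ a l0 * (Q l * g l) =
     \prod_l0 g l0 ^+ (a l0 + (l0 == l)) * Q l.
    rewrite mulrCA mulrC; congr (_ * _).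
    under [RHS]eq_bigr do rewrite exprD.
    rewrite big_split /=; congr (_ * _).
    by rewrite (bigD1 l) //= eqxx expr1 big1 ?mulr1 // => i /negPf ->.
  apply: IH; rewrite big_split /=.
  suff -> : (\sum_(i < r') (i == l) = 1)%N by rewrite -addnA add1n.
  by rewrite (bigD1 l) //= eqxx big1 // => i /negPf ->.
rewrite /mtrunc mulr_sumr; apply: Sp_sum => m mN.
have mk (k0 : 'I_r) : (m k0 < N.+1)%N.
  by rewrite ltnS; apply: leq_trans (ltnW mN); rewrite mdegE (bigD1 k0) //= leq_addr.
pose i0 : I := ([ffun l => inord (a l)], [ffun k0 => inord (m k0)]).
exists (fun i => (i == i0)%:R * P@_m).
rewrite (bigD1 i0) //= eqxx mul1r [X in _ - (_ + X)]big1 => [|i /negPf ->]; last first.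
  by rewrite mul0r scale0r.
rewrite addr0 /G /= -scalerAr.
suff -> : [multinom (([ffun k0 => inord (m k0)] : {ffun 'I_r -> 'I_N.+1}) k0 : nat) | k0 < r] = m.
  under [X in _ - _ *: (X * _)]eq_bigr do rewrite ffunE inordK //.
  by rewrite subrr; apply: ordge0.
by apply/mnmP => k0; rewrite mnmE ffunE inordK.
Qed.

(** There are (T+1)^r monomials with exponents at most T, all of degree at most D, and the spanning
    family yields them modulo degree D + 1. Taking coefficients factors an identity matrix through
    the index set of the family. *)
Lemma span_card (T : nat) : (r * T <= D)%N ->
  (T.+1 ^ r <= D.+1 ^ r' * N.+1 ^ r)%N.
Proof.
move=> TD; pose J : finType := {ffun 'I_r -> 'I_T.+1}.
have -> : (T.+1 ^ r)%N = #|J| by rewrite card_ffun !card_ord.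
have -> : (D.+1 ^ r' * N.+1 ^ r)%N = #|I| by rewrite card_prod !card_ffun !card_ord.
pose mon (j : J) := [multinom (j k : nat) | k < r].
have monD j : (mdeg (mon j) < D.+1)%N.
  rewrite ltnS mdegE; apply: leq_trans TD.
  rewrite -[r in (r * T)%N]card_ord -sum_nat_const leq_sum // => k _.
  by rewrite mnmE -ltnS.
have /boolp.choice [c hc] : forall j, Sp 'X_[mon j].
  move=> j; have := @span_all D.+1 (fun=> 0%N) 'X_[mon j].
  have -> : \prod_(l < r') g l ^+ 0 = 1 by apply: big1.
  by rewrite mul1r; apply; rewrite addnS ltnS leq_addl.
pose Cm : 'M[K]_(#|J|, #|I|) := \matrix_(a, b) c (enum_val a) (enum_val b).
pose Gm : 'M[K]_(#|I|, #|J|) := \matrix_(b, a) (G (enum_val b))@_(mon (enum_val a)).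
have CG : Cm *m Gm = 1%:M.
  apply/matrixP => a a'; rewrite !mxE.
  have := hc (enum_val a) (mon (enum_val a')) (monD _).
  rewrite mcoeffB mcoeffX raddf_sum /= => /eqP; rewrite subr_eq0 => /eqP e.
  have -> : (a == a') = (mon (enum_val a) == mon (enum_val a')).
    apply/eqP/eqP => [->//|/mnmP em]; apply: enum_val_inj; apply/ffunP => k.
    by apply: val_inj; have := em k; rewrite !mnmE.
  rewrite e (reindex (@enum_val I I)) /=; last exact/onW_bij/enum_val_bij.
  by apply: eq_bigr => b _; rewrite !mxE mcoeffZ.
have := mxrankM_maxl Cm Gm; rewrite CG mxrank1 => /leq_trans; apply.
exact: rank_leq_col.
Qed.
End Count.

(** An elementary form of Krull's height theorem: the monomials of degree at most D grow in number
    like D^r, the spanning family only like D^r'. *)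
Theorem ideal_height (K : fieldType) (r r' N : nat) (g : 'I_r' -> {mpoly K[r]}) :
  (forall l, ordge 1 (g l)) ->
  (forall m, mdeg m = N ->
  exists Q : 'I_r' -> {mpoly K[r]}, ordge N.+1 ('X_[m] - \sum_l Q l * g l)) ->
  (r <= r')%N.
Proof.
move=> g1 gN; rewrite leqNgt; apply/negP => lt.
(* With T = M and D = r M the bound reads (M+1)^r <= (rM+1)^r' (N+1)^r, and the right side is at
   most M (M+1)^r', which is impossible for r' < r. *)
pose M := (r ^ r' * N.+1 ^ r)%N.
have := @span_card _ _ _ _ _ g1 gN (r * M) M (leqnn _).
apply/negP; rewrite -ltnNge.
have r0 : (0 < r)%N by apply: leq_trans lt.
have h1 : ((r * M).+1 <= r * M.+1)%N by nia.
have : ((r * M).+1 ^ r' <= (r * M.+1) ^ r')%N by case: (posnP r') => [->//|r0']; rewrite leq_exp2r.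
rewrite expnMn => h2.
have h3 : (M.+1 ^ r'.+1 <= M.+1 ^ r)%N by rewrite leq_pexp2l.
apply: leq_trans h3; rewrite expnS.
have h4 : (0 < M.+1 ^ r')%N by rewrite expn_gt0.
apply: (@leq_ltn_trans (M * M.+1 ^ r')); last by rewrite ltn_pmul2r.
rewrite {2}/M mulnAC leq_mul2r; apply/orP; right.
by apply: leq_trans h2 _.
Qed.

(** * Linear symmetries and the tangent space *)

(** The derivative of [P] along the linear vector field x -> x A. *)
Definition lie n (K : comNzRingType) (A : 'M[K]_n) (P : {mpoly K[n]}) :=
  \sum_i (\sum_k A k i *: 'X_k) * P^`M(i).

(* (A, B) is an infinitesimal symmetry: F (x exp (t A)) = F (x) exp (t B) *)
Definition eqv n p (K : comNzRingType) (A : 'M[K]_n) (B : 'M[K]_p)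
  (F : 'I_p -> {mpoly K[n]}) := forall j, lie A (F j) = \sum_l B l j *: F l.

(* The tangent space of the contact orbit of F contains all terms of degree N,
   modulo terms of degree > N *)
Definition TK n p (K : comNzRingType) N (F : 'I_p -> {mpoly K[n]}) :=
  forall m j, mdeg m = N ->
  exists (xi : 'I_n -> {mpoly K[n]}) (M : 'I_p -> 'I_p -> {mpoly K[n]}),
  forall l, ordge N.+1 ((l == j)%:R *: 'X_[m] - \sum_i xi i * (F l)^`M(i)
                        - \sum_k F k * M k l).

Lemma mderiv_lie n (K : comNzRingType) (A : 'M[K]_n) (P : {mpoly K[n]}) k : (lie A P)^`M(k) =
  \sum_i A k i *: P^`M(i) + \sum_i (\sum_k A k i *: 'X_k) * P^`M(i)^`M(k).
Proof.
rewrite /lie raddf_sum -big_split /=; apply: eq_bigr => i _.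
rewrite mderivM; congr (_ + _); rewrite raddf_sum (bigD1 k) //= mderivZ mderivX.
rewrite mnm1E eqxx scale1r big1 => [|l /negPf ne]; last first.
  by rewrite mderivZ mderivX mnm1E ne scale0r scaler0.
have ->: (U_(k) - U_(k) = 0)%MM by apply/mnmP => ?; rewrite mnmBE subnn mnm0E.
by rewrite mpolyX0 addr0 -scalerAl mul1r.
Qed.

Section TKgen.
Variables (n p : nat) (K : comNzRingType) (N : nat) (F : 'I_p -> {mpoly K[n]}).
Hypothesis tk : TK N F.

Let T d (h : 'I_p -> {mpoly K[n]}) :=
  exists (xi : 'I_n -> {mpoly K[n]}) (M : 'I_p -> 'I_p -> {mpoly K[n]}),
  forall l, ordge d (h l - \sum_i xi i * (F l)^`M(i) - \sum_k F k * M k l).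

Let TD d h h' : T d h -> T d h' -> T d (fun l => h l + h' l).
Proof.
move=> [x [M e]] [x' [M' e']].
exists (fun i => x i + x' i), (fun i k => M i k + M' i k) => l.
under [X in _ - X - _]eq_bigr do rewrite mulrDl.
under [X in _ - X]eq_bigr do rewrite mulrDr.
rewrite !big_split /=.
suff -> : forall a a' b b' c c' : {mpoly K[n]},
  a + a' - (b + b') - (c + c') = (a - b - c) + (a' - b' - c') by apply: ordgeD.
by move=> *; ring.
Qed.

Let TZ d c h : T d h -> T d (fun l => c *: h l).
Proof.
move=> [x [M e]].
exists (fun i => c *: x i), (fun i k => c *: M i k) => l.
under [X in _ - X - _]eq_bigr do rewrite -scalerAl.
under [X in _ - X]eq_bigr do rewrite -scalerAr.
by rewrite -!scaler_sumr -!scalerBr; apply: ordgeZ.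
Qed.

Let T0 d h : (forall l, ordge d (h l)) -> T d h.
Proof.
move=> e; exists (fun=> 0), (fun _ _ => 0) => l.
by rewrite !big1 ?subr0 // => *; rewrite ?mul0r ?mulr0.
Qed.

Let Teq d h h' : h =1 h' -> T d h -> T d h'.
Proof. by move=> e [x [M H]]; exists x, M => l; rewrite -e. Qed.

Lemma TK_gen (phi : {mpoly K[n]}) (y : 'I_p -> K) : ordge N phi ->
  exists (xi : 'I_n -> {mpoly K[n]}) (M : 'I_p -> 'I_p -> {mpoly K[n]}),
  forall l, ordge N.+1 (y l *: phi - \sum_i xi i * (F l)^`M(i)
                        - \sum_k F k * M k l).
Proof.
move=> hphi; rewrite -/(T N.+1 (fun l => y l *: phi)).
apply: (@Teq _ (fun l => y l *: (phi - mtrunc N.+1 phi) + y l *: mtrunc N.+1 phi)).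
  by move=> l; rewrite -scalerDr subrK.
apply: TD; first by apply: T0 => l; apply/ordgeZ/ordge_trunc.
have Ty m : mdeg m = N -> T N.+1 (fun l => y l *: 'X_[m]).
  move=> mN; apply: (@Teq _ (fun l => \sum_j y j *: ((l == j)%:R *: 'X_[m]))).
    move=> l; rewrite (bigD1 l) //= eqxx scale1r big1 ?addr0 // => j.
    by rewrite eq_sym => /negPf ->; rewrite scale0r scaler0.
  have gen (s : seq 'I_p) :
      T N.+1 (fun l => \sum_(j <- s) y j *: ((l == j)%:R *: 'X_[m])).
    elim: s => [|j s IH].
      by apply: T0 => l; rewrite big_nil; apply: ordge0.
    apply: (@Teq _ (fun l => y j *: ((l == j)%:R *: 'X_[m]) +
       \sum_(j <- s) y j *: ((l == j)%:R *: 'X_[m]))).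
      by move=> l; rewrite big_cons.
    by apply: TD IH; apply: TZ; apply: tk.
  exact: gen.
rewrite /mtrunc.
have : forall m, m \in msupp phi -> (mdeg m < N.+1)%N -> mdeg m = N.
  move=> m mP mD; apply/eqP; rewrite eqn_leq -ltnS mD /= leqNgt.
  by apply/negP => /hphi /eqP; rewrite mcoeff_eq0 mP.
elim: (msupp phi) => [|m s IH] hs.
  by apply: T0 => l; rewrite big_nil scaler0; apply: ordge0.
have {}IH := IH (fun m0 (m0s : m0 \in s) => hs m0 (@mem_behead _ (m :: s) m0 m0s)).
have [mN|mN] := boolP (mdeg m < N.+1)%N; last first.
  by apply: Teq IH => l; rewrite big_cons (negPf mN).
apply: (@Teq _ (fun l => phi@_m *: (y l *: 'X_[m]) + 
   y l *: \sum_(j <- s | (mdeg j < N.+1)%N) phi@_j *: 'X_[j])).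
  by move=> l; rewrite big_cons mN scalerDr !scalerA mulrC.
by apply: TD IH; apply: TZ; apply: Ty; apply: hs; rewrite ?mem_head.
Qed.
End TKgen.

Section Restr.
Variables (n r : nat) (K : comNzRingType) (u : 'M[K]_(r, n)).

(** The coordinates of the point s u: substituting them restricts a polynomial to the row space of
    [u], with the entries of s as variables. *)
Definition linsub (i : 'I_n) : {mpoly K[r]} := \sum_a u a i *: 'X_a.

Lemma ordge_linsub i : ordge 1 (linsub i).
Proof. by apply: ordge_sum => a _; apply/ordgeZ/ordgeX1. Qed.

Lemma meval_linsub (v : 'I_r -> K) i : (linsub i).@[v] = \sum_a v a * u a i.
Proof.
by rewrite raddf_sum /=; apply: eq_bigr => a _; rewrite mevalZ mevalXU mulrC.
Qed.

Lemma msub_linX (A : 'M[K]_n) i :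
  msub linsub (\sum_k A k i *: 'X_k) = \sum_a (u *m A) a i *: 'X_a.
Proof.
rewrite msub_sum; under eq_bigr do rewrite msubZ msubX scaler_sumr.
rewrite exchange_big /=; apply: eq_bigr => a _.
by rewrite !mxE scaler_suml; apply: eq_bigr => k _; rewrite scalerA mulrC.
Qed.

End Restr.

Section FixedSubspace.
Variables (K : fieldType) (n p N : nat) (F : 'I_p -> {mpoly K[n]}).
Hypotheses (tk : TK N F) (F2 : forall j, ordge 2 (F j)).
Variables (A : 'M[K]_n) (B : 'M[K]_p) (eqvF : eqv A B F).
Variables (r : nat) (u : 'M[K]_(r, n)) (u_free : row_free u) (uA : u *m A = 0).

Definition jac m : 'M[K]_(n, p) := \matrix_(i, j) (msub (linsub u) (F j)^`M(i))@_m.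

Lemma jac_intertwine m : A *m jac m = jac m *m B.
Proof.
apply/matrixP => k j; rewrite !mxE.
have := congr1 (fun P => (msub (linsub u) P^`M(k))@_m) (eqvF j).
rewrite mderiv_lie rmorphD /=.
have -> : msub (linsub u) (\sum_i (\sum_k0 A k0 i *: 'X_k0) * (F j)^`M(i)^`M(k)) = 0.
  rewrite msub_sum big1 //= => i _.
  rewrite rmorphM /= msub_linX uA big1 ?mul0r // => a _.
  by rewrite mxE scale0r.
rewrite addr0 msub_sum raddf_sum [X in msub _ X](raddf_sum (mderiv k)) msub_sum raddf_sum /= => e.
transitivity (\sum_i (msub (linsub u) (A k i *: (F j)^`M(i)))@_m).
  by apply: eq_bigr => i _; rewrite mxE msubZ mcoeffZ.
rewrite {}e; apply: eq_bigr => l _; rewrite mxE mderivZ msubZ mcoeffZ.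
by rewrite mulrC.
Qed.

(** Pairing the target with [z] kills the Jacobian part of the tangent space condition on the row
    space of [u]. What remains expresses every monomial of degree N through the components of [F]
    along a basis of [u'], and [ideal_height] applies. *)
Theorem fixed_subspace_rank (s : nat) (u' : 'M[K]_(s, p)) (z : 'cV[K]_p) :
  (forall m, (\row_j (msub (linsub u) (F j))@_m <= u')%MS) ->
  z != 0 -> (forall J : 'M[K]_(n, p), A *m J = J *m B -> J *m z = 0) ->
  (r <= \rank u')%N.
Proof.
move=> hu' z0 hJ; set v := row_base u'.
(* A target vector with y z = 1: the pairing with [z] turns y phi into phi. *)
have [y yz] : exists y : 'I_p -> K, \sum_l y l * z l 0 = 1.
  have /existsP[l zl] : [exists l, z l 0 != 0].
    apply: contraNT z0; rewrite negb_exists => /forallP h; apply/eqP/colP => l.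
    by rewrite mxE; apply/eqP; have := h l; rewrite negbK.
  exists (fun k => (k == l)%:R * (z l 0)^-1).
  rewrite (bigD1 l) //= eqxx mul1r mulVf // big1 ?addr0 // => k /negPf ->.
  by rewrite !mul0r.
have [w uw] := row_freeP u_free.
pose R := msub (linsub u).
have RB a b : R (a - b) = R a - R b by exact: rmorphB.
have RM a b : R (a * b) = R a * R b by exact: rmorphM.
pose g b := \sum_j (pinvmx v) j b *: R (F j).
have RF k : R (F k) = \sum_b v b k *: g b.
  apply/mpolyP => m; rewrite [RHS]raddf_sum /=.
  have := hu' m; rewrite -(eq_row_base u') => /mulmxKpV /rowP /(_ k).
  rewrite !mxE -/(R (F k)) => <-; apply: eq_bigr => b _; rewrite mcoeffZ mulrC; congr (_ * _).
  rewrite !mxE raddf_sum /=; apply: eq_bigr => j _; rewrite mcoeffZ mxE.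
  by rewrite mulrC.
have RZ : forall i, \sum_l z l 0 *: R (F l)^`M(i) = 0.
  move=> i; apply/mpolyP => m; rewrite mcoeff0 raddf_sum /=.
  have /colP /(_ i) := hJ _ (jac_intertwine m); rewrite !mxE => e0; rewrite -[RHS]e0.
  by apply: eq_bigr => l _; rewrite mcoeffZ mxE mulrC.
apply: (@ideal_height K r _ N g).
  move=> b; apply: ordge_sum => j _; apply: ordgeZ.
  apply: ordge_msub; first exact: ordge_linsub.
  by apply: ordgeW (F2 j).
(* Since [w] is a right inverse of [u], phi is a polynomial on the whole source that restricts to
   ['X_[m]]. *)
move=> m mN; pose phi := \prod_a (\sum_i w i a *: 'X_i) ^+ m a : {mpoly K[n]}.
have phiN : ordge N phi.
  rewrite -mN mdegE; apply: ordge_prod => a; rewrite -{1}[m a]mul1n; apply: ordgeXn.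
  by apply: ordge_sum => i _; apply/ordgeZ/ordgeX1.
have Rphi : R phi = 'X_[m].
  rewrite /R rmorph_prod mpolyXE_id; apply: eq_bigr => a _; rewrite rmorphXn /=.
  congr (_ ^+ _); rewrite msub_sum.
  under eq_bigr do rewrite msubZ msubX scaler_sumr.
  rewrite exchange_big /= (bigD1 a) //= [X in _ + X]big1 => [|b ba].
    rewrite addr0; under eq_bigr do rewrite scalerA mulrC.
    rewrite -scaler_suml; have /matrixP /(_ a a) := uw; rewrite !mxE eqxx => ->.
    by rewrite scale1r.
  under eq_bigr do rewrite scalerA mulrC.
  rewrite -scaler_suml; have /matrixP /(_ b a) := uw; rewrite !mxE (negPf ba) => ->.
  by rewrite scale0r.
have [xi [M hM]] := TK_gen tk y phiN.
exists (fun b => \sum_k v b k *: \sum_l z l 0 *: R (M k l)).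
have : ordge N.+1 (\sum_l z l 0 *: R (y l *: phi - \sum_i xi i * (F l)^`M(i) - \sum_k F k * M k l)).
  apply: ordge_sum => l _; apply: ordgeZ; apply: ordge_msub => //.
  exact: ordge_linsub.
congr ordge.
under eq_bigr do rewrite !RB !scalerBr.
rewrite !sumrB; congr (_ - _).
  rewrite -[RHS]subr0; congr (_ - _).
    under eq_bigr do rewrite /R msubZ -/R Rphi scalerA mulrC.
    by rewrite -scaler_suml yz scale1r.
  transitivity (\sum_i R (xi i) * \sum_l z l 0 *: R (F l)^`M(i)).
    under eq_bigr do rewrite /R msub_sum scaler_sumr -/R.
    rewrite exchange_big /=; apply: eq_bigr => i _; rewrite mulr_sumr.
    by apply: eq_bigr => l _; rewrite RM scalerAr.
  by rewrite big1 // => i _; rewrite RZ mulr0.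
transitivity (\sum_k R (F k) * \sum_l z l 0 *: R (M k l)).
  under eq_bigr do rewrite /R msub_sum scaler_sumr -/R.
  rewrite exchange_big /=; apply: eq_bigr => i _; rewrite mulr_sumr.
  by apply: eq_bigr => l _; rewrite RM scalerAr.
transitivity (\sum_k \sum_b (v b k *: \sum_l z l 0 *: R (M k l)) * g b).
  apply: eq_bigr => k _; rewrite RF mulr_suml; apply: eq_bigr => b _.
  by rewrite -!scalerAl [g b * _]mulrC.
by rewrite exchange_big /=; apply: eq_bigr => b _; rewrite mulr_suml.
Qed.
End FixedSubspace.

(** * Real skew matrices *)

From mathcomp Require Import spectral.
Import Num.Def.

Section Skew.
Variable C : numClosedFieldType.

(** Real skew matrices are kept over the closed field, where the spectral theorem diagonalizes
    them. *)
Definition rskew n (A : 'M[C]_n) := (A \is a mxOver Num.real) /\ A^T = - A.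

Local Notation cj := (map_mx conjC).

Lemma rskew_conj n (A : 'M[C]_n) : rskew A -> cj A = A.
Proof. by case=> /realmxC. Qed.

Lemma conj_eigen n (A : 'M[C]_n) (x : 'rV_n) l : rskew A ->
  x *m A = l *: x -> cj x *m A = conjC l *: cj x.
Proof.
move=> rA e; have := congr1 cj e.
by rewrite map_mxM (rskew_conj rA) map_mxZ.
Qed.

Lemma dot_gt0 n (x : 'rV[C]_n) : x != 0 -> 0 < (x *m (cj x)^T) 0 0.
Proof.
move=> x0; rewrite mxE; under eq_bigr do rewrite !mxE.
have nn i : 0 <= x 0 i * conjC (x 0 i) by rewrite mul_conjC_ge0.
rewrite lt_def sumr_ge0 // andbT psumr_neq0 //.
apply: contraNT x0 => /hasPn h; apply/eqP/rowP => i; rewrite mxE.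
apply/eqP; have := h i (mem_index_enum i); rewrite /= lt_def nn andbT negbK.
by rewrite mul_conjC_eq0.
Qed.

Lemma skew_eigen_imag n (A : 'M[C]_n) (x : 'rV_n) l : rskew A -> x != 0 ->
  x *m A = l *: x -> conjC l = - l.
Proof.
move=> rA x0 e; have s0 := lt0r_neq0 (dot_gt0 x0).
have e1 : x *m A *m (cj x)^T = l *: (x *m (cj x)^T) by rewrite e scalemxAl.
have e2 : x *m A *m (cj x)^T = - conjC l *: (x *m (cj x)^T).
  rewrite -mulmxA; have -> : A *m (cj x)^T = (- (cj x *m A))^T.
    by rewrite linearN /= trmx_mul; case: rA => _ ->; rewrite mulNmx opprK.
  by rewrite (conj_eigen rA e) -scaleNr linearZ /= -scalemxAr.
have /matrixP/(_ 0 0) := etrans (esym e1) e2.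
by rewrite [LHS]mxE [RHS]mxE => /(mulIf s0) el; rewrite {2}el opprK.
Qed.

Lemma normal_eigenbasis n (A : 'M[C]_n) : A \is normalmx ->
  exists P d, P \in unitmx /\ P *m A = diag_mx d *m P.
Proof.
move=> /orthomx_spectralP e; exists (spectralmx A), (spectral_diag A).
have uP := spectral_unit A; split => //.
by have := congr1 (mulmx (spectralmx A)) e; rewrite !mulmxA mulmxV // mul1mx.
Qed.

Lemma rskew_eigenbasis n (A : 'M[C]_n) : rskew A ->
  exists P d, P \in unitmx /\ P *m A = diag_mx d *m P.
Proof.
move=> rA; apply: normal_eigenbasis; apply/normalmxP.
by rewrite -map_trmx (rskew_conj rA); case: rA => _ ->; rewrite mulmxN mulNmx.
Qed.

Lemma eigenrow n (A P : 'M[C]_n) d i : P \in unitmx -> P *m A = diag_mx d *m P ->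
  row i P != 0 /\ row i P *m A = d 0 i *: row i P.
Proof.
move=> uP e; split.
  apply: contraTneq uP => r0; rewrite -row_free_unit; apply/negP => /row_freeP[Q PQ].
  have := congr1 (row i) PQ; rewrite row_mul r0 mul0mx => /rowP /(_ i).
  by rewrite !mxE eqxx => /esym/eqP; rewrite oner_eq0.
by rewrite -row_mul e; apply/rowP => k; rewrite mul_diag_mx !mxE.
Qed.

Lemma eigen_diag n (A P : 'M[C]_n) d (x : 'rV_n) l : P \in unitmx ->
  P *m A = diag_mx d *m P -> x != 0 -> x *m A = l *: x -> exists i, d 0 i = l.
Proof.
move=> uP e x0 ex.
have [y xy] : exists y : 'rV_n, x = y *m P by exists (x *m invmx P); rewrite mulmxKV.
have ey : y *m diag_mx d = l *: y.
  apply: (can_inj (mulmxK uP)); rewrite -mulmxA -e mulmxA -xy ex.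
  by rewrite -scalemxAl -xy.
have /existsP[i yi] : [exists i, y 0 i != 0].
  apply: contraNT x0; rewrite negb_exists => /forallP h; rewrite xy.
  suff -> : y = 0 by rewrite mul0mx.
  by apply/rowP => i; rewrite [RHS]mxE; apply/eqP; have := h i; rewrite negbK.
exists i; by have /rowP /(_ i) := ey; rewrite mul_mx_diag !mxE mulrC => /(mulIf yi).
Qed.

(** The order of [C] is only partial, so maxima are taken over lists of real elements. *)
Lemma max_real (s : seq C) : s != [::] -> {subset s <= Num.real} ->
  exists2 w, w \in s & forall v, v \in s -> v <= w.
Proof.
elim: s => // a [_ _ h|b s IH _ h].
  by exists a; rewrite ?mem_head // => v; rewrite inE => /eqP ->.
have [||w ws hw] := IH; [by []|by move=> v vs; apply: h; rewrite inE vs orbT|].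
have [aw|wa] := real_leP (h _ (mem_head _ _)) (h w (mem_behead (s := a :: b :: s) ws)).
  exists w; first by rewrite inE ws orbT.
  by move=> v; rewrite inE => /orP[/eqP ->//|/hw].
exists a; first exact: mem_head.
move=> v; rewrite inE => /orP[/eqP ->//|/hw /le_trans]; apply; exact: ltW.
Qed.

Lemma imag_norm (l : C) : conjC l = - l -> exists2 w, w \is Num.real & l = 'i * w.
Proof.
move=> e; exists (- 'i * l); last by rewrite mulrA mulrN -expr2 sqrCi opprK mul1r.
by apply/CrealP; rewrite rmorphM /= rmorphN /= conjCi e opprK mulrN mulNr.
Qed.

Lemma norm_i (w : C) : w \is Num.real -> `|'i * w| = `|w|.
Proof. by rewrite normrM normCi mul1r. Qed.

(** Eigenvalues are purely imaginary, and conjugating an eigenvector reverses the sign of its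
    eigenvalue; one of largest modulus may thus be taken with w >= 0. *)
Lemma max_weight n (A : 'M[C]_n) : (0 < n)%N -> rskew A ->
  exists (w : C) (x : 'rV[C]_n), [/\ 0 <= w, x != 0, x *m A = ('i * w) *: x &
    forall (y : 'rV[C]_n) l, y != 0 -> y *m A = l *: y -> `|l| <= w].
Proof.
move=> n0 rA; have [P [d [uP e]]] := rskew_eigenbasis rA.
have dR i : exists2 w, w \is Num.real & d 0 i = 'i * w.
  by have [r0 er] := eigenrow i uP e; apply/imag_norm/(skew_eigen_imag rA r0 er).
pose s := [seq `|d 0 i| | i : 'I_n].
have [||w0 /mapP[i _ ->] hw] := @max_real s.
- by rewrite -size_eq0 size_map -cardE card_ord -lt0n.
- by move=> v /mapP[i _ ->]; apply: normr_real.
have le (y : 'rV_n) l : y != 0 -> y *m A = l *: y -> `|l| <= `|d 0 i|.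
  move=> y0 ey; have [k <-] := eigen_diag uP e y0 ey; apply: hw.
  by apply/mapP; exists k; rewrite ?mem_enum.
have [r0 er] := eigenrow i uP e; have [w wR ew] := dR i.
have [wp|wn] := real_leP (real0 _) wR.
  exists `|d 0 i|, (row i P); split => //; first by rewrite ew norm_i // (ger0_norm wp) -ew.
exists `|d 0 i|, (cj (row i P)); split => //.
  by rewrite map_mx_eq0.
rewrite (conj_eigen rA er) ew norm_i // (ltr0_norm wn) rmorphM /= conjCi.
by rewrite (CrealP wR) mulNr mulrN.
Qed.

Lemma weight0 n (A : 'M[C]_n) : rskew A ->
  (forall (y : 'rV[C]_n) l, y != 0 -> y *m A = l *: y -> l = 0) -> A = 0.
Proof.
move=> rA h; have [P [d [uP e]]] := rskew_eigenbasis rA.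
have d0 : diag_mx d = 0.
  apply/matrixP => i j; rewrite !mxE; have [r0 er] := eigenrow i uP e.
  by rewrite (h _ _ r0 er) mul0rn.
apply: (can_inj (mulKmx uP)); by rewrite e d0 mul0mx mulmx0.
Qed.
End Skew.

Lemma coef_mcurve_lin n (K : comNzRingType) (x : 'I_n -> K) d P k :
  ordge d P -> (k < d)%N -> (mcurve (fun i => x i *: 'X) P)`_k = 0.
Proof.
move=> hP kd; rewrite (mpolyE P) raddf_sum /= coef_sum big_seq big1 // => m mP.
rewrite mcurveZ mcurveXm coefZ.
have dm : (d <= mdeg m)%N by rewrite leqNgt; apply/negP => /hP /eqP; rewrite mcoeff_eq0 mP.
have -> : \prod_i (x i *: 'X) ^+ m i = (\prod_i x i ^+ m i) *: 'X^(mdeg m) :> {poly K}.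
  under eq_bigr do rewrite exprZn.
  by rewrite scaler_prod mdegE expr_sum.
by rewrite coefZ coefXn; case: eqP => [E|]; rewrite ?mulr0 //; lia.
Qed.

(** * Weights *)

Section LineRestriction.
Variables (K : comNzRingType) (n p : nat) (F : 'I_p -> {mpoly K[n]}).
Variables (A : 'M[K]_n) (B : 'M[K]_p) (eqvF : eqv A B F).
Variables (x : 'rV[K]_n) (l : K) (xA : x *m A = l *: x).

Definition ray (P : {mpoly K[n]}) : {poly K} := mcurve (fun i => x 0 i *: 'X) P.

Lemma ray_sum (I : Type) (s : seq I) (Q : pred I) (E : I -> {mpoly K[n]}) :
  ray (\sum_(i <- s | Q i) E i) = \sum_(i <- s | Q i) ray (E i).
Proof. exact: raddf_sum. Qed.
Lemma rayM P Q : ray (P * Q) = ray P * ray Q. Proof. exact: rmorphM. Qed.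
Lemma rayB P Q : ray (P - Q) = ray P - ray Q. Proof. exact: rmorphB. Qed.
Lemma rayD P Q : ray (P + Q) = ray P + ray Q. Proof. exact: rmorphD. Qed.
Lemma rayZ c P : ray (c *: P) = c *: ray P. Proof. exact: mcurveZ. Qed.
Lemma rayX i : ray 'X_i = x 0 i *: 'X. Proof. exact: mcurveX. Qed.

Lemma deriv_ray P : (ray P)^`() = \sum_i x 0 i *: ray P^`M(i).
Proof.
rewrite /ray deriv_mcurve; apply: eq_bigr => i _.
by rewrite derivZ derivX -scalerAr mulr1.
Qed.

Lemma ray_field i : ray (\sum_k A k i *: 'X_k) = (l * x 0 i) *: 'X.
Proof.
have /rowP/(_ i) := xA; rewrite !mxE => <-.
rewrite ray_sum scaler_suml; apply: eq_bigr => k _.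
by rewrite rayZ rayX scalerA mulrC.
Qed.

(** Along the eigenline the field x A is l times the Euler field t d/dt, so the coefficient of t^m
    in F(t x) has weight m l. *)
Lemma ray_coef m : (\row_j (ray (F j))`_m) *m B = (l *+ m) *: \row_j (ray (F j))`_m.
Proof.
apply/rowP => j; rewrite !mxE.
have := congr1 ray (eqvF j); rewrite ray_sum /lie ray_sum.
have -> : \sum_i ray ((\sum_k A k i *: 'X_k) * (F j)^`M(i)) = l *: ('X * (ray (F j))^`()).
  rewrite deriv_ray mulr_sumr scaler_sumr; apply: eq_bigr => i _.
  by rewrite rayM ray_field -scalerAl -scalerAr scalerA.
move=> /(congr1 (fun q : {poly K} => q`_m)); rewrite coefZ coefXM coef_deriv coef_sum.
under [X in _ = X -> _]eq_bigr do rewrite rayZ coefZ mulrC.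
move=> e; under eq_bigr do rewrite mxE.
rewrite -e; case: m {e} => [|m] /=; first by rewrite mulr0 mulr0n mul0r.
by rewrite mulrnAl mulrnAr.
Qed.

Definition ray_jac m : 'M[K]_(n, p) := \matrix_(i, j) (ray (F j)^`M(i))`_m.

(** The derivative of the symmetry equation is restricted to the eigenline; its second-order term is
    again l t d/dt, which accounts for the shift by m l. *)
Lemma ray_jac_intertwine m : A *m ray_jac m + (l *+ m) *: ray_jac m = ray_jac m *m B.
Proof.
apply/matrixP => k j; rewrite !mxE.
have E1 : ray (lie A (F j))^`M(k) =
    \sum_i A k i *: ray (F j)^`M(i) + l *: ('X * (ray (F j)^`M(k))^`()).
  rewrite mderiv_lie rayD; congr (_ + _).
    by rewrite ray_sum; apply: eq_bigr => i _; rewrite rayZ.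
  rewrite deriv_ray mulr_sumr scaler_sumr ray_sum; apply: eq_bigr => i _.
  by rewrite rayM ray_field -scalerAl -scalerAr scalerA mderiv_comm.
have E2 : ray (\sum_l B l j *: F l)^`M(k) = \sum_l B l j *: ray (F l)^`M(k).
  rewrite raddf_sum ray_sum; apply: eq_bigr => i _.
  by rewrite -rayZ -mderivZ.
have /(congr1 (fun q : {poly K} => q`_m)) : \sum_i A k i *: ray (F j)^`M(i) + 
   l *: ('X * (ray (F j)^`M(k))^`()) = \sum_l B l j *: ray (F l)^`M(k).
  by rewrite -E1 -E2 eqvF.
rewrite coefD coef_sum coefZ coefXM coef_deriv [RHS]coef_sum => e.
transitivity (\sum_i (A k i *: (ray (F j)^`M(i)))`_m + l *+ m * (ray (F j)^`M(k))`_m).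
  by congr (_ + _); apply: eq_bigr => i _; rewrite mxE coefZ.
transitivity (\sum_i (B i j *: ray (F i)^`M(k))`_m); last first.
  by apply: eq_bigr => i _; rewrite coefZ !mxE mulrC.
rewrite -e; congr (_ + _); case: m {e} => [|m] /=; first by rewrite mulr0 mulr0n mul0r.
by rewrite mulrnAl mulrnAr.
Qed.
End LineRestriction.

(** On a line where [F] vanishes and [z] kills the Jacobian, pairing the tangent space condition
    with [z] leaves z_j t^N, where t^N comes from a power of a coordinate normalized on the line. So
    z_j = 0 for every j. *)
Lemma ray_TK (K : fieldType) n p N (F : 'I_p -> {mpoly K[n]}) (x : 'rV[K]_n) (z : 'cV_p) :
  TK N F -> x != 0 -> (forall j, ray x (F j) = 0) ->
  (forall m, ray_jac F x m *m z = 0) -> z = 0.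
Proof.
move=> tk x0 Fx hz; apply/colP => j; rewrite mxE.
have /existsP[i xi] : [exists i, x 0 i != 0].
  apply: contraNT x0; rewrite negb_exists => /forallP h.
  by apply/eqP/rowP => i; rewrite mxE; apply/eqP; have := h i; rewrite negbK.
pose phi : {mpoly K[n]} := (x 0 i ^- N) *: 'X_i ^+ N.
have hphi : ordge N phi.
  by apply: ordgeZ; rewrite -{1}[N]mul1n; apply: ordgeXn; apply: ordgeX1.
have [xi' [M h]] := TK_gen tk (fun l => (l == j)%:R) hphi.
have h2 l : (ray x ((l == j)%:R *: phi - \sum_i xi' i * (F l)^`M(i)))`_N = 0.
  have := coef_mcurve_lin (fun i => x 0 i) (h l) (ltnSn N); rewrite -/(ray x _).
  have F0 : ray x (\sum_k F k * M k l) = 0.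
    by rewrite ray_sum big1 // => k _; rewrite rayM Fx mul0r.
  by rewrite rayB F0 subr0.
have : \sum_l z l 0 *: ray x ((l == j)%:R *: phi - \sum_i xi' i * (F l)^`M(i)) =
       z j 0 *: 'X^N.
  transitivity (\sum_l (z l 0 * (l == j)%:R) *: 'X^N - 
     \sum_i ray x (xi' i) * \sum_l z l 0 *: ray x (F l)^`M(i)).
    under eq_bigr do rewrite rayB scalerBr.
    rewrite sumrB; congr (_ - _).
      apply: eq_bigr => l _; rewrite rayZ scalerA; congr (_ *: _).
      rewrite /phi rayZ.
      have -> : ray x ('X_i ^+ N) = (x 0 i *: 'X) ^+ N by rewrite /ray rmorphXn /= mcurveX.
      by rewrite exprZn scalerA mulVf ?scale1r // expf_neq0.
    under eq_bigr do rewrite ray_sum scaler_sumr.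
    rewrite exchange_big /=; apply: eq_bigr => k _; rewrite mulr_sumr.
    by apply: eq_bigr => l _; rewrite rayM scalerAr.
  rewrite [X in _ - X]big1 => [|k _].
    rewrite subr0 (bigD1 j) //= eqxx mulr1 big1 ?addr0 // => l /negPf ->.
    by rewrite mulr0 scale0r.
  suff -> : \sum_l z l 0 *: ray x (F l)^`M(k) = 0 by rewrite mulr0.
  apply/polyP => m; rewrite coef0 coef_sum.
  have /colP/(_ k) := hz m; rewrite !mxE => e; rewrite -[RHS]e.
  by apply: eq_bigr => l _; rewrite coefZ mxE mulrC.
move=> /(congr1 (fun q : {poly K} => q`_N)); rewrite coefZ coefXn eqxx mulr1 => <-.
by rewrite coef_sum big1 // => l _; rewrite coefZ h2 mulr0.
Qed.

Lemma coef0_ray (K : comNzRingType) n (x : 'rV[K]_n) P : (ray x P)`_0 = P@_0%MM.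
Proof.
have h : ordge 1 (P - (P@_0%MM)%:MP).
  by apply/ordge1E; rewrite mcoeffB mcoeffC eqxx mulr1 subrr.
have := coef_mcurve_lin (fun i => x 0 i) h (ltnSn 0); rewrite -/(ray x _) rayB coefB.
by move/eqP; rewrite subr_eq0 /ray mcurveC coefC eqxx => /eqP.
Qed.

Lemma coef1_ray (K : comNzRingType) n (x : 'rV[K]_n) P :
  (ray x P)`_1 = \sum_k x 0 k * P@_U_(k)%MM.
Proof.
have := coef_deriv (ray x P) 0; rewrite mulr1n => <-.
rewrite deriv_ray coef_sum; apply: eq_bigr => k _.
by rewrite coefZ coef0_ray mcoeff_deriv add0m mnm0E mulr1n.
Qed.

(** * The gap between the largest weights of source and target *)

Section WeightGap.
Variables (C : numClosedFieldType) (n p N : nat) (F : 'I_p -> {mpoly C[n]}).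
Hypotheses (tk : TK N F) (F2 : forall j, ordge 2 (F j)).
Variables (A : 'M[C]_n) (B : 'M[C]_p) (eqvF : eqv A B F).
Hypotheses (rA : rskew A) (rB : rskew B) (A0 : A != 0).
Hypothesis hp : (1 < p)%N \/ (0 < p)%N /\ forall j, ordge 3 (F j).

Lemma ray_jac_eigen (x : 'rV[C]_n) (w mu : C) m (z : 'cV[C]_p) :
  x *m A = w *: x -> B *m z = mu *: z ->
  (ray_jac F x m *m z)^T *m A = (w *+ m - mu) *: (ray_jac F x m *m z)^T.
Proof.
move=> xA Bz; have := congr1 (mulmx^~ z) (ray_jac_intertwine eqvF xA m).
rewrite mulmxDl -mulmxA -scalemxAl -[RHS]mulmxA Bz -scalemxAr => e.
apply: trmx_inj; rewrite trmx_mul trmxK linearZ /= trmxK.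
case: (rA) => _ ->; rewrite mulNmx; apply/eqP; rewrite eqr_oppLR -scaleNr opprB.
by rewrite scalerBl -e addrK.
Qed.

Theorem weight_gap : exists (w d : C) (y : 'rV[C]_p), 
  [/\ 0 < w, w *+ 2 <= d,
     forall (x : 'rV[C]_n) l, x != 0 -> x *m A = l *: x -> `|l| <= w,
     forall (x : 'rV[C]_p) l, x != 0 -> x *m B = l *: x -> `|l| <= d
   & y != 0 /\ y *m B = - ('i * d) *: y].
Proof.
have p0 : (0 < p)%N by case: hp => [|[]//]; apply: ltnW.
have n0 : (0 < n)%N.
  have [e|//] := posnP n; case/eqP: A0; apply/matrixP => -[i hi]; exfalso.
  by move: hi; rewrite e.
have [w [x [w0 x0 xA wmax]]] := max_weight n0 rA.
have [d [y [d0 y0 yB dmax]]] := max_weight p0 rB.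
have {}w0 : 0 < w.
  rewrite lt_def w0 andbT; apply: contraNneq A0 => e; apply/eqP/(weight0 rA).
  by move=> u l u0 /(wmax _ _ u0); rewrite e normr_le0 => /eqP.
have wR := gtr0_real w0; have dR := ger0_real d0.
exists w, d, (map_mx conjC y).
suff gap : w *+ 2 <= d.
  split => //; split; first by rewrite map_mx_eq0.
  rewrite (conj_eigen rB yB) rmorphM /= conjCi; congr (_ *: _).
  by rewrite mulNr (CrealP dR).
(* From here on d < 2w is refuted. *)
have [//|dw] := real_leP (rpredMn _ wR) dR.
(* A nonzero coefficient of t^m in F(t u), m >= 2, would be an eigenvector of [B] of weight m w >
   d. *)
have FV (u : 'rV[C]_n) : u *m A = ('i * w) *: u -> forall j, ray u (F j) = 0.
  move=> uA; suff h m : \row_j (ray u (F j))`_m = 0.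
    by move=> j; apply/polyP => m; have /rowP/(_ j) := h m; rewrite !mxE coef0.
  have [m2|m2] := ltnP m 2.
    by apply/rowP => j; rewrite !mxE (coef_mcurve_lin _ (F2 j)).
  apply/eqP; apply: contraT => r0; exfalso.
  have := dmax _ _ r0 (ray_coef eqvF uA m).
  rewrite normrMn norm_i // gtr0_norm // => /le_lt_trans /(_ dw).
  by rewrite ltr_pMn2l // ltnNge m2.
have J0 (u : 'rV[C]_n) : ray_jac F u 0 = 0.
  apply/matrixP => i j; rewrite !mxE (coef_mcurve_lin _ (d := 1)) //.
  exact: ordge_mderiv.
have Jn0 (u : 'rV[C]_n) (z : 'cV[C]_p) : u != 0 -> u *m A = ('i * w) *: u -> z != 0 ->
    exists2 m, (0 < m)%N & ray_jac F u m *m z != 0.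
  move=> u0 uA z0; apply: boolp.contrapT => h; case/eqP: z0.
  apply: (ray_TK tk u0 (FV u uA)) => m; case: m => [|m]; first by rewrite J0 mul0mx.
  by apply/eqP; apply: contraT => nz; case: h; exists m.+1.
(* For some m >= 1 the vector J_m u^T is nonzero of weight m w + v; as this is at most w, v <= 0.
   Conjugation gives the same for -v, so [B] has weight 0 only. *)
have Beig (u : 'rV[C]_p) v : u != 0 -> u *m B = ('i * v) *: u -> v \is Num.real -> v <= 0.
  move=> u0 uB vR.
  have uT0 : u^T != 0 by rewrite -trmx0 (inj_eq trmx_inj).
  have Bu : B *m u^T = - ('i * v) *: u^T.
    by rewrite scaleNr -linearZ /= -uB trmx_mul; case: (rB) => _ ->; rewrite mulNmx opprK.
  have [m m0 nz] := Jn0 _ _ x0 xA uT0.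
  have nzT : (ray_jac F x m *m u^T)^T != 0 by rewrite -trmx0 (inj_eq trmx_inj).
  have := wmax _ _ nzT (ray_jac_eigen m xA Bu).
  rewrite opprK -mulrnAr -mulrDr norm_i ?rpredD ?rpredMn //.
  move=> /(le_trans (real_ler_norm (rpredD (rpredMn _ wR) vR))).
  case: m m0 {nz nzT} => // m _; rewrite mulrS -addrA gerDl.
  by apply: le_trans; rewrite lerDr mulrn_wge0 // ltW.
have B0 : B = 0.
  apply: (weight0 rB) => u l u0 uB.
  have [v vR e] := imag_norm (skew_eigen_imag rB u0 uB); rewrite {}e in uB *.
  suff -> : v = 0 by rewrite mulr0.
  apply/eqP; rewrite eq_le (Beig _ _ u0 uB vR) -oppr_le0 /=.
  apply: (@Beig (map_mx conjC u) (- v)); rewrite ?map_mx_eq0 ?rpredN //.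
  by rewrite (conj_eigen rB uB) rmorphM /= conjCi (CrealP vR) mulNr mulrN.
(* With B = 0 the vector J_m z has weight m w <= w, which leaves m = 1. *)
have J1 (u : 'rV[C]_n) (z : 'cV[C]_p) : u != 0 -> u *m A = ('i * w) *: u -> z != 0 -> ray_jac F u 1 *m z != 0.
  move=> u0 uA z0; have [m m0 nz] := Jn0 _ _ u0 uA z0.
  have nzT : (ray_jac F u m *m z)^T != 0 by rewrite -trmx0 (inj_eq trmx_inj).
  have Bz : B *m z = 0 *: z by rewrite B0 mul0mx scale0r.
  have := wmax _ _ nzT (ray_jac_eigen m uA Bz).
  rewrite subr0 normrMn norm_i // gtr0_norm // -[X in _ <= X]mulr1n ler_pMn2l //.
  by case: m m0 nz {nzT} => [|[]].
case: hp => [p1|[_ F3]]; last first.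
  have z0 : const_mx 1 != 0 :> 'cV[C]_p.
    apply/eqP => /colP/(_ (Ordinal p0)); rewrite !mxE => /eqP; by rewrite oner_eq0.
  have /eqP := J1 _ _ x0 xA z0; case.
  apply/colP => i; rewrite !mxE big1 // => j _.
  by rewrite !mxE (coef_mcurve_lin _ (d := 2)) ?mul0r //; apply: ordge_mderiv.
(* The Hessians of the components at 0; they describe the linear part of the Jacobian. *)
pose H j : 'M[C]_n := \matrix_(k, i) (F j)^`M(i)@_U_(k)%MM.
have JH (u : 'rV[C]_n) j : row j (ray_jac F u 1)^T = u *m H j.
  by apply/rowP => i; rewrite !mxE coef1_ray; apply: eq_bigr => k _; rewrite mxE.
(* With B = 0 each [H j] preserves the eigenspace of the largest weight; [K] below gives the
   matrices of this action. *)
have HA (u : 'rV[C]_n) j : u *m A = ('i * w) *: u -> u *m H j *m A = ('i * w) *: (u *m H j).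
  move=> uA; rewrite -JH -row_mul.
  have := ray_jac_intertwine eqvF uA 1; rewrite B0 mulmx0 mulr1n => /eqP.
  rewrite addr_eq0 => /eqP /(congr1 trmx); rewrite trmx_mul.
  case: (rA) => _ ->; rewrite mulmxN linearN /= => /oppr_inj ->.
  by rewrite linearZ linearZ.
have [r [v [vA sub_v v_free r0]]] : exists r (v : 'M_(r, n)),
    [/\ v *m A = ('i * w) *: v, 
        forall u : 'rV[C]_n, u *m A = ('i * w) *: u -> (u <= v)%MS, row_free v & (0 < r)%N].
  exists (\rank (eigenspace A ('i * w))), (row_base (eigenspace A ('i * w))); split.
  - by apply/eigenspaceP; rewrite eq_row_base.
  - by move=> u uA; rewrite eq_row_base; apply/eigenspaceP.
  - exact: row_base_free.
  rewrite lt0n mxrank_eq0; apply: contra x0 => /eqP e.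
  by rewrite -submx0 -e; apply/eigenspaceP.
have [K vH] : exists K : 'I_p -> 'M_r, forall j, v *m H j = K j *m v.
  exists (fun j => v *m H j *m pinvmx v) => j; rewrite mulmxKpV //; apply/row_subP => i; rewrite row_mul; apply: sub_v.
  by apply: HA; rewrite -row_mul vA linearZ.
pose j0 := Ordinal p0; pose j1 := Ordinal p1.
(* No nontrivial combination of [K j0] and [K j1] is singular. But either [K j1] is, or K_0 - a K_1
   is for an eigenvalue [a] of K_0 K_1^-1. *)
have sing (s : 'rV_r) (a b : C) :
    s != 0 -> s *m (a *: K j0 + b *: K j1) = 0 -> a = 0 /\ b = 0.
  move=> s0 sK; have sv0 : s *m v != 0.
    apply: contra s0 => /eqP e; apply/eqP/(row_free_inj v_free).
    by rewrite e mul0mx.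
  have svA : s *m v *m A = ('i * w) *: (s *m v) by rewrite -mulmxA vA -scalemxAr.
  pose z : 'cV[C]_p := \col_j ((j == j0)%:R * a + (j == j1)%:R * b).
  have [z0|z0] := eqVneq z 0.
    by move/colP: z0 => z0; split; [have := z0 j0|have := z0 j1];
      rewrite !mxE /= ?mul1r ?mul0r ?addr0 ?add0r.
  have /eqP := J1 _ _ sv0 svA z0; case; apply: trmx_inj; rewrite trmx_mul trmx0.
  have -> : z^T *m (ray_jac F (s *m v) 1)^T = a *: (s *m v *m H j0) + b *: (s *m v *m H j1).
    rewrite -!JH; set Jt := (ray_jac _ _ _)^T.
    apply/rowP => i; rewrite mxE (bigD1 j0) //= (bigD1 j1) //= big1 ?addr0.
      by rewrite !mxE /= mul0r addr0 mul0r add0r !mul1r.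
    by move=> k /andP[/negPf k0 /negPf k1]; rewrite !mxE k0 k1 !mul0r addr0 mul0r.
  rewrite -!mulmxA !vH !mulmxA.
  transitivity (s *m (a *: K j0 + b *: K j1) *m v); last by rewrite sK mul0mx.
  by rewrite mulmxDr mulmxDl -!scalemxAr -!scalemxAl.
have [u1|] := boolP (K j1 \in unitmx); last first.
  rewrite -row_free_unit -kermx_eq0 => /rowV0Pn[s /sub_kermxP sK s0].
  have [] := sing s 0 1 s0; first by rewrite scale0r add0r scale1r.
  by move=> _ /eqP; rewrite oner_eq0.
have [a /eigenvalueP[s es s0]] := eigenvalue_closed (K j0 *m invmx (K j1)) r0.
have [] := sing s 1 (- a) s0; last by move/eqP; rewrite oner_eq0.
rewrite scale1r mulmxDr scaleNr mulmxN -scalemxAr.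
have -> : s *m K j0 = a *: (s *m K j1).
  by rewrite scalemxAl -es -!mulmxA mulVmx // mulmx1.
by rewrite subrr.
Qed.
End WeightGap.

(** * Commuting symmetries *)

Section Lie.
Variables (n : nat) (K : comNzRingType).
Implicit Types (A : 'M[K]_n) (P Q : {mpoly K[n]}).

Lemma mderivXU (i k : 'I_n) : ('X_k : {mpoly K[n]})^`M(i) = (k == i)%:R.
Proof.
rewrite mderivX mnm1E; have [->|_] := eqVneq k i; last by rewrite scale0r.
by rewrite scale1r (_ : (U_(i) - U_(i) = 0)%MM) ?mpolyX0 //;
  apply/mnmP => l; rewrite mnmBE subnn mnm0E.
Qed.

Lemma lieX A i : lie A 'X_i = \sum_k A k i *: 'X_k.
Proof.
rewrite /lie (bigD1 i) //= mderivXU eqxx mulr1 [X in _ + X]big1 ?addr0 // => k ki.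
by rewrite mderivXU eq_sym (negPf ki) mulr0.
Qed.

Lemma lieC A c : lie A c%:MP = 0.
Proof. by rewrite /lie big1 // => i _; rewrite mderivC mulr0. Qed.

Lemma lie0 A : lie A 0 = 0.
Proof. by rewrite /lie big1 // => i _; rewrite mderiv0 mulr0. Qed.

Lemma lieD A P Q : lie A (P + Q) = lie A P + lie A Q.
Proof. by rewrite /lie -big_split; apply: eq_bigr => i _; rewrite mderivD mulrDr. Qed.

Lemma lieZ A c P : lie A (c *: P) = c *: lie A P.
Proof. by rewrite /lie scaler_sumr; apply: eq_bigr => i _; rewrite mderivZ scalerAr. Qed.

Lemma lie_sum A (I : Type) (s : seq I) (R : pred I) (E : I -> {mpoly K[n]}) :
  lie A (\sum_(i <- s | R i) E i) = \sum_(i <- s | R i) lie A (E i).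
Proof.
elim/big_rec2: _ => [|i x y _ <-]; first exact: lie0.
by rewrite lieD.
Qed.

Lemma lieM A P Q : lie A (P * Q) = lie A P * Q + P * lie A Q.
Proof.
rewrite /lie mulr_suml mulr_sumr -big_split; apply: eq_bigr => i _ /=.
by rewrite mderivM mulrDr mulrA mulrCA.
Qed.

Lemma lie_linl A A' a b P : lie (a *: A + b *: A') P = a *: lie A P + b *: lie A' P.
Proof.
rewrite /lie !scaler_sumr -big_split; apply: eq_bigr => i _ /=.
rewrite !scalerAl -mulrDl; congr (_ * _); rewrite !scaler_sumr -big_split.
by apply: eq_bigr => k _; rewrite /= !mxE scalerDl !scalerA.
Qed.

Lemma lie_comm A A' P :
  lie A (lie A' P) - lie A' (lie A P) = lie (A *m A' - A' *m A) P.
Proof.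
elim/mpoly_gen_ind: P => [c|i|P Q IHP IHQ|P Q IHP IHQ].
- by rewrite !lieC subrr.
- have h (B B' : 'M[K]_n) : lie B (lie B' 'X_i) = \sum_k (B *m B') k i *: 'X_k.
    rewrite lieX lie_sum; under eq_bigr do rewrite lieZ lieX scaler_sumr.
    rewrite exchange_big; apply: eq_bigr => l _ /=; rewrite mxE scaler_suml.
    by apply: eq_bigr => k _; rewrite scalerA mulrC.
  rewrite !h lieX -sumrB; apply: eq_bigr => k _.
  by rewrite -scalerBl; congr (_ *: _); rewrite !mxE.
- by rewrite !lieD -IHP -IHQ; ring.
by rewrite !lieM !lieD !lieM -IHP -IHQ; ring.
Qed.

End Lie.

Section Eqv.
Variables (n p : nat) (K : comNzRingType) (F : 'I_p -> {mpoly K[n]}).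

Lemma eqv_lin A B A' B' a b : eqv A B F -> eqv A' B' F ->
  eqv (a *: A + b *: A') (a *: B + b *: B') F.
Proof.
move=> e e' j; rewrite lie_linl e e' !scaler_sumr -big_split; apply: eq_bigr => l _ /=.
by rewrite !mxE scalerDl !scalerA.
Qed.

Lemma eqv_lie2 A B A' B' j : eqv A B F -> eqv A' B' F ->
  lie A (lie A' (F j)) = \sum_l (B *m B') l j *: F l.
Proof.
move=> e e'; rewrite e' lie_sum; under eq_bigr do rewrite lieZ e scaler_sumr.
rewrite exchange_big; apply: eq_bigr => l _ /=; rewrite mxE scaler_suml.
by apply: eq_bigr => k _; rewrite scalerA mulrC.
Qed.

Lemma eqv_comm A B A' B' : eqv A B F -> eqv A' B' F ->
  eqv (A *m A' - A' *m A) (B *m B' - B' *m B) F.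
Proof.
move=> e e' j; rewrite -lie_comm (eqv_lie2 _ e e') (eqv_lie2 _ e' e) -sumrB.
by apply: eq_bigr => l _; rewrite -scalerBl; congr (_ *: _); rewrite !mxE.
Qed.

Lemma mcoeff_euler (r : nat) (Q : {mpoly K[r]}) (a : 'I_r) m :
  ('X_a * Q^`M(a))@_m = Q@_m *+ m a.
Proof.
have [m0|m0] := eqVneq (m a) 0%N; last first.
  have e : m = (U_(a) + (m - U_(a)))%MM by rewrite addmC submK // lep1mP.
  rewrite mulrC {1}e mcoeffMX mcoeff_deriv submK ?lep1mP //; congr (_ *+ _).
  by rewrite mnmBE mnm1E eqxx subn1 prednK // lt0n.
rewrite m0 mulr0n mcoeffM big1 // => -[[m1 h1] [m2 h2]] /= /eqP em.
rewrite mcoeffX; case: eqP => [E|]; last by rewrite mul0r.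
by move: m0; rewrite em -E mnmDE mnm1E eqxx.
Qed.

(** On a span of eigenvectors with eigenvalues d_a the field x A becomes the sum of d_a s_a d/ds_a,
    for which the monomial s^m is an eigenvector with eigenvalue the sum of the d_a m_a. *)
Lemma restr_weight A B r (u : 'M[K]_(r, n)) (d : 'rV[K]_r) m :
  eqv A B F -> u *m A = diag_mx d *m u ->
  (\row_j (msub (linsub u) (F j))@_m) *m B =
  (\sum_a d 0 a *+ m a) *: \row_j (msub (linsub u) (F j))@_m.
Proof.
move=> e uA; apply/rowP => j; rewrite !mxE.
have E P : msub (linsub u) (lie A P) =
    \sum_a d 0 a *: ('X_a * (msub (linsub u) P)^`M(a)).
  rewrite /lie msub_sum.
  transitivity (\sum_i \sum_a d 0 a *: ('X_a * (msub (linsub u) P^`M(i) * (linsub u i)^`M(a)))).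
    apply: eq_bigr => i _; rewrite rmorphM /= msub_linX uA mulr_suml.
    apply: eq_bigr => a _; rewrite mul_diag_mx mxE -scalerAl -scalerA; congr (_ *: _).
    have -> : (linsub u i)^`M(a) = (u a i)%:MP.
      rewrite /linsub (raddf_sum (mderiv a)) (bigD1 a) //= mderivZ mderivXU eqxx big1 ?addr0.
        by rewrite -mul_mpolyC mulr1.
      by move=> b ba; rewrite mderivZ mderivXU (negPf ba) scaler0.
    by rewrite [X in 'X_a * X]mulrC mul_mpolyC -scalerAr.
  rewrite exchange_big; apply: eq_bigr => a _ /=.
  by rewrite -scaler_sumr -mulr_sumr mderiv_msub.
have := congr1 (fun Q => (msub (linsub u) Q)@_m) (e j); rewrite E msub_sum.
rewrite (raddf_sum (mcoeff m)) [RHS](raddf_sum (mcoeff m)) /= => H.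
transitivity (\sum_l (msub (linsub u) (B l j *: F l))@_m).
  by apply: eq_bigr => l _; rewrite mxE msubZ mcoeffZ mulrC.
rewrite -H mulr_suml; apply: eq_bigr => a _.
by rewrite mcoeffZ mcoeff_euler mulrnAl mulrnAr.
Qed.
End Eqv.

Lemma card_fiber_leq n p (T : eqType) (a : 'I_n -> T) (b : 'I_p -> T) :
  (forall r, #|[pred i | a i == r]| <= #|[pred j | b j == r]|)%N -> (n <= p)%N.
Proof.
move=> h; have cnt k (c : 'I_k -> T) r : #|[pred i | c i == r]| = count_mem r [seq c i | i : 'I_k].
  by rewrite count_map -size_filter cardE enumT; congr size; apply: eq_filter.
have /count_subseqP[s ss /perm_size] : forall r, (count_mem r [seq a i | i : 'I_n] <=
   count_mem r [seq b i | i : 'I_p])%N by move=> r; rewrite -!cnt.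
rewrite size_map -cardE card_ord => ->; apply: leq_trans (size_subseq ss) _.
by rewrite size_map -cardE card_ord.
Qed.

(** * Noncommuting symmetries *)

Lemma row_free_rowsub (K : fieldType) n r (P : 'M[K]_n) (f : 'I_r -> 'I_n) :
  P \in unitmx -> injective f -> row_free (rowsub f P).
Proof.
move=> uP injf; apply/row_freeP; exists (colsub f (invmx P)).
apply/matrixP => a b; rewrite !mxE -(inj_eq injf).
have /matrixP/(_ (f a) (f b)) := mulmxV uP; rewrite !mxE => <-.
by apply: eq_bigr => k _; rewrite !mxE.
Qed.

Section Commuting.
Variables (C : numClosedFieldType) (n p N : nat) (F : 'I_p -> {mpoly C[n]}).
Hypotheses (tk : TK N F) (F2 : forall j, ordge 2 (F j)).
Hypothesis hp : (1 < p)%N \/ (0 < p)%N /\ forall j, ordge 3 (F j).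

Definition sym (A : 'M[C]_n) (B : 'M[C]_p) := [/\ rskew A, rskew B & eqv A B F].

Lemma rskew_lin m (A A' : 'M[C]_m) a b : rskew A -> rskew A' ->
  a \is Num.real -> b \is Num.real -> rskew (a *: A + b *: A').
Proof.
move=> [/mxOverP rA sA] [/mxOverP rA' sA'] ra rb; split.
  by apply/mxOverP => i j; rewrite !mxE rpredD ?rpredM.
by rewrite linearD linearZ [X in _ + X]linearZ /= sA sA' !scalerN -opprD.
Qed.

Lemma sym_lin A B A' B' a b : sym A B -> sym A' B' ->
  a \is Num.real -> b \is Num.real ->
  sym (a *: A + b *: A') (a *: B + b *: B').
Proof.
move=> [rA rB e] [rA' rB' e'] ra rb.
by split; [exact: rskew_lin|exact: rskew_lin|exact: eqv_lin].
Qed.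

(** If A = 0 the whole source is fixed and every intertwiner satisfies J B = 0, so a nonzero column
    of [B] serves as [z] and gives n <= p. *)
Lemma source_action_neq0 A B : sym A B -> (p < n)%N -> A = 0 -> B = 0.
Proof.
move=> [rA rB e] pn A0; apply/eqP; apply: contraTT pn => B0; rewrite -leqNgt.
have /existsP[i Bi] : [exists i, col i B != 0].
  apply: contraNT B0; rewrite negb_exists => /forallP h; apply/eqP/matrixP => a b.
  by have := h b; rewrite negbK => /eqP/colP/(_ a); rewrite !mxE.
have u1 : row_free (1%:M : 'M[C]_n) by rewrite row_free_unit unitmx1.
have := fixed_subspace_rank tk F2 e u1 _ (u' := 1%:M) _ Bi.
rewrite mxrank1; apply; first by rewrite mul1mx.
  by move=> m; apply: submx1.
by move=> J; rewrite A0 mul0mx colE mulmxA => <-; rewrite mul0mx.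
Qed.

(** [z] is an eigenvector of [B] for the largest weight d. An intertwiner that did not kill it would
    give an eigenvector of [A] of weight d >= 2w > w. *)
Lemma kill_gap A B : sym A B -> A != 0 ->
  exists2 z : 'cV[C]_p, z != 0 & forall J : 'M[C]_(n, p), A *m J = J *m B -> J *m z = 0.
Proof.
move=> [rA rB e] A0; have [w [d [y [w0 wd hA hB [y0 yB]]]]] := weight_gap tk F2 e rA rB A0 hp.
exists y^T; first by rewrite -trmx0 (inj_eq trmx_inj).
have By : B *m y^T = ('i * d) *: y^T.
  apply: trmx_inj; rewrite trmx_mul trmxK linearZ /= trmxK; case: rB => _ ->.
  by rewrite mulmxN yB scaleNr opprK.
move=> J AJ; apply/eqP; apply: contraT => nz.
have nzT : (J *m y^T)^T != 0 by rewrite -trmx0 (inj_eq trmx_inj).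
have d0 : 0 < d by apply: lt_le_trans wd; rewrite pmulrn_lgt0.
suff /(hA _ _ nzT) : (J *m y^T)^T *m A = - ('i * d) *: (J *m y^T)^T.
  rewrite normrN norm_i ?gtr0_real // gtr0_norm // => /(le_trans wd).
  by rewrite mulr2n gerDl (lt_geF w0).
apply: trmx_inj; rewrite trmx_mul trmxK linearZ /= trmxK; case: (rA) => _ ->.
by rewrite mulNmx mulmxA AJ -mulmxA By -scalemxAr scaleNr.
Qed.

Lemma normal_eigenbasis2 m (M : 'M[C]_m) : M \is normalmx -> exists P d,
  [/\ P \in unitmx, P *m M = diag_mx d *m P &
     P *m (map_mx conjC M)^T = diag_mx (map_mx conjC d) *m P].
Proof.
move=> /orthomx_spectralP e; exists (spectralmx M), (spectral_diag M).
have uP := spectral_unit M; split => //.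
  by have := congr1 (mulmx (spectralmx M)) e; rewrite !mulmxA mulmxV // mul1mx.
have iP := invmx_unitary (spectral_unitarymx M); move: e iP uP.
move: (spectralmx M) (spectral_diag M) => P d -> iP uP.
rewrite !map_mxM !trmx_mul map_diag_mx tr_diag_mx iP.
have -> : (map_mx conjC (map_mx conjC P^T))^T = P.
  by apply/matrixP => i j; rewrite !mxE conjCK.
have -> : (map_mx conjC P)^T = invmx P by rewrite iP map_trmx.
by rewrite !mulmxA mulmxV // mul1mx.
Qed.

Variables (A1 A2 : 'M[C]_n) (B1 B2 : 'M[C]_p).
Hypotheses (s1 : sym A1 B1) (s2 : sym A2 B2).
Hypotheses (cA : A1 *m A2 = A2 *m A1) (cB : B1 *m B2 = B2 *m B1).
Hypothesis indep : forall a b, a \is Num.real -> b \is Num.real ->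
  a *: A1 + b *: A2 = 0 -> a *: B1 + b *: B2 = 0 -> a = 0 /\ b = 0.

(** Commuting skew matrices combine into one normal matrix M1 + i M2, whose eigenvalue d encodes the
    joint weight: M1 has eigenvalue i Im d and M2 has -i Re d. The combination with coefficients Re
    r and Im r kills an eigenvector as soon as d is a real multiple of r. *)
Lemma commuting_eigenbasis m (M1 M2 : 'M[C]_m) : rskew M1 -> rskew M2 ->
  M1 *m M2 = M2 *m M1 -> exists P (d : 'rV[C]_m),
  [/\ P \in unitmx, P *m (M1 + 'i *: M2) = diag_mx d *m P &
    forall r : C, P *m ('Re r *: M1 + 'Im r *: M2) =
       diag_mx (\row_i ('i * ('Re r * 'Im (d 0 i) - 'Im r * 'Re (d 0 i)))) *m P].
Proof.
move=> r1 r2 c; pose M := M1 + 'i *: M2.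
have cM : map_mx conjC M = M1 - 'i *: M2.
  by rewrite map_mxD map_mxZ (rskew_conj r1) (rskew_conj r2) /= conjCi scaleNr.
have cMT : (map_mx conjC M)^T = - M1 + 'i *: M2.
  rewrite cM linearD linearN linearZ /=; case: r1 => _ ->; case: r2 => _ ->.
  by rewrite scalerN opprK.
have nM : M \is normalmx.
  apply/normalmxP; rewrite -map_trmx cMT /M !mulmxDl !mulmxDr.
  rewrite !mulmxN !mulNmx -!scalemxAl -!scalemxAr c.
  by rewrite !addrA addrK subrK.
have [P [d [uP PM PMT]]] := normal_eigenbasis2 nM; exists P, d; split => // r.
rewrite cMT in PMT.
have e1 : P *m M1 = diag_mx (\row_i ('i * 'Im (d 0 i))) *m P.
  have -> : M1 = 2^-1 *: (M - (- M1 + 'i *: M2)).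
    rewrite /M opprD opprK addrACA subrr addr0 -mulr2n -scaler_nat scalerA mulVf ?scale1r //.
    by rewrite pnatr_eq0.
  rewrite -scalemxAr mulmxBr PM PMT -mulmxBl -linearB /= scalemxAl -linearZ /=; congr (diag_mx _ *m _).
  apply/rowP => i; rewrite !mxE ImE !mulrA -expr2 sqrCi; by field.
have e2 : P *m M2 = diag_mx (\row_i (- ('i * 'Re (d 0 i)))) *m P.
  have -> : M2 = ('i * 2)^-1 *: (M + (- M1 + 'i *: M2)).
    rewrite /M addrACA subrr add0r -mulr2n -scaler_nat !scalerA.
    rewrite -[LHS]scale1r; congr (_ *: _); field.
    exact: neq0Ci.
  rewrite -scalemxAr mulmxDr PM PMT -mulmxDl -linearD /= scalemxAl -linearZ /=; congr (diag_mx _ *m _).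
  apply/rowP => i; rewrite !mxE ReE invfM invCi; by field.
rewrite mulmxDr -!scalemxAr e1 e2 !scalemxAl -mulmxDl -!linearZ -linearD /=.
by congr (diag_mx _ *m _); apply/rowP => i; rewrite !mxE; ring.
Qed.

(** The ray through [c]. As division by 0 gives 0, the zero weight forms a class of its own. *)
Definition dir (c : C) := c / `|c|.

Lemma dir_scale (c : C) : c = `|c| * dir c.
Proof.
rewrite /dir; have [->|c0] := eqVneq c 0; first by rewrite mul0r mulr0.
by rewrite mulrC divfK // normr_eq0.
Qed.

Lemma dir_comb r (d : 'I_r -> C) (m : 'I_r -> nat) c :
  (forall a, dir (d a) = c) -> (exists a, m a != 0%N) -> dir (\sum_a d a *+ m a) = c.
Proof.
move=> hd [b mb]; have [c0|c0] := eqVneq c 0.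
  rewrite big1 ?/dir ?mul0r ?c0 // => a _.
  by rewrite (dir_scale (d a)) hd c0 mulr0 mul0rn.
have d0 a : d a != 0.
  by apply: contraNneq c0 => e; rewrite -(hd a) e /dir mul0r.
have c1 : `|c| = 1 by rewrite -(hd b) /dir normrM normfV normr_id divff // normr_eq0.
have -> : \sum_a d a *+ m a = (\sum_a `|d a| *+ m a) * c.
  by rewrite mulr_suml; apply: eq_bigr => a _; rewrite {1}(dir_scale (d a)) hd mulrnAl.
have s0 : 0 < \sum_a `|d a| *+ m a.
  rewrite (bigD1 b) //= ltr_pwDl ?pmulrn_lgt0 ?normr_gt0 ?lt0n //.
  by apply: sumr_ge0 => a _; rewrite mulrn_wge0.
by rewrite /dir normrM c1 mulr1 gtr0_norm // mulrC mulKf // lt0r_neq0.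
Qed.

(** Joint weights are grouped by rays. On the source weight space of one ray some real combination
    of the two symmetries vanishes, and [F] maps that space into the target weight space of the same
    ray, because nonnegative combinations of weights on a ray stay on it. So each ray carries at
    most as many source weights as target weights. *)
Theorem commuting_source_leq : (n <= p)%N.
Proof.
rewrite leqNgt; apply/negP => pn.
have [[r1 rB1 e1] [r2 rB2 e2]] := (s1, s2).
have [P [d [uP PA killA]]] := commuting_eigenbasis r1 r2 cA.
have [Q [e [uQ QB _]]] := commuting_eigenbasis rB1 rB2 cB.
have : ~~ (n <= p)%N by rewrite -ltnNge.
apply/negP; rewrite negbK.
apply: (@card_fiber_leq _ _ _ (fun i => dir (d 0 i)) (fun j => dir (e 0 j))) => c.
pose S := [pred i | dir (d 0 i) == c]; pose S' := [pred j | dir (e 0 j) == c].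
rewrite -/S -/S'.
pose f (a : 'I_#|S|) := enum_val a; pose f' (a : 'I_#|S'|) := enum_val a.
have hf a : dir (d 0 (f a)) = c by have := enum_valP a; rewrite inE => /eqP.
pose u := rowsub f P; pose u' := rowsub f' Q.
have u_free : row_free u by apply: row_free_rowsub => //; apply: enum_val_inj.
(* For c != 0 the coefficients are Re c and Im c; on the zero weight space every combination
   vanishes, and 1, 0 are taken. *)
have [al [be [ral rbe nz killu]]] : exists al be : C, [/\ al \is Num.real,
    be \is Num.real, al != 0 \/ be != 0 & u *m (al *: A1 + be *: A2) = 0].
  have kill_rows (r : C) : (forall a, 'Re r * 'Im (d 0 (f a)) - 'Im r * 'Re (d 0 (f a)) = 0) ->
     u *m ('Re r *: A1 + 'Im r *: A2) = 0.
    move=> h; apply/row_matrixP => a; rewrite row_mul row0 row_rowsub -row_mul killA.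
    by apply/rowP => k; rewrite mxE mul_diag_mx !mxE h mulr0 mul0r.
  have [c0|c0] := eqVneq c 0.
    exists ('Re 1), ('Im 1); split; rewrite ?Creal_Re ?Creal_Im //.
      by left; rewrite (Creal_ReP _ _) ?oner_eq0 ?real1.
    apply: kill_rows => a; rewrite (dir_scale (d 0 (f a))) hf c0 mulr0.
    by rewrite !raddf0 !mulr0 subrr.
  exists ('Re c), ('Im c); split; rewrite ?Creal_Re ?Creal_Im //.
    have [re0|] := eqVneq ('Re c) 0; last by left.
    by right; apply: contraNneq c0 => im0; rewrite [c]Crect re0 im0 mulr0 addr0.
  apply: kill_rows => a; rewrite (dir_scale (d 0 (f a))) hf.
  by rewrite ReMl ?normr_real // ImMl ?normr_real //; ring.
have sAB := sym_lin s1 s2 ral rbe.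
have A0 : al *: A1 + be *: A2 != 0.
  apply/eqP => A0; have B0 := source_action_neq0 sAB pn A0.
  by have [al0 be0] := indep ral rbe A0 B0; case: nz; rewrite ?al0 ?be0 eqxx.
have [z z0 hz] := kill_gap sAB A0.
have [_ _ eAB] := sAB.
have := fixed_subspace_rank tk F2 eAB u_free killu (u' := u') _ z0 hz.
move=> h; apply: leq_trans (h _) (rank_leq_row _) => m {h hz}.
set c_m := \row_j _; have [->|cm0] := eqVneq c_m 0; first exact: sub0mx.
(* [dir_comb] concerns nonconstant monomials; the constant coefficient vanishes because [F] has
   order 2. *)
have m0 : exists a, m a != 0%N.
  apply/existsP; apply: contraNT cm0; rewrite negb_exists => /forallP hm.
  have m0 : m = 0%MM.
    by apply/mnmP => a; rewrite mnm0E; apply/eqP; have := hm a; rewrite negbK.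
  rewrite /c_m m0; apply/eqP/rowP => j; rewrite !mxE; apply: (@ordge_msub _ _ _ _ 2); rewrite ?mdeg0 //.
  exact: ordge_linsub.
have eN : eqv (A1 + 'i *: A2) (B1 + 'i *: B2) F.
  by have := eqv_lin 1 'i e1 e2; rewrite !scale1r.
have uN : u *m (A1 + 'i *: A2) = diag_mx (\row_a d 0 (f a)) *m u.
  apply/row_matrixP => a; rewrite row_mul row_rowsub -row_mul PA.
  by apply/rowP => k; rewrite !mul_diag_mx !mxE.
have := restr_weight m eN uN; rewrite -/c_m; set lam := \sum_a _ => cN.
have dlam : dir lam = c.
  by rewrite /lam; under eq_bigr do rewrite mxE; apply: dir_comb.
have [y cy] : exists y : 'rV_p, c_m = y *m Q by exists (c_m *m invmx Q); rewrite mulmxKV.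
have ye j : y 0 j != 0 -> e 0 j = lam.
  move=> yj; have : y *m diag_mx e = lam *: y.
    by apply: (can_inj (mulmxK uQ)); rewrite -mulmxA -QB mulmxA -cy cN -scalemxAl -cy.
  by move=> /rowP/(_ j); rewrite mul_mx_diag !mxE mulrC => /(mulIf yj).
have -> : c_m = (\row_a y 0 (f' a)) *m u'.
  rewrite cy; apply/rowP => k; rewrite !mxE (bigID S') /= [X in _ + X]big1 ?addr0.
    by rewrite big_enum_val /=; apply: eq_bigr => a _; rewrite !mxE.
  move=> j; apply: contraNeq => yQ; rewrite /= ye ?dlam //.
  by apply: contraNneq yQ => ->; rewrite mul0r.
exact: submxMl.
Qed.

End Commuting.

(** * Vanishing on kernels and images of powers of an operator *)

Section Homog.
Variables (n : nat) (K : comNzRingType).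
Implicit Types (P : {mpoly K[n]}).

Lemma mderiv_homog d P i : P \is d.+1.-homog -> P^`M(i) \is d.-homog.
Proof.
move=> hP; apply/dhomogP => m; rewrite mcoeff_msupp mcoeff_deriv => h.
have: P@_(m + U_(i)) != 0 by apply: contraNneq h => ->; rewrite mul0rn.
rewrite -mcoeff_msupp => /(dhomog_mf hP).
by rewrite /= mdegD mdeg1 addn1 => -[].
Qed.

Lemma lie_homog (A : 'M[K]_n) d P : P \is d.-homog -> lie A P \is d.-homog.
Proof.
case: d => [|d] hP.
  suff -> : P = (P@_0%MM)%:MP by rewrite lieC dhomog0.
  apply/mpolyP => m; rewrite mcoeffC; case: eqP => [->|/eqP m0]; first by rewrite mulr1.
  by rewrite mulr0 (dhomog_nemf_coeff hP) //= mdeg_eq0.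
apply: rpred_sum => i _; rewrite -add1n; apply: dhomogM; last exact: mderiv_homog.
by apply: rpred_sum => k _; apply: dhomogZ; rewrite dhomogX /= mdeg1.
Qed.

(** A linear field preserves the degree, so homogeneous components are killed separately. *)
Lemma iter_lie_homog (A : 'M[K]_n) a d P :
  iter a (lie A) P = 0 -> iter a (lie A) (pihomog mdeg d P) = 0.
Proof.
move=> h; have hh e : iter a (lie A) (pihomog mdeg e P) \is e.-homog.
  elim: a {h} => [|a IH] /=; first exact: pihomogP.
  exact: lie_homog.
have E : \sum_(e < maxn (msize P) d.+1) iter a (lie A) (pihomog mdeg e P) = 0.
  have lsum (G : 'I_(maxn (msize P) d.+1) -> {mpoly K[n]}) :
      iter a (lie A) (\sum_e G e) = \sum_e iter a (lie A) (G e).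
    by elim: (a) => // b IH; rewrite /= IH lie_sum.
  by rewrite -lsum -pihomog_partitionE // leq_maxl.
have := congr1 (pihomog mdeg d) E; rewrite raddf_sum raddf0 /=.
rewrite (bigD1 (Ordinal (leq_maxr (msize P) d.+1))) //= big1 => [|e ne].
  by rewrite addr0 pihomog_dE.
by rewrite (pihomog_ne0 _ (hh e)).
Qed.
End Homog.

Lemma coefM_top (K : comNzRingType) (p q : {poly K}) a b :
  (size p <= a.+1)%N -> (size q <= b.+1)%N -> (p * q)`_(a + b) = p`_a * q`_b.
Proof.
move=> hp hq; rewrite coefM.
have la : (a < (a + b).+1)%N by rewrite ltnS leq_addr.
rewrite (bigD1 (Ordinal la)) //= addKn big1 ?addr0 // => i ne.
have [lt|ge] := ltnP i a.
  rewrite [X in _ * X]nth_default ?mulr0 //; apply: leq_trans hq _; lia.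
rewrite [X in X * _]nth_default ?mul0r //; apply: leq_trans hp _.
by move: ne; rewrite -val_eqE /=; lia.
Qed.

Lemma coefXn_top (K : comNzRingType) (p : {poly K}) a k :
  (size p <= a.+1)%N -> (size (p ^+ k) <= (a * k).+1)%N /\ (p ^+ k)`_(a * k) = p`_a ^+ k.
Proof.
move=> hp; elim: k => [|k [IH1 IH2]].
  by rewrite muln0 !expr0 size_poly1 coef1.
rewrite !exprS mulnS; split; last by rewrite coefM_top // IH2.
apply: leq_trans (size_polyMleq _ _) _.
by move: hp IH1; set s := size (polyseq p); set t := size (polyseq _); lia.
Qed.

Lemma coef_prod_top (K : comNzRingType) (I : Type) (r : seq I) (p : I -> {poly K}) (a : I -> nat) :
  (forall i, (size (p i) <= (a i).+1)%N) ->
  (size (\prod_(i <- r) p i)%R <= (\sum_(i <- r) a i).+1)%N /\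
  (\prod_(i <- r) p i)`_(\sum_(i <- r) a i) = \prod_(i <- r) (p i)`_(a i).
Proof.
move=> h; elim: r => [|i r [IH1 IH2]].
  by rewrite !big_nil size_poly1 coef1.
rewrite !big_cons; split; last by rewrite coefM_top // IH2.
apply: leq_trans (size_polyMleq _ _) _.
by move: (h i) IH1; set s := size (polyseq (p i)); set t := size (polyseq _); lia.
Qed.

Section Nilpotent.
Variables (n : nat) (K : numFieldType) (E : 'M[K]_n).

(** The curve g(t) = a! w exp(t E) is polynomial of degree a with leading coefficient w E^a. For Q
    homogeneous of degree e >= 1, the value Q(w E^a) is the coefficient of t^(a e) in Q(g(t)), and
    the a-th derivative of Q(g(t)) is the a-fold Lie derivative of Q along g, hence 0. *)
Lemma nil_meval (w : 'rV[K]_n) a (P : {mpoly K[n]}) :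
  w *m E ^+ a *m E = 0 -> iter a (lie E) P = 0 -> ordge 1 P ->
  P.@[fun i => (w *m E ^+ a) 0 i] = 0.
Proof.
move=> wE lP P1; rewrite (pihomog_partitionE (leqnn (msize P))) raddf_sum /=.
apply: big1 => -[d _] _ /=; set Q := pihomog mdeg d P.
have hQ : Q \is d.-homog by apply: pihomogP.
have lQ : iter a (lie E) Q = 0 by apply: iter_lie_homog.
case: d @Q hQ lQ => [|d] Q hQ lQ.
  suff -> : Q = 0 by rewrite meval0.
  apply/mpolyP => m; rewrite mcoeff0.
  have [m0|m0] := eqVneq (mdeg m) 0%N; last by rewrite (dhomog_nemf_coeff hQ).
  rewrite /Q pihomogE raddf_sum /= big1 // => m' /eqP m'0; rewrite mcoeffZ P1 ?mul0r //.
  by rewrite m'0.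
(* The factor a! normalizes the leading coefficient to w E^a. *)
pose g i : {poly K} := \poly_(k < a.+1) (a`!%:R / k`!%:R * (w *m E ^+ k) 0 i).
have ga i : (g i)`_a = (w *m E ^+ a) 0 i.
  by rewrite coef_poly ltnSn divff ?mul1r // pnatr_eq0 -lt0n fact_gt0.
have gs i : (size (g i) <= a.+1)%N by apply: size_poly.
have g' i : (g i)^`() = \sum_k E k i *: g k.
  apply/polyP => k; rewrite coef_deriv coef_sum coef_poly.
  under eq_bigr do rewrite coefZ coef_poly.
  have wk : \sum_l E l i * (w *m E ^+ k) 0 l = (w *m E ^+ k.+1) 0 i.
    by rewrite exprSr -mulmxE mulmxA [RHS]mxE; apply: eq_bigr => l _; rewrite mulrC.
  rewrite ltnS; have [ka|ak] := ltnP k a; last first.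
    rewrite mul0rn; case: ltnP => ak'; last by rewrite big1 // => *; rewrite mulr0.
    have -> : k = a by lia.
    under eq_bigr do rewrite divff ?mul1r ?pnatr_eq0 -?lt0n ?fact_gt0 //.
    have /rowP/(_ i) := wE; rewrite mxE [RHS]mxE => e; rewrite -[LHS]e.
    by apply: eq_bigr => l _; rewrite mulrC.
  rewrite ltnS ltnW //; under eq_bigr do rewrite mulrCA.
  rewrite -mulr_sumr wk -mulrnAl; congr (_ * _).
  rewrite factS natrM -mulr_natr; field.
  by rewrite -mulrS !pnatr_eq0 -!lt0n fact_gt0.
have dG R : (mcurve g R)^`() = mcurve g (lie E R).
  rewrite deriv_mcurve /lie raddf_sum /=; apply: eq_bigr => i _.
  rewrite g' rmorphM /= mulrC; congr (_ * _).
  by rewrite raddf_sum /=; apply: eq_bigr => k _; rewrite mcurveZ mcurveX.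
have dGn k : (mcurve g Q)^`(k) = mcurve g (iter k (lie E) Q).
  elim: k => [|k IH]; first by rewrite derivn0.
  by rewrite derivnS IH dG.
have top : (mcurve g Q)`_(a * d.+1) = 0.
  have := dGn a; rewrite lQ raddf0 => /(congr1 (fun q : {poly K} => q`_(a * d))).
  rewrite coef_derivn coef0 mulnS => /eqP; rewrite mulrn_eq0 => /orP[|/eqP//].
  by rewrite eqn0Ngt ffact_gt0 leq_addr.
rewrite -[RHS]top (mpolyE Q) !raddf_sum /= coef_sum big_seq [RHS]big_seq.
apply: eq_bigr => m mQ; have dm := dhomog_mf hQ mQ.
rewrite mevalZ mevalX mcurveZ mcurveXm coefZ; congr (_ * _).
have h i := coefXn_top (m i) (gs i).
have := coef_prod_top (index_enum 'I_n) (a := fun i => (a * m i)%N) (fun i => (h i).1).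
rewrite -big_distrr /= -mdegE dm => -[_ ->].
by apply: eq_bigr => i _; rewrite (h i).2 ga.
Qed.

Lemma nil_restr r (v u : 'M[K]_(r, n)) a (P : {mpoly K[n]}) :
  u = v *m E ^+ a -> u *m E = 0 -> iter a (lie E) P = 0 -> ordge 1 P ->
  msub (linsub u) P = 0.
Proof.
move=> eu uE lP P1; apply: meval_eq0 => s; rewrite meval_msub.
pose w := (\row_a s a) *m v.
have e i : (w *m E ^+ a) 0 i = (linsub u i).@[s].
  by rewrite meval_linsub -mulmxA -eu mxE; apply: eq_bigr => k _; rewrite mxE.
rewrite -(meval_eq _ e); apply: nil_meval => //.
by rewrite /w -(mulmxA _ v) -eu -mulmxA uE mulmx0.
Qed.
End Nilpotent.

Lemma eigen_shift (K : fieldType) m (M X : 'M[K]_m) (s l : K) (x : 'rV_m) k :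
  X *m M = M *m X + s *: X -> x *m M = l *: x ->
  x *m X ^+ k *m M = (l + s *+ k) *: (x *m X ^+ k).
Proof.
move=> XM xM; elim: k => [|k IH]; first by rewrite expr0 mulmx1 mulr0n addr0.
rewrite exprSr -mulmxE mulmxA -mulmxA XM mulmxDr mulmxA IH -scalemxAl -scalemxAr.
by rewrite -scalerDl mulrSr addrA.
Qed.

(** * The dimension bound from a raising operator *)

Section Raising.
Variables (C : numClosedFieldType) (n p N : nat) (F : 'I_p -> {mpoly C[n]}).
Hypotheses (tk : TK N F) (F2 : forall j, ordge 2 (F j)).
Hypothesis hp : (1 < p)%N \/ (0 < p)%N /\ forall j, ordge 3 (F j).
Variables (A : 'M[C]_n) (B : 'M[C]_p) (sAB : sym F A B) (A0 : A != 0).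
Variables (E1 : 'M[C]_n) (E2 G2 : 'M[C]_p) (al c : C).
Hypotheses (al0 : 0 < al) (c0 : c != 0) (eE : eqv E1 E2 F).
Hypotheses (cE1 : E1 *m A = A *m E1 + ('i * al) *: E1)
           (cE2 : E2 *m B = B *m E2 + ('i * al) *: E2)
           (cG2 : G2 *m B = B *m G2 - ('i * al) *: G2)
           (cEG : E2 *m G2 = G2 *m E2 + c *: B).

(** A lowest weight vector [y] of [B] starts a chain y E2^k whose length follows from the commutator
    with [G2] as in the representation theory of sl_2: it ends at K with al K = 2d. On the source a
    shift by 2d exceeds the spread 2w of the weights, because d >= 2w > w. *)
Lemma nilpotency_gap : exists K, E1 ^+ K = 0 /\ E2 ^+ K != 0.
Proof.
have [rA rB e] := sAB.
have [w [d [y [w0 wd hA hB [y0 yB]]]]] := weight_gap tk F2 e rA rB A0 hp.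
have d0 : 0 < d by apply: lt_le_trans wd; rewrite pmulrn_lgt0.
have yEk k : y *m E2 ^+ k *m B = ('i * (- d + al *+ k)) *: (y *m E2 ^+ k).
  by rewrite (eigen_shift k cE2 yB) mulrDr mulrN mulrnAr.
(* Otherwise the y E2^k would give p + 1 distinct eigenvalues of [B]. *)
have [k yk0] : exists k, y *m E2 ^+ k == 0.
  apply: boolp.contrapT => h.
  have hk k : y *m E2 ^+ k != 0 by apply/negP => hk; apply: h; exists k.
  have nz : char_poly B != 0 by rewrite monic_neq0 // char_poly_monic.
  have := @max_poly_roots _ _ [seq 'i * (- d + al *+ k) | k <- iota 0 p.+1] nz.
  rewrite size_char_poly size_map size_iota ltnn => H; suff: false by []; apply: H.
    apply/allP => _ /mapP[k _ ->]; rewrite -eigenvalue_root_char.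
    by apply/eigenvalueP; exists (y *m E2 ^+ k).
  rewrite map_inj_uniq ?iota_uniq // => a b /(mulfI (neq0Ci _)) /addrI /eqP.
  by rewrite -subr_eq0; case: (leqP a b) => [ab|/ltnW ab];
    [rewrite -opprB oppr_eq0|]; rewrite -mulrnBr // mulrn_eq0 (gt_eqF al0) orbF subn_eq0 => ba;
    apply/eqP; rewrite eqn_leq ab ba.
have {yk0 k} [k yk0 kmin] := ex_minnP (ex_intro (fun k => y *m E2 ^+ k == 0) k yk0).
case: k yk0 kmin => [|K] yk0 kmin; first by rewrite expr0 mulmx1 (negPf y0) in yk0.
have yK : y *m E2 ^+ K != 0 by apply/negP => /kmin; rewrite ltnn.
have yG : y *m G2 = 0.
  have yGB : y *m G2 *m B = - ('i * (d + al)) *: (y *m G2).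
    rewrite -mulmxA cG2 mulmxBr mulmxA yB -scalemxAl -scalemxAr -scalerBl.
    by congr (_ *: _); ring.
  apply/eqP; apply: contraT => /hB /(_ yGB).
  rewrite normrN norm_i ?gtr0_real ?addr_gt0 // gtr0_norm ?addr_gt0 //.
  by rewrite gerDl (lt_geF al0).
(* The sum of the weights of the first j vectors of the chain, which must be 0 where the chain
   ends. *)
pose s j : C := \sum_(i < j) (- d + al *+ i).
have yEG j : y *m E2 ^+ j.+1 *m G2 = (c * 'i * s j.+1) *: (y *m E2 ^+ j).
  elim: j => [|j IH].
    rewrite expr1 expr0 mulmx1 -mulmxA cEG mulmxDr mulmxA yG mul0mx add0r.
    rewrite -scalemxAr yB scalerA /s big_ord1 mulr0n addr0; congr (_ *: _); ring.
  rewrite exprSr -mulmxE mulmxA -mulmxA cEG mulmxDr mulmxA IH -scalemxAl -scalemxAr yEk.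
  rewrite -mulmxA mulmxE -exprSr scalerA -scalerDl /s [in RHS]big_ord_recr /=.
  by congr (_ *: _); ring.
have sK : s K.+1 = 0.
  have := yEG K; rewrite (eqP yk0) mul0mx => /esym/eqP; rewrite scaler_eq0 (negPf yK) orbF.
  by rewrite !mulf_eq0 (negPf c0) (negPf (neq0Ci _)) /= => /eqP.
have sE j : s j *+ 2 = (al *+ j.-1 - d *+ 2) *+ j.
  elim: j => [|j IH]; first by rewrite /s big_ord0 mul0rn mulr0n.
  rewrite /s big_ord_recr /= mulrnDl -/(s j) IH; case: j {IH} => [|j] /=.
    by rewrite !mulr0n addr0 add0r add0r mulNrn.
  by ring.
have alK : al *+ K = d *+ 2.
  have /eqP := sE K.+1; rewrite sK mul0rn eq_sym mulrn_eq0 /= subr_eq0.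
  by move/eqP.
exists K; split; last by apply: contraNneq yK => ->; rewrite mulmx0.
have [P [dd [uP PA]]] := rskew_eigenbasis rA.
apply: (can_inj (mulKmx uP)); rewrite mulmx0; apply/row_matrixP => i.
rewrite row_mul row0; have [r0 er] := eigenrow i uP PA.
have [v vR ev] := imag_norm (skew_eigen_imag rA r0 er).
have := eigen_shift K cE1 er; rewrite ev => eK.
apply/eqP; apply: contraT => /hA /(_ eK).
have rvd : v + d *+ 2 \is Num.real by rewrite rpredD ?rpredMn // gtr0_real.
rewrite -mulrnAr alK -mulrDr norm_i //.
have hv := hA _ _ r0 er; rewrite ev norm_i // in hv.
move=> /(le_trans (real_ler_norm rvd)) h.
have h2 : - w <= v by move: hv; rewrite real_ler_norml // => /andP[].
have h3 : - w + d *+ 2 <= w by apply: le_trans h; rewrite lerD2r.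
have h4 : d *+ 2 <= w *+ 2 by move: h3; rewrite -lerBDl opprK -mulr2n.
have h5 : d <= w by rewrite lerMn2r in h4.
by have := le_trans wd h5; rewrite mulr2n gerDl (lt_geF w0).
Qed.

(** Membership in the image of E2^a is tested on the linear forms Z that kill it: the a-fold Lie
    derivative of Z F is 0, and [nil_restr] makes Z F vanish on the row space of [u]. Membership in
    the kernel is [restr_weight] with all weights 0. *)
Lemma row_image_restr r (v u : 'M[C]_(r, n)) a m :
  u = v *m E1 ^+ a -> u *m E1 = 0 ->
  (\row_j (msub (linsub u) (F j))@_m <= kermx E2 :&: E2 ^+ a)%MS.
Proof.
move=> eu uE; rewrite sub_capmx; apply/andP; split.
  apply/sub_kermxP; rewrite (restr_weight (d := 0) m eE) ?linear0 ?mul0mx //.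
  by rewrite big1 ?scale0r // => i _; rewrite mxE mul0rn.
rewrite submxE; apply/eqP/rowP => k; rewrite [RHS]mxE.
set Z := cokermx _; pose P := \sum_j Z j k *: F j.
have lk b : iter b (lie E1) P = \sum_j (E2 ^+ b *m Z) j k *: F j.
  elim: b => [|b IH]; first by rewrite expr0 mul1mx.
  rewrite iterS IH lie_sum; under eq_bigr do rewrite lieZ eE scaler_sumr.
  rewrite exchange_big; apply: eq_bigr => l _ /=.
  rewrite exprS -mulmxE -mulmxA mxE scaler_suml; apply: eq_bigr => j _.
  by rewrite scalerA mulrC.
have P0 : msub (linsub u) P = 0.
  apply: (nil_restr eu uE).
    by rewrite lk mulmx_coker big1 // => j _; rewrite mxE scale0r.
  by apply: ordge_sum => j _; apply/ordgeZ/(ordgeW _ (F2 j)).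
have := congr1 (mcoeff m) P0; rewrite /P msub_sum mcoeff0 (raddf_sum (mcoeff m)) => <-.
rewrite mxE; apply: eq_bigr => j _; by rewrite /= mxE msubZ mcoeffZ mulrC.
Qed.

(** The dimensions of the spaces ker E :&: im E^a for a < K add up to the size minus the rank of
    E^K, hence to n on the source and to at most p on the target. They are compared one by one for
    the pair (E1, E2), with E2^K z in the role of the killed vector. *)
Theorem raising_source_leq : (n <= p)%N.
Proof.
have [K [E1K E2K]] := nilpotency_gap.
have [z z0] : exists z : 'cV[C]_p, E2 ^+ K *m z != 0.
  apply: boolp.contrapT => h; case/eqP: E2K; apply/matrixP => i j.
  have hz : col j (E2 ^+ K) = 0.
    apply/eqP; rewrite colE; apply: contraT => nz; case: h; by exists (delta_mx j 0).
  by have /colP/(_ i) := hz; rewrite !mxE.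
have hJ (J : 'M[C]_(n, p)) : E1 *m J = J *m E2 -> J *m (E2 ^+ K *m z) = 0.
  move=> EJ; have EJk k : E1 ^+ k *m J = J *m E2 ^+ k.
    elim: k => [|k IH]; first by rewrite !expr0 mul1mx mulmx1.
    by rewrite exprS -mulmxE -mulmxA IH mulmxA EJ -mulmxA mulmxE -exprS.
  by rewrite mulmxA -EJk E1K !mul0mx.
have rk a : (\rank (E1 ^+ a :&: kermx E1)%MS <= \rank (E2 ^+ a :&: kermx E2)%MS)%N.
  set W := (E1 ^+ a :&: kermx E1)%MS.
  have /submxP[v ev] : (row_base W <= E1 ^+ a)%MS by rewrite eq_row_base capmxSl.
  have uE : row_base W *m E1 = 0 by apply/sub_kermxP; rewrite eq_row_base capmxSr.
  rewrite [X in (_ <= \rank X)%N]capmxC.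
  apply: (fixed_subspace_rank tk F2 eE (row_base_free W) uE _ z0 hJ) => m.
  exact: row_image_restr ev uE.
have tel m (M : 'M[C]_m) k : (\sum_(a < k) \rank (M ^+ a :&: kermx M)%MS + \rank (M ^+ k) = m)%N.
  elim: k => [|k IH]; first by rewrite big_ord0 add0n expr0 mxrank1.
  rewrite big_ord_recr /= -[RHS]IH -addnA; congr (_ + _)%N.
  by rewrite exprSr -mulmxE addnC mxrank_mul_ker.
rewrite -(tel n E1 K) -(tel p E2 K) E1K mxrank0 addn0.
by apply: leq_trans (leq_addr _ _); apply: leq_sum.
Qed.
End Raising.

(** * Linear dependence of any two symmetries *)

Section MapMpoly.
Variables (n p : nat) (K L : comNzRingType) (f : {rmorphism K -> L}).

Lemma map_mpoly_deriv (P : {mpoly K[n]}) i :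
  map_mpoly f P^`M(i) = (map_mpoly f P)^`M(i).
Proof.
by apply/mpolyP => m; rewrite mcoeff_map_mpoly !mcoeff_deriv mcoeff_map_mpoly raddfMn.
Qed.

Lemma map_mpoly_lie (A : 'M[K]_n) (P : {mpoly K[n]}) :
  map_mpoly f (lie A P) = lie (map_mx f A) (map_mpoly f P).
Proof.
rewrite /lie raddf_sum /=; apply: eq_bigr => i _; rewrite rmorphM /= map_mpoly_deriv.
congr (_ * _); rewrite raddf_sum /=; apply: eq_bigr => k _.
by rewrite map_mpolyZ map_mpolyX mxE.
Qed.

Lemma map_mpoly_eqv (A : 'M[K]_n) (B : 'M[K]_p) (F : 'I_p -> {mpoly K[n]}) :
  eqv A B F -> eqv (map_mx f A) (map_mx f B) (fun j => map_mpoly f (F j)).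
Proof.
move=> e j; rewrite -map_mpoly_lie e raddf_sum /=; apply: eq_bigr => l _.
by rewrite map_mpolyZ mxE.
Qed.

Lemma eqv_ext (A : 'M[K]_n) (B : 'M[K]_p) (F G : 'I_p -> {mpoly K[n]}) :
  F =1 G -> eqv A B F -> eqv A B G.
Proof. by move=> e h j; rewrite -e h; apply: eq_bigr => l _; rewrite e. Qed.
End MapMpoly.

(** By Cayley-Hamilton, multiplying [x] successively by the linear factors of the characteristic
    polynomial of [M] ends in 0; the last nonzero vector is an eigenvector and still belongs to
    [S]. *)
Lemma stable_eigenvector (C : numClosedFieldType) d (M : 'M[C]_d) (S : 'rV[C]_d -> Prop) x :
  (forall r u, S u -> S (u *m M - r *: u)) -> S x -> x != 0 ->
  exists e l, [/\ S e, e != 0 & e *m M = l *: e].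
Proof.
move=> cS Sx x0; case: d M S x cS Sx x0 => [|d] M S x cS Sx x0.
  by case/eqP: x0; apply/rowP => -[].
have [rs ers] := closed_field_poly_normal (char_poly M).
have xP : x *m \prod_(z <- rs) (M - z%:M) = 0.
  have : x *m horner_mx M (char_poly M) = 0 by rewrite Cayley_Hamilton mulmx0.
  rewrite ers (monicP (char_poly_monic M)) scale1r rmorph_prod /=.
  by under eq_bigr do rewrite rmorphB /= horner_mx_X horner_mx_C.
elim: rs x {ers} xP Sx x0 => [|z rs IH] x.
  by rewrite big_nil mulmx1 => -> _; rewrite eqxx.
rewrite big_cons -mulmxE mulmxA mulmxBr mul_mx_scalar => h Sx x0.
have [e|ne] := eqVneq (x *m M - z *: x) 0; last exact: IH h (cS _ _ Sx) ne.
by exists x, z; split => //; apply/eqP; rewrite -subr_eq0 e.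
Qed.

(** * Root vectors of a fixed symmetry *)

Section Final.
Variables (C : numClosedFieldType) (n p N : nat) (F : 'I_p -> {mpoly C[n]}).
Hypotheses (tk : TK N F) (F2 : forall j, ordge 2 (F j)).
Hypothesis hp : (1 < p)%N \/ (0 < p)%N /\ forall j, ordge 3 (F j).
Hypothesis F_real : forall j, map_mpoly conjC (F j) = F j.
Hypothesis pn : (p < n)%N.

Local Notation cj := (map_mx conjC).
Local Notation sym := (sym F).

(** A skew matrix of size 1 is 0, so the largest weight d of the target is 0, against 2w <= d and w
    > 0. *)
Lemma sym_p1 A B : p = 1%N -> sym A B -> A = 0 /\ B = 0.
Proof.
move=> p1 sAB; have [rA rB e] := sAB.
suff A0 : A = 0 by split=> //; exact: (source_action_neq0 tk F2 sAB pn A0).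
apply/eqP; apply: contraT => A0.
have [w [d [y [w0 wd hA hB [y0 yB]]]]] := weight_gap tk F2 e rA rB A0 hp.
have B0 : B = 0.
  apply/matrixP => i j; have ij : i = j by apply/ord_inj; have := ltn_ord i; have := ltn_ord j; rewrite [X in (_ < X)%N]p1 => hj; rewrite [X in (_ < X)%N]p1; lia.
  have [_ /matrixP/(_ i j)] := rB; rewrite !mxE ij => /eqP.
  by rewrite -addr_eq0 -mulr2n mulrn_eq0 => /eqP.
move: yB; rewrite B0 mulmx0 => /esym/eqP; rewrite scaler_eq0 (negPf y0) orbF oppr_eq0.
rewrite mulf_eq0 (negPf (neq0Ci _)) => /eqP d0.
by move: wd; rewrite d0 pmulrn_lle0 // (lt_geF w0).
Qed.

Lemma eqv_conj A B : eqv A B F -> eqv (cj A) (cj B) F.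
Proof. by move=> /(map_mpoly_eqv conjC); apply: eqv_ext. Qed.

(** The trace form on pairs. It is invariant under commutators, and on skew pairs its value at X and
    the conjugate of X is negative unless X = 0. *)
Definition tau (X X' : 'M[C]_n) (Y Y' : 'M[C]_p) := \tr (X *m X') + \tr (Y *m Y').

Lemma trace_conj_le0 m (X : 'M[C]_m) : X^T = - X ->
  \tr (X *m cj X) <= 0 /\ (\tr (X *m cj X) = 0 -> X = 0).
Proof.
move=> sX; have -> : \tr (X *m cj X) = - \sum_i \sum_j `|X i j| ^+ 2.
  rewrite /mxtrace -sumrN; apply: eq_bigr => i _; rewrite mxE -sumrN.
  apply: eq_bigr => j _; rewrite !mxE normCK.
  by have /matrixP/(_ i j) := sX; rewrite !mxE => ->; rewrite rmorphN mulrN.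
have nn i : 0 <= \sum_j `|X i j| ^+ 2 by apply: sumr_ge0 => j _; rewrite exprn_ge0.
split; first by rewrite oppr_le0; apply: sumr_ge0.
move=> /eqP; rewrite oppr_eq0 psumr_eq0 // => /allP h; apply/matrixP => i j.
have := h i (mem_index_enum i); rewrite psumr_eq0; last by move=> *; rewrite exprn_ge0.
move=> /allP/(_ j (mem_index_enum j)); rewrite /= expf_eq0 /= normr_eq0 mxE.
by move/eqP.
Qed.

Lemma tau_conj_neq0 (X : 'M[C]_n) (Y : 'M[C]_p) : X^T = - X -> Y^T = - Y ->
  ~ (X = 0 /\ Y = 0) -> tau X (cj X) Y (cj Y) != 0.
Proof.
move=> sX sY nz; have [lX eX] := trace_conj_le0 sX; have [lY eY] := trace_conj_le0 sY.
apply/eqP => /eqP; rewrite -oppr_eq0 opprD paddr_eq0 ?oppr_ge0 // !oppr_eq0.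
by move=> /andP[/eqP/eX X0 /eqP/eY Y0]; apply: nz.
Qed.

Section FixedElement.
Variables (A : 'M[C]_n) (B : 'M[C]_p).
Hypotheses (sAB : sym A B) (AB0 : ~ (A = 0 /\ B = 0)).

Lemma tau_self_neq0 : tau A A B B != 0.
Proof.
have [[_ sA] [_ sB] _] := sAB; have [rA rB _] := sAB.
by have := tau_conj_neq0 sA sB AB0; rewrite (rskew_conj rA) (rskew_conj rB).
Qed.

(** If nonzero, (X, Y) would be independent of (A, B), being orthogonal to it, and
    [commuting_source_leq] would give n <= p. *)
Lemma orth_commuting X Y : sym X Y -> A *m X = X *m A -> B *m Y = Y *m B ->
  tau A X B Y = 0 -> X = 0 /\ Y = 0.
Proof.
move=> sXY cX cY o; apply: boolp.contrapT => nz.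
suff : (n <= p)%N by rewrite leqNgt pn.
apply: (commuting_source_leq tk F2 hp sAB sXY cX cY) => a b _ _ eX eY.
have a0 : a = 0.
  have : tau A (a *: A + b *: X) B (a *: B + b *: Y) = 0.
    by rewrite /tau eX eY !mulmx0 !mxtrace0 addr0.
  rewrite /tau !mulmxDr -!scalemxAr !mxtraceD !mxtraceZ addrACA -!mulrDr.
  rewrite -/(tau A A B B) -/(tau A X B Y) o mulr0 addr0 => /eqP.
  by rewrite mulf_eq0 (negPf tau_self_neq0) orbF => /eqP.
split=> //; move: eX eY; rewrite a0 !scale0r !add0r => /eqP; rewrite scaler_eq0.
move=> /orP[/eqP //|/eqP X0] /eqP; rewrite scaler_eq0 => /orP[/eqP//|/eqP Y0].
by case: nz.
Qed.

(** (E1, E2) is a root vector for (A, B), and its conjugate (D1, D2) one for the opposite root. If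
    the root is nonzero, their commutator commutes with (A, B), so it is a multiple of (A, B) by
    [orth_commuting], and a nonzero one by invariance of the trace form. This is the relation that
    [raising_source_leq] requires. *)
Lemma no_raising E1 E2 mu : E1^T = - E1 -> E2^T = - E2 -> eqv E1 E2 F ->
  tau A E1 B E2 = 0 -> ~ (E1 = 0 /\ E2 = 0) ->
  A *m E1 - E1 *m A = mu *: E1 -> B *m E2 - E2 *m B = mu *: E2 -> False.
Proof.
move=> k1 k2 eE oE nzE a1 a2.
have [rA rB eAB] := sAB.
have A0 : A != 0.
  by apply/eqP => A0; apply: AB0; split => //; exact: (source_action_neq0 tk F2 sAB pn A0).
have cA : cj A = A by apply: rskew_conj.
have cB : cj B = B by apply: rskew_conj.
pose D1 := cj E1; pose D2 := cj E2.
have kd1 : D1^T = - D1 by rewrite map_trmx k1 map_mxN.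
have kd2 : D2^T = - D2 by rewrite map_trmx k2 map_mxN.
have eD : eqv D1 D2 F by apply: eqv_conj.
have b1 : A *m D1 - D1 *m A = conjC mu *: D1.
  by have := congr1 cj a1; rewrite map_mxB !map_mxM map_mxZ cA.
have b2 : B *m D2 - D2 *m B = conjC mu *: D2.
  by have := congr1 cj a2; rewrite map_mxB !map_mxM map_mxZ cB.
have cDE m (X : 'M[C]_m) : cj (cj X) = X by apply/matrixP => i j; rewrite !mxE conjCK.
have oD : tau A D1 B D2 = 0.
  have := congr1 conjC oE; rewrite /tau rmorphD /= -!trace_map_mx !map_mxM cA cB.
  by rewrite rmorph0.
pose h := tau E1 D1 E2 D2.
have h0 : h != 0 by apply: tau_conj_neq0.
have tr1 m (X Y Z : 'M[C]_m) : \tr ((X *m Y - Y *m X) *m Z) = \tr (X *m (Y *m Z - Z *m Y)).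
  rewrite mulmxBl mulmxBr !linearB /= -!mulmxA; congr (_ - _).
  by rewrite mxtrace_mulC -mulmxA.
have tr2 m (X Y Z : 'M[C]_m) : \tr ((X *m Y - Y *m X) *m Z) = - \tr (Y *m (X *m Z - Z *m X)).
  rewrite mulmxBl mulmxBr !linearB /= opprB -!mulmxA; congr (_ - _).
  by rewrite mxtrace_mulC -mulmxA.
(* Invariance of the trace form gives mu h = - conj(mu) h, and h != 0. *)
have muh : conjC mu = - mu.
  have e1 : mu * h = - (conjC mu * h).
    rewrite /h /tau !mulrDr -!mxtraceZ !scalemxAl -a1 -a2 !tr2 b1 b2.
    by rewrite -!scalemxAr !mxtraceZ -!scalemxAl !mxtraceZ opprD.
  by rewrite -mulNr in e1; move/(mulIf h0): e1 => e1; rewrite {2}e1 opprK.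
have kreal m (X : 'M[C]_m) : X^T = - X -> cj X = X -> rskew X.
  move=> kX cX; split => //; apply/mxOverP => i j; apply/CrealP.
  by have /matrixP/(_ i j) := cX; rewrite mxE.
pose a := 'i : C.
(* For mu = 0 the real and imaginary parts of (E1, E2) are symmetries commuting with (A, B) and
   orthogonal to it, hence 0. *)
have [mu0|mu0] := eqVneq mu 0.
  have comm m (M X : 'M[C]_m) : M *m X - X *m M = 0 *: X -> M *m X = X *m M.
    by rewrite scale0r => /eqP; rewrite subr_eq0 => /eqP.
  rewrite muh mu0 oppr0 in b1 b2; rewrite mu0 in a1 a2.
  have R0 : E1 + D1 = 0 /\ E2 + D2 = 0.
    apply: orth_commuting.
    - split; [apply: kreal|apply: kreal|].
      + by rewrite linearD /= k1 kd1 opprD.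
      + by rewrite map_mxD cDE addrC.
      + by rewrite linearD /= k2 kd2 opprD.
      + by rewrite map_mxD cDE addrC.
      by have := eqv_lin 1 1 eE eD; rewrite !scale1r.
    - by rewrite mulmxDr mulmxDl (comm _ _ _ a1) (comm _ _ _ b1).
    - by rewrite mulmxDr mulmxDl (comm _ _ _ a2) (comm _ _ _ b2).
    by rewrite /tau !mulmxDr !mxtraceD addrACA -/(tau A E1 B E2) -/(tau A D1 B D2) oE oD addr0.
  have [I1 I2] : 'i *: E1 + (- 'i) *: D1 = 0 /\ 'i *: E2 + (- 'i) *: D2 = 0.
    apply: orth_commuting.
    - split; [apply: kreal|apply: kreal|].
      + by rewrite linearD !linearZ /= k1 kd1 !scalerN opprD.
      + by rewrite map_mxD !map_mxZ rmorphN /= conjCi cDE opprK addrC.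
      + by rewrite linearD !linearZ /= k2 kd2 !scalerN opprD.
      + by rewrite map_mxD !map_mxZ rmorphN /= conjCi cDE opprK addrC.
      exact: eqv_lin.
    - by rewrite mulmxDr mulmxDl -!scalemxAr -!scalemxAl (comm _ _ _ a1) (comm _ _ _ b1).
    - by rewrite mulmxDr mulmxDl -!scalemxAr -!scalemxAl (comm _ _ _ a2) (comm _ _ _ b2).
    rewrite /tau !mulmxDr -!scalemxAr !mxtraceD !mxtraceZ addrACA -!mulrDr.
    by rewrite -/(tau A E1 B E2) -/(tau A D1 B D2) oE oD !mulr0 addr0.
  have half m (X Y : 'M[C]_m) : X + Y = 0 -> 'i *: X + (- 'i) *: Y = 0 -> X = 0.
    move=> /eqP; rewrite addr_eq0 => /eqP ->; rewrite scalerN scaleNr -opprD -scalerDr.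
    move=> /eqP; rewrite oppr_eq0 scaler_eq0 (negPf (neq0Ci _)) /= -mulr2n.
    by rewrite -scaler_nat scaler_eq0 pnatr_eq0 /= => /eqP ->; rewrite oppr0.
  by apply: nzE; split; [apply: half R0.1 I1|apply: half R0.2 I2].
have [al alR emu] := imag_norm muh.
have al0 : al != 0 by apply: contraNneq mu0 => e; rewrite emu e mulr0.
pose H1 := E1 *m D1 - D1 *m E1; pose H2 := E2 *m D2 - D2 *m E2.
have eH : eqv H1 H2 F by apply: eqv_comm.
have kH m (X Y : 'M[C]_m) : X^T = - X -> Y^T = - Y ->
   (X *m Y - Y *m X)^T = - (X *m Y - Y *m X).
  by move=> kX kY; rewrite linearB /= !trmx_mul kX kY !mulmxN !mulNmx !opprK opprB.
have cH m (X Y : 'M[C]_m) : Y = cj X -> cj ('i *: (X *m Y - Y *m X)) = 'i *: (X *m Y - Y *m X).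
  by move=> ->; rewrite map_mxZ map_mxB !map_mxM !cDE /= conjCi scaleNr -scalerN opprB.
have comH m (M X Y : 'M[C]_m) : M *m X - X *m M = mu *: X -> M *m Y - Y *m M = conjC mu *: Y ->
    M *m (X *m Y - Y *m X) = (X *m Y - Y *m X) *m M.
  move=> /eqP; rewrite subr_eq => /eqP eX /eqP; rewrite subr_eq => /eqP eY.
  have c2 (X' Y' : 'M[C]_m) l l' : M *m X' = l *: X' + X' *m M ->
      M *m Y' = l' *: Y' + Y' *m M -> l + l' = 0 -> M *m (X' *m Y') = X' *m Y' *m M.
    move=> e1 e2 ll; rewrite mulmxA e1 mulmxDl -scalemxAl -mulmxA e2 mulmxDr.
    by rewrite -scalemxAr addrA -scalerDl ll scale0r add0r mulmxA.
  rewrite mulmxBr mulmxBl (c2 _ _ _ _ eX eY) ?(c2 _ _ _ _ eY eX) // muh ?subrr //.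
  by rewrite addNr.
(* Chosen to make i (H1, H2) - kap (A, B) orthogonal to (A, B); the factor i turns the commutator of
   conjugates into a real pair. *)
pose kap := 'i * tau A H1 B H2 / tau A A B B.
have tauH : tau A H1 B H2 = mu * h.
  by rewrite /tau -!tr1 a1 a2 -!scalemxAl !mxtraceZ -mulrDr.
have tAA := tau_self_neq0.
have tauR : tau A A B B \is Num.real.
  apply/CrealP; rewrite /tau rmorphD /= -!trace_map_mx !map_mxM cA cB //.
have kapR : kap \is Num.real.
  have hR : h \is Num.real.
    apply/CrealP; rewrite /h /tau rmorphD /= -!trace_map_mx !map_mxM !cDE.
    by congr (_ + _); rewrite mxtrace_mulC.
  rewrite /kap tauH emu !mulrA -expr2 sqrCi mulN1r !mulNr.
  by rewrite rpredN rpredM ?rpredV // rpredM.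
have [W1 W2] : 1 *: ('i *: H1) + (- kap) *: A = 0 /\ 1 *: ('i *: H2) + (- kap) *: B = 0.
  have sH : sym ('i *: H1) ('i *: H2).
    split; [apply: kreal|apply: kreal|].
    - by rewrite linearZ /= kH // scalerN.
    - exact: cH.
    - by rewrite linearZ /= kH // scalerN.
    - exact: cH.
    by have := eqv_lin 'i 0 eH eH; rewrite !scale0r !addr0.
  apply: orth_commuting.
  - by apply: sym_lin; rewrite ?rpredN ?rpred1.
  - by rewrite !scale1r mulmxDr mulmxDl -!scalemxAr -!scalemxAl (comH _ _ _ _ a1 b1).
  - by rewrite !scale1r mulmxDr mulmxDl -!scalemxAr -!scalemxAl (comH _ _ _ _ a2 b2).
  rewrite !scale1r /tau !mulmxDr -!scalemxAr !mxtraceD !mxtraceZ addrACA -!mulrDr.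
  rewrite -/(tau A A B B) -/(tau A H1 B H2) mulNr /kap divfK //.
  by rewrite subrr.
have kap0 : kap != 0.
  by rewrite /kap tauH !mulf_neq0 ?neq0Ci ?invr_eq0.
have EG : E2 *m D2 = D2 *m E2 + (- 'i * kap) *: B.
  have iH : 'i *: H2 = kap *: B.
    by apply/eqP; rewrite -subr_eq0 -scaleNr -[X in X + _]scale1r W2.
  apply/eqP; rewrite addrC -subr_eq -/H2; apply/eqP.
  by rewrite -scalerA -iH scalerA mulNr -expr2 sqrCi opprK scale1r.
have shift m (M X : 'M[C]_m) l : M *m X - X *m M = l *: X -> X *m M = M *m X + (- l) *: X.
  by move=> e; rewrite scaleNr -e opprB addrC subrK.
suff : (n <= p)%N by rewrite leqNgt pn.
(* Since E A = A E - mu E, the raising operator is D when al > 0 and E when al < 0. *)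
have [alp|aln] := real_ltP (real0 _) alR.
  apply: (@raising_source_leq _ _ _ _ _ tk F2 hp A B sAB A0 D1 D2 E2 al ('i * kap)) => //.
  - by rewrite mulf_neq0 ?neq0Ci.
  - by rewrite (shift _ _ _ _ b1) muh emu opprK.
  - by rewrite (shift _ _ _ _ b2) muh emu opprK.
  - by rewrite (shift _ _ _ _ a2) emu scaleNr.
  by rewrite EG mulNr scaleNr addrNK.
apply: (@raising_source_leq _ _ _ _ _ tk F2 hp A B sAB A0 E1 E2 D2 (- al) (- 'i * kap)) => //.
- by rewrite oppr_gt0 lt_neqAle al0.
- by rewrite mulf_neq0 ?oppr_eq0 ?neq0Ci.
- by rewrite (shift _ _ _ _ a1) emu mulrN.
- by rewrite (shift _ _ _ _ a2) emu mulrN.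
by rewrite (shift _ _ _ _ b2) muh emu opprK mulrN scaleNr opprK.
Qed.
End FixedElement.
End Final.

Section Dim.
Variables (C : numClosedFieldType) (n p N : nat) (F : 'I_p -> {mpoly C[n]}).
Hypotheses (tk : TK N F) (F2 : forall j, ordge 2 (F j)).
Hypothesis hp : (1 < p)%N \/ (0 < p)%N /\ forall j, ordge 3 (F j).
Hypothesis F_real : forall j, map_mpoly conjC (F j) = F j.
Hypothesis pn : (p < n)%N.

(** An independent second symmetry, made orthogonal to (A, B), is a nonzero element of the complex
    skew symmetries orthogonal to (A, B). These are stable under the commutator with (A, B), and an
    eigenvector among them contradicts [no_raising]. *)
Theorem sym_dependent A B X Y : sym F A B -> sym F X Y -> exists a b,
  [/\ a \is Num.real, b \is Num.real, a != 0 \/ b != 0,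
     a *: A + b *: X = 0 & a *: B + b *: Y = 0].
Proof.
move=> sAB sXY; apply: boolp.contrapT => ind.
have AB0 : ~ (A = 0 /\ B = 0).
  move=> [A0 B0]; apply: ind; exists 1, 0; split; rewrite ?rpred1 ?rpred0 //.
  - by left; apply: oner_neq0.
  - by rewrite A0 scaler0 scale0r addr0.
  by rewrite B0 scaler0 scale0r addr0.
have [rA rB eAB] := sAB; have [rX rY eXY] := sXY.
have [[_ kA] [_ kB]] := (rA, rB).
have tR (U V : 'M[C]_n) (U' V' : 'M[C]_p) : rskew U -> rskew V -> rskew U' -> rskew V' ->
    tau U V U' V' \is Num.real.
  move=> hU hV hU' hV'; apply/CrealP.
  by rewrite /tau rmorphD /= -!trace_map_mx !map_mxM !rskew_conj.
have tAA : tau A A B B != 0 by apply: (tau_self_neq0 sAB AB0).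
pose t := tau A X B Y / tau A A B B.
have tr : t \is Num.real by rewrite rpredM ?rpredV ?tR.
pose X' := 1 *: X + (- t) *: A; pose Y' := 1 *: Y + (- t) *: B.
have [[_ kX'] [_ kY'] eX'] : sym F X' Y' by apply: sym_lin; rewrite ?rpred1 ?rpredN.
have oX' : tau A X' B Y' = 0.
  rewrite /tau /X' /Y' !scale1r !mulmxDr -!scalemxAr !mxtraceD !mxtraceZ addrACA -mulrDr.
  by rewrite -/(tau A X B Y) -/(tau A A B B) mulNr /t divfK // subrr.
have nz : ~ (X' = 0 /\ Y' = 0).
  move=> [X0 Y0]; apply: ind; exists (- t), 1; split; rewrite ?rpredN ?rpred1 //.
  - by right; apply: oner_neq0.
  - by rewrite addrC.
  by rewrite addrC.
(* Pairs of matrices are flattened to row vectors, so that the commutator with (A, B) becomes right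
   multiplication by [M]. *)
pose e1 (v : 'rV[C]_(n * n + p * p)) : 'M[C]_n := vec_mx (lsubmx v).
pose e2 (v : 'rV[C]_(n * n + p * p)) : 'M[C]_p := vec_mx (rsubmx v).
pose S v := [/\ (e1 v)^T = - e1 v, (e2 v)^T = - e2 v, eqv (e1 v) (e2 v) F &
   tau A (e1 v) B (e2 v) = 0].
pose M := block_mx (lin_mulmx A - lin_mulmxr A) 0 0 (lin_mulmx B - lin_mulmxr B).
have M1 v : e1 (v *m M) = A *m e1 v - e1 v *m A.
  rewrite /e1 -{1}[v]hsubmxK mul_row_block mulmx0 addr0 row_mxKl mulmxBr.
  by rewrite !mul_rV_lin linearB /= !mxvecK.
have M2 v : e2 (v *m M) = B *m e2 v - e2 v *m B.
  rewrite /e2 -{1}[v]hsubmxK mul_row_block !mulmx0 add0r row_mxKr mulmxBr.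
  by rewrite !mul_rV_lin linearB /= !mxvecK.
have L1 r v w : e1 (v - r *: w) = e1 v - r *: e1 w by rewrite /e1 !linearB !linearZ.
have L2 r v w : e2 (v - r *: w) = e2 v - r *: e2 w by rewrite /e2 !linearB !linearZ.
have tauL P1 P2 (U1 : 'M[C]_n) (U2 : 'M[C]_p) r :
    tau A (P1 - r *: U1) B (P2 - r *: U2) = tau A P1 B P2 - r * tau A U1 B U2.
  by rewrite /tau !mulmxBr -!scalemxAr !linearB !linearZ /=; ring.
have trc m (U V : 'M[C]_m) : \tr (U *m (U *m V - V *m U)) = 0.
  by rewrite mulmxBr linearB /= [X in _ - X]mxtrace_mulC -[V *m U *m U]mulmxA [X in _ - X]mxtrace_mulC mulmxA subrr.
have kc m (U V : 'M[C]_m) r : U^T = - U -> V^T = - V ->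
   (U *m V - V *m U - r *: V)^T = - (U *m V - V *m U - r *: V).
  move=> kU kV; rewrite [LHS]linearB [X in X - _]linearB linearZ /=.
  rewrite !trmx_mul kU kV !mulmxN !mulNmx !opprK scalerN opprK [RHS]opprB.
  by rewrite addrC opprB.
have [| | |v [l [[k1 k2 e o] v0 ev]]] :=
    @stable_eigenvector C _ M S (row_mx (mxvec X') (mxvec Y')).
- move=> r u [h1 h2 h3 h4]; rewrite /S L1 L2 M1 M2; split; [exact: kc|exact: kc| |].
    have := eqv_lin 1 (- r) (eqv_comm eAB h3) h3.
    by rewrite !scale1r !scaleNr.
  by rewrite tauL h4 /tau !trc addr0 mulr0 subr0.
- by rewrite /S /e1 /e2 row_mxKl row_mxKr !mxvecK.
- apply/eqP; rewrite -row_mx0 => /eq_row_mx [z1 z2]; apply: nz; split.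
    by rewrite -(mxvecK X') z1 linear0.
  by rewrite -(mxvecK Y') z2 linear0.
apply: (no_raising tk F2 hp F_real pn sAB AB0 k1 k2 e o (mu := l)).
- move=> [z1 z2]; case/eqP: v0; rewrite -[v]hsubmxK -(vec_mxK (lsubmx v)) -(vec_mxK (rsubmx v)).
  by rewrite -/(e1 v) -/(e2 v) z1 z2 !linear0 row_mx0.
- by rewrite -M1 ev /e1 !linearZ.
by rewrite -M2 ev /e2 !linearZ.
Qed.
End Dim.

(** * Jets and contact equivalence *)

Section CoefDerivation.
Variables (K : comNzRingType) (D : K -> K) (dD : derivation D).

Lemma derivation0 : D 0 = 0.
Proof. by have := dD.1 0 0; rewrite addr0 => /eqP; rewrite -subr_eq0 opprD addrA subrr sub0r oppr_eq0 => /eqP. Qed.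

Lemma derivationN x : D (- x) = - D x.
Proof. by apply/eqP; rewrite -addr_eq0 -dD.1 addNr derivation0. Qed.

Lemma derivation_nat k : D k%:R = 0.
Proof.
have D1 : D 1 = 0.
  by have := dD.2 1 1; rewrite !mulr1 mul1r => /eqP; rewrite -subr_eq0 opprD addrA subrr sub0r oppr_eq0 => /eqP.
by elim: k => [|k IH]; rewrite ?derivation0 // -natr1 dD.1 IH D1 addr0.
Qed.

Lemma derivation_sum (I : Type) (r : seq I) (P : pred I) (E : I -> K) :
  D (\sum_(i <- r | P i) E i) = \sum_(i <- r | P i) D (E i).
Proof. by elim/big_rec2: _ => [|i x y _ <-]; rewrite ?derivation0 ?dD.1. Qed.

Definition dcoef n (P : {mpoly K[n]}) : {mpoly K[n]} := \sum_(m <- msupp P) D P@_m *: 'X_[m].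

Lemma mcoeff_dcoef n (P : {mpoly K[n]}) m : (dcoef P)@_m = D P@_m.
Proof.
rewrite /dcoef raddf_sum /=; under eq_bigr do rewrite mcoeffZ mcoeffX.
have [mP|mNP] := boolP (m \in msupp P).
  rewrite (bigD1_seq m) ?msupp_uniq //= eqxx mulr1 big1 ?addr0 // => i /negPf ->.
  by rewrite mulr0.
rewrite (memN_msupp_eq0 mNP) derivation0 big_seq big1 // => i iP.
by case: eqP => [E|]; rewrite ?mulr0 //; move: mNP; rewrite -E iP.
Qed.

Lemma dcoefD n (P Q : {mpoly K[n]}) : dcoef (P + Q) = dcoef P + dcoef Q.
Proof. by apply/mpolyP => m; rewrite mcoeffD !mcoeff_dcoef mcoeffD dD.1. Qed.

Lemma dcoefN n (P : {mpoly K[n]}) : dcoef (- P) = - dcoef P.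
Proof. by apply/mpolyP => m; rewrite mcoeffN !mcoeff_dcoef mcoeffN derivationN. Qed.

Lemma dcoefM n (P Q : {mpoly K[n]}) : dcoef (P * Q) = dcoef P * Q + P * dcoef Q.
Proof.
apply/mpolyP => m; rewrite mcoeffD mcoeff_dcoef !mcoeffM derivation_sum -big_split /=.
by apply: eq_bigr => k _; rewrite dD.2 !mcoeff_dcoef.
Qed.

Lemma dcoef_sum n (I : Type) (r : seq I) (E : I -> {mpoly K[n]}) :
  dcoef (\sum_(i <- r) E i) = \sum_(i <- r) dcoef (E i).
Proof.
elim: r => [|i r IH]; last by rewrite !big_cons dcoefD IH.
by rewrite !big_nil; apply/mpolyP => m; rewrite mcoeff_dcoef mcoeff0 derivation0.
Qed.

Lemma dcoefC n c : dcoef (c%:MP : {mpoly K[n]}) = (D c)%:MP.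
Proof.
apply/mpolyP => m; rewrite mcoeff_dcoef !mcoeffC.
by rewrite dD.2 derivation_nat mulr0 addr0.
Qed.

Lemma dcoefX n (i : 'I_n) : dcoef ('X_i : {mpoly K[n]}) = 0.
Proof. by apply/mpolyP => m; rewrite mcoeff_dcoef mcoeffX mcoeff0 derivation_nat. Qed.

Lemma ordge_dcoef n d (P : {mpoly K[n]}) : ordge d P -> ordge d (dcoef P).
Proof. by move=> h m lt; rewrite mcoeff_dcoef h // derivation0. Qed.

Lemma dcoef_msub n r (Phi : 'I_n -> {mpoly K[r]}) P :
  dcoef (msub Phi P) = msub Phi (dcoef P) + \sum_i msub Phi P^`M(i) * dcoef (Phi i).
Proof.
elim/mpoly_gen_ind: P => [c|i|P Q IHP IHQ|P Q IHP IHQ].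
- rewrite msubC !dcoefC msubC big1 ?addr0 // => i _.
  by rewrite mderivC rmorph0 mul0r.
- rewrite msubX dcoefX rmorph0 add0r (bigD1 i) //= mderivX mnm1E eqxx scale1r.
  have ->: (U_(i) - U_(i) = 0)%MM by apply/mnmP => k; rewrite mnmBE subnn mnm0E.
  rewrite mpolyX0 rmorph1 mul1r big1 ?addr0 // => k ne.
  by rewrite mderivX mnm1E eq_sym (negPf ne) scale0r rmorph0 mul0r.
- rewrite rmorphD !dcoefD rmorphD IHP IHQ addrACA -big_split /=; congr (_ + _).
  by apply: eq_bigr => i _; rewrite mderivD rmorphD mulrDl.
rewrite rmorphM !dcoefM rmorphD !rmorphM /= IHP IHQ.
under [in RHS]eq_bigr do rewrite mderivM rmorphD !rmorphM /= mulrDl mulrAC -[_ * _ * dcoef _]mulrA.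
by rewrite big_split /= -mulr_suml -mulr_sumr; ring.
Qed.
End CoefDerivation.

(** * Contact equivalence of jets and its derivative *)

Section KEquivalence.
Variables (K : fieldType) (n p N : nat).
Implicit Types (F G : 'I_p -> {mpoly K[n]}).

Definition const_matrix (M : 'I_p -> 'I_p -> {mpoly K[n]}) : 'M[K]_p := \matrix_(l, j) (M l j)@_0%MM.

(* F \o Phi = G . M  modulo terms of degree > N *)
Definition jet_equiv F G :=
  exists (Phi Psi : 'I_n -> {mpoly K[n]}) (M M' : 'I_p -> 'I_p -> {mpoly K[n]}),
  [/\ forall i, ordge 1 (Phi i) /\ ordge 1 (Psi i),
      forall i, ordge N.+1 (msub Psi (Phi i) - 'X_i),
      forall j, ordge N.+1 (msub Phi (F j) - \sum_l G l * M l j),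
      const_matrix M \in unitmx &
      forall l, ordge N.+1 (G l - \sum_j msub Phi (F j) * M' j l)].

Lemma ordge_trans d (P Q R : {mpoly K[n]}) : ordge d (P - Q) -> ordge d (Q - R) -> ordge d (P - R).
Proof. by move=> h h'; rewrite -(subrK Q P) -addrA; apply: ordgeD. Qed.

Lemma ordge_sym d (P Q : {mpoly K[n]}) : ordge d (P - Q) -> ordge d (Q - P).
Proof. by move=> h; rewrite -opprB; apply: ordgeN. Qed.

Lemma mcoeff0_msub (h : 'I_n -> {mpoly K[n]}) P : (forall i, ordge 1 (h i)) ->
  (msub h P)@_0%MM = P@_0%MM.
Proof.
move=> h1; apply/eqP; rewrite -subr_eq0.
have -> : P@_0%MM = (msub h (P@_0%MM)%:MP)@_0%MM by rewrite msubC mcoeffC eqxx mulr1.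
rewrite -mcoeffB -rmorphB /=; apply/eqP; apply: (ordge_msub h1 (d := 1)); rewrite ?mdeg0 //.
by apply/ordge1E; rewrite mcoeffB mcoeffC eqxx mulr1 subrr.
Qed.

Lemma mcoeff0M (P Q : {mpoly K[n]}) : (P * Q)@_0%MM = P@_0%MM * Q@_0%MM.
Proof. exact: (rmorphM (mcoeff 0%MM)). Qed.

Lemma jet_equiv_trans F1 F2 F3 : jet_equiv F1 F2 -> jet_equiv F2 F3 -> jet_equiv F1 F3.
Proof.
move=> [Phi1 [Psi1 [M1 [M1' [o1 i1 e1 u1 e1']]]]] [Phi2 [Psi2 [M2 [M2' [o2 i2 e2 u2 e2']]]]].
have oP1 i : ordge 1 (Phi1 i) by case: (o1 i).
have oP2 i : ordge 1 (Phi2 i) by case: (o2 i).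
have oS1 i : ordge 1 (Psi1 i) by case: (o1 i).
have oS2 i : ordge 1 (Psi2 i) by case: (o2 i).
exists (fun i => msub Phi2 (Phi1 i)), (fun i => msub Psi1 (Psi2 i)),
  (fun l j => \sum_k M2 l k * msub Phi2 (M1 k j)), (fun j l => \sum_k msub Phi2 (M1' j k) * M2' k l).
split.
- by move=> i; split; apply: ordge_msub.
- move=> i; rewrite msub_comp; apply: ordge_trans (i1 i).
  have -> : msub (msub (fun i => msub Psi1 (Psi2 i)) \o Phi2) (Phi1 i) =
            msub Psi1 (msub (msub Psi2 \o Phi2) (Phi1 i)).
    by rewrite msub_comp; apply: eq_msub => k /=; rewrite msub_comp.
  rewrite -[X in ordge _ (_ - msub _ X)]msub_id -rmorphB /=; apply: ordge_msub => //.
  exact: ordge_msubB.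
- move=> j; rewrite -(msub_comp Phi1 Phi2).
  apply: (@ordge_trans _ _ (msub Phi2 (\sum_l F2 l * M1 l j))).
    by rewrite -rmorphB; apply: ordge_msub.
  rewrite msub_sum.
  have -> : \sum_l F3 l * (\sum_k M2 l k * msub Phi2 (M1 k j)) =
     \sum_k (\sum_l F3 l * M2 l k) * msub Phi2 (M1 k j).
    under eq_bigr do rewrite mulr_sumr.
    rewrite exchange_big /=; apply: eq_bigr => k _; rewrite mulr_suml.
    by apply: eq_bigr => l _; rewrite mulrA.
  rewrite -sumrB; apply: ordge_sum => k _; rewrite rmorphM /= -mulrBl.
  by apply: ordgeMl.
- suff -> : const_matrix (fun l j => \sum_k M2 l k * msub Phi2 (M1 k j)) =
     const_matrix M2 *m const_matrix M1 by rewrite unitmx_mul u2.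
  apply/matrixP => l j; rewrite !mxE (raddf_sum (mcoeff 0%MM)); apply: eq_bigr => k _ /=.
  by rewrite mcoeff0M mcoeff0_msub // !mxE.
move=> l; apply: ordge_trans (e2' l) _.
have -> : \sum_j msub (fun i => msub Phi2 (Phi1 i)) (F1 j) * (\sum_k msub Phi2 (M1' j k) * M2' k l)
   = \sum_k msub Phi2 (\sum_j msub Phi1 (F1 j) * M1' j k) * M2' k l.
  under eq_bigr do rewrite mulr_sumr.
  rewrite exchange_big /=; apply: eq_bigr => k _; rewrite msub_sum mulr_suml.
  by apply: eq_bigr => j _; rewrite rmorphM /= msub_comp mulrA.
rewrite -sumrB; apply: ordge_sum => k _; rewrite -mulrBl -rmorphB.
by apply: ordgeMl; apply: ordge_msub.
Qed.

Lemma jet_equiv_ordge F G d : (d <= N.+1)%N -> jet_equiv F G ->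
  (forall j, ordge d (G j)) -> forall j, ordge d (F j).
Proof.
move=> dN [Phi [Psi [M [M' [o i e u e']]]]] hG j.
have oP k : ordge 1 (Phi k) by case: (o k).
have oS k : ordge 1 (Psi k) by case: (o k).
have h : ordge d (msub Phi (F j)).
  rewrite -(subrK (\sum_l G l * M l j) (msub _ _)); apply: ordgeD.
    by apply: ordgeW dN (e j).
  by apply: ordge_sum => l _; apply: ordgeMl.
have := ordge_msub oS h; rewrite msub_comp => h'.
rewrite -(subrK (msub (msub Psi \o Phi) (F j)) (F j)); apply: ordgeD => //.
apply: ordgeW dN _; rewrite -{1}[F j]msub_id; apply: ordge_msubB => k.
by apply: ordge_sym; apply: i.
Qed.

(** As D kills the coefficients of [F] and sends those of [G] to those of [h], applying it to F(Phi)
    = G M gives dF(Phi) D(Phi) = h M + G D(M). Composition with Psi moves this back to the source,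
    where [M'] rewrites G(Psi) through [F]; so h M composed with Psi lies in the tangent space. *)
Theorem TK_of_generic F G : jet_equiv F G ->
  (forall h : 'I_p -> {mpoly K[n]}, (forall l, ordge N (h l) /\ (msize (h l) <= N.+1)%N) ->
    exists D : K -> K, [/\ derivation D, forall j, dcoef D (F j) = 0 & forall l, dcoef D (G l) = h l]) ->
  TK N F.
Proof.
move=> [Phi [Psi [M [M' [o i e u e']]]]] hD m j0 mN.
have oP k : ordge 1 (Phi k) by case: (o k).
have oS k : ordge 1 (Psi k) by case: (o k).
pose c := const_matrix M; pose T := mtrunc N.+1 (msub Phi 'X_[m]).
have ordT : ordge N T.
  move=> m' lt; rewrite mcoeff_trunc; case: ifP => // _.
  by apply: (ordge_msub oP (d := N)) => //; rewrite -mN; apply: ordgeX.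
(* As T has order N, only the constant part c of [M] matters up to degree N: h M is T in component
   [j0], and T composed with Psi is ['X_[m]]. *)
pose h l := (invmx c j0 l) *: T.
have [|D [dD DF DG]] := hD h.
  move=> l; split; first exact: ordgeZ.
  by apply: leq_trans (msizeZ_le _ _) _; apply: msize_trunc.
pose xi k := msub Psi (dcoef D (Phi k)).
pose M2 k j := \sum_l msub Psi (M' k l * dcoef D (M l j)).
exists xi, (fun k j => - M2 k j) => j.
have back P : ordge N.+1 (msub Psi (msub Phi P) - P).
  by rewrite -[X in _ - X]msub_id msub_comp; apply: ordge_msubB.
have E : ordge N.+1 (\sum_k msub Phi (F j)^`M(k) * dcoef D (Phi k)
     - (\sum_l h l * M l j + \sum_l G l * dcoef D (M l j))).
  have := ordge_dcoef dD (e j); rewrite dcoefD // dcoefN // dcoef_msub // DF rmorph0 add0r.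
  congr (ordge _ (_ - _)); rewrite dcoef_sum // -big_split /=; apply: eq_bigr => l _.
  by rewrite dcoefM // DG.
have {}E := ordge_msub oS E.
have hM l : ordge N.+1 (h l * M l j - (invmx c j0 l * c l j) *: T).
  have -> : h l * M l j - (invmx c j0 l * c l j) *: T = h l * (M l j - (c l j)%:MP).
    by rewrite mulrBr; congr (_ - _); rewrite [RHS]mulrC mul_mpolyC /h scalerA mulrC.
  rewrite -addn1; apply: ordgeM; first exact: ordgeZ.
  by apply/ordge1E; rewrite mcoeffB mcoeffC eqxx mulr1 mxE subrr.
have hT : ordge N.+1 (\sum_l h l * M l j - (j0 == j)%:R *: T).
  have -> : (j0 == j)%:R *: T = \sum_l (invmx c j0 l * c l j) *: T.
    rewrite -scaler_suml; congr (_ *: _).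
    by have /matrixP/(_ j0 j) := mulVmx u; rewrite !mxE.
  by rewrite -sumrB; apply: ordge_sum.
have ST : ordge N.+1 (msub Psi T - 'X_[m]).
  apply: ordge_trans (back _); rewrite -rmorphB; apply: ordge_msub => //.
  by apply: ordge_sym; apply: ordge_trunc.
have SG : ordge N.+1 (msub Psi (\sum_l G l * dcoef D (M l j)) - \sum_k F k * M2 k j).
  apply: (@ordge_trans _ _ (msub Psi (\sum_l (\sum_k msub Phi (F k) * M' k l) * dcoef D (M l j)))).
    rewrite -rmorphB; apply: ordge_msub => //; rewrite -sumrB; apply: ordge_sum => l _.
    by rewrite -mulrBl; apply: ordgeMl.
  rewrite msub_sum.
  have -> : \sum_l msub Psi ((\sum_k msub Phi (F k) * M' k l) * dcoef D (M l j)) =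
      \sum_k msub Psi (msub Phi (F k)) * M2 k j.
    under eq_bigr do rewrite mulr_suml msub_sum.
    rewrite exchange_big /=; apply: eq_bigr => k _; rewrite mulr_sumr; apply: eq_bigr => l _.
    by rewrite -rmorphM /= mulrA.
  by rewrite -sumrB; apply: ordge_sum => k _; rewrite -mulrBl; apply: ordgeMl.
have SX : ordge N.+1 (msub Psi (\sum_k msub Phi (F j)^`M(k) * dcoef D (Phi k)) - \sum_k xi k * (F j)^`M(k)).
  rewrite msub_sum -sumrB; apply: ordge_sum => k _; rewrite rmorphM /= [xi k * _]mulrC.
  by rewrite -/(xi k) -mulrBl; apply: ordgeMl.
have Sh : ordge N.+1 (msub Psi (\sum_l h l * M l j) - (j == j0)%:R *: 'X_[m]).
  apply: (@ordge_trans _ _ (msub Psi ((j0 == j)%:R *: T))).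
    by rewrite -rmorphB; apply: ordge_msub.
  by rewrite msubZ eq_sym -scalerBr; apply: ordgeZ.
under [X in _ - X]eq_bigr do rewrite mulrN.
rewrite sumrN opprK.
rewrite rmorphB rmorphD /= in E.
set a := msub Psi _ in E; set b := msub Psi _ in E; set d := msub Psi _ in E.
rewrite -/a in SX; rewrite -/b in Sh; rewrite -/d in SG.
set x := _ *: _; set y := \sum_k _ * _; set z := \sum_k _ * _.
have -> : x - y + z = - (b - x) + (a - y) - (d - z) - (a - (b + d)) by ring.
by apply: ordgeB => //; apply: ordgeB => //; apply: ordgeD => //; apply: ordgeN.
Qed.
End KEquivalence.

Lemma mcoeff0E n (K : comNzRingType) (P : {mpoly K[n]}) : P@_0%MM = P.@[fun=> 0].
Proof.
elim/mpoly_gen_ind: P => [c|i|p q IHp IHq|p q IHp IHq].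
- by rewrite mevalC mcoeffC eqxx mulr1.
- by rewrite mevalXU mcoeffX mnm1_eq0.
- by rewrite mcoeffD mevalD IHp IHq.
- by rewrite mevalM -IHp -IHq; exact: (rmorphM (mcoeff 0%MM)).
Qed.

Lemma mcoeff0_subst n r (K : comNzRingType) (h : 'I_n -> {mpoly K[r]}) P :
  (forall i, ordge 1 (h i)) -> (msub h P)@_0%MM = P@_0%MM.
Proof.
move=> h1; rewrite !mcoeff0E meval_msub; apply: meval_eq => i.
by rewrite -mcoeff0E; apply/ordge1E.
Qed.

Lemma size_ray n (K : comNzRingType) (v : 'rV[K]_n) d (P : {mpoly K[n]}) :
  (msize P <= d)%N -> (size (ray v P) <= d)%N.
Proof.
move=> Pd; rewrite (mpolyE P) ray_sum big_seq.
apply: (leq_trans (size_sum _ _ _)); apply/bigmax_leqP_seq => m mP _.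
rewrite rayZ /ray mcurveXm; under eq_bigr do rewrite exprZn.
rewrite scaler_prod; apply: leq_trans (size_scale_leq _ _) _.
apply: leq_trans (size_scale_leq _ _) _.
rewrite -expr_sum size_polyXn -mdegE; exact: leq_trans (msize_mdeg_lt mP) Pd.
Qed.

(** * From Taylor polynomials of a contact map to an equivalence of jets *)

Section Graph.
Variables (K : fieldType) (n p : nat).

Definition pair_sub T (a : 'I_n -> T) (b : 'I_p -> T) (i : 'I_(n + p)) : T :=
  match split i with inl i => a i | inr j => b j end.

Lemma pair_subl T a b i : @pair_sub T a b (lshift p i) = a i.
Proof. by rewrite /pair_sub; case: split_ordP => j /eqP; rewrite ?eq_lshift ?eq_lrshift // => /eqP ->. Qed.

Lemma pair_subr T a b i : @pair_sub T a b (rshift n i) = b i.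
Proof. by rewrite /pair_sub; case: split_ordP => j /eqP; rewrite ?eq_rshift ?eq_rlshift // => /eqP ->. Qed.

Let base (P : {mpoly K[n + p]}) : {mpoly K[n]} := msub (pair_sub (fun i => 'X_i) (fun=> 0)) P.
Let lift (P : {mpoly K[n]}) : {mpoly K[n + p]} := msub (fun i => 'X_(lshift p i)) P.

(** Hadamard's lemma for polynomials: what vanishes on y = 0 is a combination of the y_l. *)
Lemma base_expand (P : {mpoly K[n + p]}) : exists M : 'I_p -> {mpoly K[n + p]},
  P = lift (base P) + \sum_l 'X_(rshift n l) * M l.
Proof.
elim/mpoly_gen_ind: P => [c|i|P Q [M e] [M' e']|P Q [M e] [M' e']].
- exists (fun=> 0); rewrite /base /lift !msubC big1 ?addr0 // => l _; exact: mulr0.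
- rewrite /base /lift msubX; case: (split_ordP i) => j ->.
    exists (fun=> 0); rewrite pair_subl msubX big1 ?addr0 // => l _; exact: mulr0.
  exists (fun l => (l == j)%:R); rewrite pair_subr rmorph0 add0r (bigD1 j) //= eqxx mulr1.
  by rewrite big1 ?addr0 // => l /negPf ->; rewrite mulr0.
- exists (fun l => M l + M' l); rewrite {1}e {1}e' /base /lift !rmorphD addrACA -big_split /=.
  by congr (_ + _); apply: eq_bigr => l _; rewrite mulrDr.
- exists (fun l => M l * Q + lift (base P) * M' l); rewrite /base /lift !rmorphM /=.
  rewrite {1}e mulrDl {1}e' mulrDr -addrA; congr (_ + _).
  rewrite addrC mulr_suml mulr_sumr -big_split; apply: eq_bigr => l _ /=.
  by rewrite mulrDr mulrA; congr (_ + _); rewrite mulrCA.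
Qed.

Lemma lin_coefM (P Q : {mpoly K[n + p]}) i :
  (P * Q)@_U_(i) = P@_U_(i) * Q@_0%MM + P@_0%MM * Q@_U_(i).
Proof.
have E (S : {mpoly K[n + p]}) : S@_U_(i) = S^`M(i)@_0%MM.
  by rewrite mcoeff_deriv add0m mnm0E mulr1n.
by rewrite !E mderivM mcoeffD !mcoeff0M.
Qed.

(** (T, S) stands for the jet of the contact map and S' for the target part of its inverse. As S
    vanishes on y = 0, the relation f(h(x)) = S(x, g(x)) expresses f(h(x)) as g(x) times a matrix,
    and S' gives a matrix in the other direction. *)
Lemma jet_equiv_of_graph N (Phi Psi : 'I_n -> {mpoly K[n]}) (F G : 'I_p -> {mpoly K[n]})
    (T : 'I_n -> {mpoly K[n + p]}) (S S' : 'I_p -> {mpoly K[n + p]}) :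
  (0 < N)%N ->
  (forall i, [/\ ordge 1 (Phi i), ordge 1 (Psi i) & ordge 1 (T i)]) ->
  (forall j, [/\ ordge 1 (F j), ordge 1 (G j) & ordge 1 (S j)]) ->
  (forall i, ordge N.+1 (msub Psi (Phi i) - 'X_i)) ->
  (forall j, ordge N.+1 (base (S j)) /\ ordge N.+1 (base (S' j))) ->
  (forall j, ordge N.+1 (msub Phi (F j) - msub (pair_sub (fun i => 'X_i) G) (S j))) ->
  (forall j, ordge N.+1 (G j - msub (pair_sub Phi (fun k => msub Phi (F k))) (S' j))) ->
  (forall j, ordge N.+1 ('X_(rshift n j) - msub (pair_sub T S) (S' j))) ->
  jet_equiv N F G.
Proof.
move=> N0 o1 o2 inv oS FS GS' inv'.
have [M hM] := fin_all_exists (fun j => base_expand (S j)).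
have [M' hM'] := fin_all_exists (fun j => base_expand (S' j)).
have X1 i : ordge 1 ('X_i : {mpoly K[n]}) by exact: ordgeX1.
have expand r (a : 'I_n -> {mpoly K[r]}) (b : 'I_p -> {mpoly K[r]}) P L : (forall i, ordge 1 (a i)) ->
    ordge N.+1 (base P) -> P = lift (base P) + \sum_l 'X_(rshift n l) * L l ->
    ordge N.+1 (msub (pair_sub a b) P - \sum_l b l * msub (pair_sub a b) (L l)).
  move=> oa oP ->; rewrite rmorphD /= [X in _ + X - _]msub_sum -addrA -sumrB big1 ?addr0; last first.
    by move=> l _; rewrite rmorphM /= msubX pair_subr subrr.
  rewrite /lift msub_comp (eq_msub (h' := a)) => [|i]; last by rewrite /= msubX pair_subl.
  exact: ordge_msub.
exists Phi, Psi, (fun l j => msub (pair_sub (fun i => 'X_i) G) (M j l)),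
  (fun j l => msub (pair_sub Phi (fun k => msub Phi (F k))) (M' l j)); split=> //.
- by move=> i; case: (o1 i).
- move=> j; apply: ordge_trans (FS j) _; apply: expand => //; by case: (oS j).
(* Comparing the coefficients of y_k in y_l = S'_l(T, S) shows that the constant parts of the two
   matrices are inverse to each other. *)
- set A := const_matrix _.
  pose B : 'M[K]_p := \matrix_(j, l) (M' l j)@_0%MM.
  suff /mulmx1_unit[] : A *m B = 1%:M by [].
  apply/matrixP => k l; rewrite !mxE.
  have oz (a : 'I_n -> {mpoly K[n+p]}) b : (forall i, ordge 1 (a i)) -> (forall i, ordge 1 (b i)) ->
      forall i, ordge 1 (pair_sub a b i).
    by move=> ha hb i; case: (split_ordP i) => j ->; rewrite ?pair_subl ?pair_subr.
  have oz' (a : 'I_n -> {mpoly K[n]}) b : (forall i, ordge 1 (a i)) -> (forall i, ordge 1 (b i)) ->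
      forall i, ordge 1 (pair_sub a b i).
    by move=> ha hb i; case: (split_ordP i) => j ->; rewrite ?pair_subl ?pair_subr.
  have oT i : ordge 1 (T i) by case: (o1 i).
  have oS1 i : ordge 1 (S i) by case: (o2 i).
  have oG i : ordge 1 (G i) by case: (o2 i).
  have oS' : ordge N.+1 (base (S' l)) by case: (oS l).
  have := ordge_trans (inv' l) (expand _ T S _ _ oT oS' (hM' l)).
  move=> /(_ U_(rshift n k)%MM); rewrite mdeg1 ltnS => /(_ N0).
  rewrite mcoeffB mcoeffX eq_mnm1 eq_rshift (raddf_sum (mcoeff U_(_))) /= => /eqP.
  rewrite subr_eq0 => /eqP; rewrite eq_sym => ->.
  apply: eq_bigr => j _; rewrite !mxE lin_coefM.
  have -> : (S j)@_0%MM = 0 by apply/ordge1E.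
rewrite mul0r addr0 mcoeff0_subst; last exact: oz'.
rewrite mcoeff0_subst; last exact: oz.
congr (_ * _); rewrite (hM j) mcoeffD.
have -> : (lift (base (S j)))@_U_(rshift n k) = 0.
  rewrite /lift; have : ordge N.+1 (msub (fun i => 'X_(lshift p i)) (base (S j)) : {mpoly K[n+p]}).
    by apply: ordge_msub => [i|]; [exact: ordgeX1|case: (oS j)].
  by apply; rewrite mdeg1.
rewrite add0r (raddf_sum (mcoeff U_(_))) (bigD1 k) //= big1 => [|i ik]; last first.
  rewrite lin_coefM mcoeffXU eq_rshift (negPf ik) mul0r add0r.
  by rewrite (_ : _@_0%MM = 0) ?mul0r //; apply/ordge1E/ordgeX1.
rewrite addr0 lin_coefM mcoeffXU eqxx mul1r.
by rewrite [X in _ + X * _](_ : _ = 0) ?mul0r ?addr0 //; apply/ordge1E/ordgeX1.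
- move=> j; apply: ordge_trans (GS' j) _; apply: expand => //; last by case: (oS j).
  by move=> i; case: (o1 i).
Qed.
End Graph.

(** The coefficients of [h], all of degree N, are generic over those of [F] and [G], so a derivation
    can be prescribed on them as [TK_of_generic] demands. *)
Lemma generic_perturbation (K : fieldType) n p N (F G : 'I_p -> {mpoly K[n]}) :
  (forall (c : seq K) s, exists h : nat -> K, forall eta : nat -> K, exists D : K -> K,
    [/\ derivation D, forall x, x \in c -> D x = 0 & forall i, (i < s)%N -> D (h i) = eta i]) ->
  exists h : 'I_p -> {mpoly K[n]}, (forall l, ordge N (h l)) /\
    (jet_equiv N F (fun l => G l + h l) -> TK N F).
Proof.
pose coefs (P : {mpoly K[n]}) := [seq P@_m | m <- msupp P].
pose c := [seq x | j <- enum 'I_p, x <- coefs (F j) ++ coefs (G j)].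
have dcoef0 D P : derivation D -> (forall x, x \in coefs P -> D x = 0) -> dcoef D P = 0.
  move=> dD h; apply/mpolyP => m; rewrite (mcoeff_dcoef dD) mcoeff0.
  have [mP|/memN_msupp_eq0 ->] := boolP (m \in msupp P); last exact: derivation0.
  by apply: h; apply: map_f.
have mem_c j P : P \in [:: F j; G j] -> {subset coefs P <= c}.
  move=> hP x hx; apply/allpairsPdep; exists j, x; split=> //; first by rewrite mem_enum.
  by move: hP; rewrite mem_cat !inE => /orP[]/eqP <-; rewrite hx ?orbT.
pose T : finType := ('I_p * 'X_{1..n < N.+1})%type.
move=> /(_ c #|T|)[h hh].
pose H (l : 'I_p) : {mpoly K[n]} := \sum_(m : 'X_{1..n < N.+1} | mdeg m == N)
  h (enum_rank ((l, m) : T)) *: 'X_[m].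
exists H; split=> [l|je].
  by apply: ordge_sum => m /eqP mN; apply: ordgeZ; rewrite -{1}mN; apply: ordgeX.
apply: (TK_of_generic je) => eta heta.
pose e i := nth 0 [seq (eta lm.1)@_(bmnm lm.2) | lm <- enum T] i.
have [D [dD Dc De]] := hh e; exists D; split=> // [j|l].
  by apply: dcoef0 => // x hx; apply/Dc/(mem_c j (F j)); rewrite ?inE ?eqxx.
rewrite (dcoefD dD) dcoef0 ?add0r // => [|x hx]; last first.
  by apply/Dc/(mem_c l (G l)); rewrite ?inE ?eqxx ?orbT.
have [oe se] := heta l; rewrite [RHS](mpolywE se) /H.
rewrite [RHS](bigID (fun m : 'X_{1..n < N.+1} => mdeg m == N)) /= [X in _ = _ + X]big1 ?addr0; last first.
  move=> m mN; rewrite oe ?scale0r // ltn_neqAle mN -ltnS; exact: bmdeg.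
apply/mpolyP => a; rewrite (mcoeff_dcoef dD) !(raddf_sum (mcoeff a)) /= (derivation_sum dD).
apply: eq_bigr => m _; rewrite !mcoeffZ dD.2 mcoeffX (derivation_nat dD) mulr0 addr0.
by rewrite De // /e (nth_map ((l, m) : T)) -?cardE // nth_enum_rank.
Qed.

(** * Invariant forms and change of basis *)

From mathcomp Require Import complex.

Section PosDef.
Variable R : rcfType.

Definition posdef n (S : 'M[R]_n) := S^T = S /\ forall v : 'rV[R]_n, v != 0 -> 0 < (v *m S *m v^T) 0 0.

Lemma posdef_congr n (S T : 'M[R]_n) : T \in unitmx -> posdef S -> posdef (T *m S *m T^T).
Proof.
move=> uT [symS posS]; split; first by rewrite !trmx_mul trmxK symS mulmxA.
move=> v v0; have vT : v *m T != 0.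
  by apply: contraNneq v0 => e; rewrite -[v](mulmxK uT) e mul0mx.
by have := posS _ vT; rewrite trmx_mul !mulmxA.
Qed.

(** Gram-Schmidt by blocks: the first basis vector is split off, the Schur complement is again
    positive definite, and the remaining diagonal entry is normalized by its square root. *)
Lemma posdef_gram n (S : 'M[R]_n) : posdef S -> exists2 P : 'M[R]_n, P \in unitmx & P *m S *m P^T = 1%:M.
Proof.
elim: n S => [|n IH] S pS.
  by exists 1%:M; rewrite ?unitmx1 //; apply/matrixP => -[].
pose s := S 0 0; pose S' : 'M[R]_(1 + n) := S.
have [symS posS] := pS.
have s0 : 0 < s.
  have := posS (delta_mx 0 0); rewrite -rowE trmx_delta -colE !mxE; apply.
  by apply/eqP => /matrixP /(_ 0 0) /eqP; rewrite !mxE !eqxx oner_eq0.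
have ulS : ulsubmx S' = s%:M.
  by rewrite [LHS]mx11_scalar !mxE; congr (S _ _)%:M; apply: val_inj.
pose u := ursubmx S'.
have dlS : dlsubmx S' = u^T by rewrite /u trmx_ursub; congr dlsubmx; rewrite /S' symS.
pose T : 'M[R]_(1 + n) := block_mx 1%:M 0 (- (s^-1 *: u^T)) 1%:M.
have uT : T \in unitmx by rewrite unitmxE det_lblock !det1 mulr1 unitr1.
have pT := posdef_congr uT pS.
have eT : T *m S' *m T^T = block_mx s%:M 0 0 (drsubmx S' - s^-1 *: (u^T *m u)).
  rewrite -[S']submxK ulS dlS -/u /T tr_block_mx !mulmx_block !trmx1 !trmx0 !mul1mx !mul0mx !mulmx1 !mulmx0 !addr0.
  have e1 : - (s^-1 *: u^T) *m s%:M + u^T = 0.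
    by rewrite mulNmx -scalemxAl mul_mx_scalar scalerA mulVf ?gt_eqF // scale1r addNr.
  have e2 : s%:M *m (- (s^-1 *: u^T))^T + u = 0.
    by rewrite linearN linearZ /= trmxK mulmxN -scalemxAr mul_scalar_mx scalerA mulVf ?gt_eqF // scale1r addNr.
  by rewrite e1 e2 mul0mx add0r mulNmx -scalemxAl block_mxKdr [- _ + _]addrC.
have [|P2 uP2 eP2] := IH (drsubmx S' - s^-1 *: (u^T *m u)).
  have [symT posT] := pT; split.
    have := congr1 (@drsubmx R 1 n 1 n) symT.
    by rewrite -[in RHS]/S' -[S]/S' eT tr_block_mx !block_mxKdr.
  move=> v v0; have := posT (row_mx 0 v : 'rV_(1 + n)); rewrite -[S]/S' eT.
  rewrite mul_row_block !mul0mx !add0r mulmx0 tr_row_mx trmx0 mul_row_col mul0mx add0r; apply.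
  by apply: contraNneq v0; rewrite -row_mx0 => /eq_row_mx[_ ->].
pose D : 'M[R]_(1 + n) := block_mx ((Num.sqrt s)^-1)%:M 0 0 P2.
have rs0 : Num.sqrt s != 0 by rewrite gt_eqF // sqrtr_gt0.
have uD : D \in unitmx.
  rewrite unitmxE det_ublock unitrM det_scalar1 unitfE invr_eq0 rs0 /=.
  by rewrite -unitmxE.
exists (D *m T : 'M_(1 + n)); first by rewrite unitmx_mul uT andbT.
have -> : D *m T *m S *m (D *m T)^T = D *m (T *m S' *m T^T) *m D^T.
  by rewrite trmx_mul !mulmxA.
rewrite eT /D tr_block_mx !mulmx_block !trmx0 !mulmx0 !mul0mx !addr0 !add0r tr_scalar_mx eP2.
rewrite mul_scalar_mx scale_scalar_mx mul_mx_scalar scale_scalar_mx [X in (X)%:M](_ : _ = 1).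
  by rewrite !mul0mx -scalar_mx_block.
transitivity ((Num.sqrt s)^-1 * ((Num.sqrt s)^-1 * (Num.sqrt s ^+ 2))).
  by rewrite sqr_sqrtr // ltW.
by field.
Qed.
End PosDef.

Section Change.
Variables (K : comNzRingType) (n : nat) (P P' : 'M[K]_n).
Hypotheses (PP' : P *m P' = 1%:M) (P'P : P' *m P = 1%:M).

Lemma msub_lin_linX (A B : 'M[K]_n) i :
  msub (linsub A) (\sum_k B k i *: 'X_k) = linsub (A *m B) i.
Proof. by rewrite msub_linX. Qed.

Lemma linsub1 i : linsub (1%:M : 'M[K]_n) i = 'X_i.
Proof.
rewrite /linsub (bigD1 i) //= mxE eqxx scale1r big1 ?addr0 // => a /negPf ai.
by rewrite mxE ai scale0r.
Qed.

Lemma lie_change (A : 'M[K]_n) f :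
  lie (P *m A *m P') (msub (linsub P) f) = msub (linsub P) (lie A f).
Proof.
rewrite /lie msub_sum.
under eq_bigr do rewrite mderiv_msub mulr_sumr.
rewrite exchange_big /=; apply: eq_bigr => i _.
rewrite rmorphM /= mulrC msub_lin_linX.
under eq_bigr => j _ do rewrite mulrCA.
rewrite -mulr_sumr; congr (_ * _).
have E j : (linsub P i)^`M(j) = (P j i)%:MP.
  rewrite /linsub (raddf_sum (mderiv j)) (bigD1 j) //= mderivZ mderivXU eqxx big1 ?addr0.
    by rewrite -mul_mpolyC mulr1.
  by move=> a /negPf aj; rewrite mderivZ mderivXU aj mulr0n scaler0.
under eq_bigr => j _ do rewrite E mulr_suml.
rewrite exchange_big; apply: eq_bigr => a _ /=.
have PA : P *m A = P *m A *m P' *m P by rewrite -mulmxA P'P mulmx1.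
rewrite [in RHS]PA mxE scaler_suml; apply: eq_bigr => j _.
by rewrite -scalerAl [_ * _%:MP]mulrC mul_mpolyC scalerA.
Qed.
End Change.

Section ChangeF.
Variables (K : fieldType) (n p : nat) (P P' : 'M[K]_n) (Q Q' : 'M[K]_p).
Hypotheses (PP' : P *m P' = 1%:M) (P'P : P' *m P = 1%:M).
Hypotheses (QQ' : Q *m Q' = 1%:M) (Q'Q : Q' *m Q = 1%:M).
Variable F : 'I_p -> {mpoly K[n]}.

(** The map x -> F(x P) Q. *)
Definition lin_change j := \sum_l Q l j *: msub (linsub P) (F l).

Lemma eqv_change A B : eqv A B F -> eqv (P *m A *m P') (Q' *m B *m Q) lin_change.
Proof.
move=> e j; have lsum (I : Type) (r : seq I) (E : I -> {mpoly K[n]}) X :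
    lie X (\sum_(i <- r) E i) = \sum_(i <- r) lie X (E i).
  rewrite /lie exchange_big; apply: eq_bigr => i _ /=.
  by rewrite -mulr_sumr; congr (_ * _); rewrite (raddf_sum (mderiv i)).
have lZ c X f : lie X (c *: f) = c *: lie X f.
  by rewrite /lie scaler_sumr; apply: eq_bigr => i _; rewrite mderivZ scalerAr.
rewrite /lin_change lsum.
under eq_bigr => l _ do rewrite lZ lie_change // e msub_sum scaler_sumr.
rewrite exchange_big /=.
under [RHS]eq_bigr => l _ do rewrite scaler_sumr.
rewrite [RHS]exchange_big; apply: eq_bigr => k _ /=.
under eq_bigr => l _ do rewrite msubZ scalerA.
under [RHS]eq_bigr => l _ do rewrite scalerA.
rewrite -!scaler_suml; congr (_ *: _).
transitivity ((B *m Q) k j).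
  by rewrite mxE; apply: eq_bigr => l _; rewrite mulrC.
rewrite -[B *m Q]mul1mx -QQ' -!mulmxA [Q' *m (B *m Q)]mulmxA mxE.
by apply: eq_bigr => l _; rewrite mulrC.
Qed.

Lemma jet_equiv_change N : jet_equiv N lin_change F.
Proof.
have idP (A B : 'M[K]_n) i : A *m B = 1%:M -> msub (linsub A) (linsub B i) = 'X_i.
  by move=> AB; rewrite msub_lin_linX AB linsub1.
exists (linsub P'), (linsub P), (fun l j => (Q l j)%:MP), (fun j l => (Q' j l)%:MP).
have E j : msub (linsub P') (lin_change j) = \sum_l Q l j *: F l.
  rewrite /lin_change msub_sum; apply: eq_bigr => l _; rewrite msubZ msub_comp.
  by rewrite (eq_msub (h' := fun i => 'X_i)) ?msub_id // => i; rewrite /= idP.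
split.
- by move=> i; split; apply: ordge_linsub.
- by move=> i; rewrite idP // subrr; apply: ordge0.
- move=> j; rewrite E (eq_bigr (fun l => F l * (Q l j)%:MP)) ?subrr; first exact: ordge0.
  by move=> l _; rewrite mulrC mul_mpolyC.
- suff -> : const_matrix (fun l j => (Q l j)%:MP : {mpoly K[n]}) = Q by case/mulmx1_unit: QQ'.
  by apply/matrixP => l j; rewrite mxE mcoeffC eqxx mulr1.
- move=> l; rewrite (eq_bigr (fun j => \sum_k (Q k j * Q' j l) *: F k)); last first.
    move=> j _; rewrite E mulr_suml; apply: eq_bigr => k _.
    by rewrite mulrC mul_mpolyC scalerA mulrC.
  rewrite exchange_big (eq_bigr (fun k => (k == l)%:R *: F k)) /=; last first.
    move=> k _; rewrite -scaler_suml; congr (_ *: _).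
    by have /matrixP /(_ k l) := QQ'; rewrite !mxE.
  rewrite (bigD1 l) //= eqxx scale1r big1 ?addr0 ?subrr; first exact: ordge0.
  by move=> k /negPf ->; rewrite scale0r.
Qed.
End ChangeF.

Section MapTK.
Variables (K L : comNzRingType) (f : {rmorphism K -> L}) (n p : nat).

Lemma ordge_map d (P : {mpoly K[n]}) : ordge d P -> ordge d (map_mpoly f P).
Proof. by move=> h m lt; rewrite mcoeff_map_mpoly h // raddf0. Qed.

Lemma TK_map N (F : 'I_p -> {mpoly K[n]}) : TK N F -> TK N (fun j => map_mpoly f (F j)).
Proof.
move=> tk m j mN; have [xi [M h]] := tk m j mN.
exists (fun i => map_mpoly f (xi i)), (fun k l => map_mpoly f (M k l)) => l.
have := ordge_map (h l); rewrite !rmorphB /= (_ : map_mpoly f (_ *: _) = (l == j)%:R *: 'X_[m]); last first.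
  by rewrite map_mpolyZ /= rmorph_nat map_mpolyX.
rewrite !(raddf_sum (map_mpoly f)) /=.
congr (ordge _ (_ - _ - _)); apply: eq_bigr => k _; rewrite rmorphM //=.
by rewrite map_mpoly_deriv.
Qed.
End MapTK.

(** * Descent from complex to real coefficients *)

Section Real.
Variables (R : rcfType) (C : numClosedFieldType) (rc : {rmorphism R -> C}).
Hypotheses (realC : forall x, rc x \is Num.real) (realCE : forall a, a \is Num.real -> exists x, a = rc x).
Variables (n p N : nat) (F : 'I_p -> {mpoly R[n]}).
Hypotheses (tk : TK N F) (F2 : forall j, ordge 2 (F j)) (pn : (p < n)%N).
Hypothesis hp : (1 < p)%N \/ (0 < p)%N /\ forall j, ordge 3 (F j).

Let FC j := map_mpoly rc (F j).

Let tkC : TK N FC. Proof. exact: TK_map. Qed.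
Let F2C j : ordge 2 (FC j). Proof. exact: ordge_map. Qed.
Let hpC : (1 < p)%N \/ (0 < p)%N /\ forall j, ordge 3 (FC j).
Proof. by case: hp => [|[p0 h]]; [left|right; split=> // j; apply: ordge_map]. Qed.

Let F_realC j : map_mpoly conjC (FC j) = FC j.
Proof. by apply/mpolyP => m; rewrite !mcoeff_map_mpoly; apply: conj_Creal; apply: realC. Qed.

Let skewC m (A : 'M[R]_m) : A^T = - A -> rskew (map_mx rc A).
Proof.
move=> sA; split; first by apply/mxOverP => i j; rewrite mxE; apply: realC.
by apply/matrixP => i j; rewrite !mxE -rmorphN; congr (rc _); have /matrixP/(_ i j) := sA; rewrite !mxE.
Qed.

Lemma real_sym_dependent A B X Y : A^T = - A -> B^T = - B -> X^T = - X -> Y^T = - Y ->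
  eqv A B F -> eqv X Y F -> exists a b : R,
  [/\ a != 0 \/ b != 0, a *: A + b *: X = 0 & a *: B + b *: Y = 0].
Proof.
move=> sA sB sX sY eAB eXY.
have [a [b [ra rb ab e1 e2]]] := sym_dependent tkC F2C hpC F_realC pn
  (And3 (skewC sA) (skewC sB) (map_mpoly_eqv rc eAB)) (And3 (skewC sX) (skewC sY) (map_mpoly_eqv rc eXY)).
have [a' ea] : exists a', a = rc a' by apply: realCE.
have [b' eb] : exists b', b = rc b' by apply: realCE.
have E m (U W : 'M[R]_m) : a *: map_mx rc U + b *: map_mx rc W = 0 -> a' *: U + b' *: W = 0.
  rewrite ea eb -!map_mxZ -map_mxD => /eqP; rewrite map_mx_eq0 => /eqP //.
exists a', b'; split; [|exact: E e1|exact: E e2].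
by move: ab; rewrite ea eb !fmorph_eq0.
Qed.

Lemma real_sym_p1 A B : p = 1%N -> A^T = - A -> B^T = - B -> eqv A B F -> A = 0 /\ B = 0.
Proof.
move=> p1 sA sB e.
have [] := sym_p1 tkC F2C hpC pn p1 (And3 (skewC sA) (skewC sB) (map_mpoly_eqv rc e)).
by move=> /eqP + /eqP; rewrite !map_mx_eq0 => /eqP -> /eqP ->.
Qed.
End Real.

Section Invariant.
Variables (R : rcfType) (n p N : nat) (F : 'I_p -> {mpoly R[n]}).
Hypotheses (N3 : (3 <= N.+1)%N) (F2 : forall j, ordge 2 (F j)) (pn : (p < n)%N).
(** Asked for all equivalent jets, since it is applied to [F] rewritten in orthonormal bases. *)
Hypothesis tk : forall G : 'I_p -> {mpoly R[n]}, jet_equiv N G F -> TK N G.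
Hypothesis hp : (1 < p)%N \/ (0 < p)%N /\ forall j, ordge 3 (F j).
Variables (S : 'M[R]_n) (T : 'M[R]_p).
Hypotheses (pS : posdef S) (pT : posdef T).

(** Infinitesimal symmetries that are skew for the inner products [S] and [T]; orthonormal bases
    make both matrices skew. *)
Definition isym A B := [/\ A *m S + S *m A^T = 0, B *m T + T *m B^T = 0 & eqv A B F].

Lemma skew_conj m (U P A : 'M[R]_m) : U^T = U -> P \in unitmx -> P *m U *m P^T = 1%:M ->
  A *m U + U *m A^T = 0 -> (P *m A *m invmx P)^T = - (P *m A *m invmx P).
Proof.
move=> sU uP e h; have -> : invmx P = U *m P^T.
  by rewrite -[LHS]mulmx1 -e !mulmxA mulVmx // mul1mx.
apply/eqP; rewrite -addr_eq0 !trmx_mul trmxK sU addrC.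
have -> : P *m A *m (U *m P^T) + P *m U *m (A^T *m P^T) = P *m (A *m U + U *m A^T) *m P^T.
  by rewrite mulmxDr mulmxDl !mulmxA.
by rewrite h mulmx0 mul0mx.
Qed.

Let rc := real_complex R : {rmorphism R -> R[i]%C}.

Let realC x : rc x \is Num.real. Proof. by apply/complex_realP; exists x. Qed.

Let realCE a : a \is Num.real -> exists x, a = rc x. Proof. by move/complex_realP. Qed.

Let main : (forall A B X Y, isym A B -> isym X Y -> exists a b : R,
  [/\ a != 0 \/ b != 0, a *: A + b *: X = 0 & a *: B + b *: Y = 0]) /\
  (p = 1%N -> forall A B, isym A B -> A = 0 /\ B = 0).
Proof.
have [P uP eP] := posdef_gram pS; have [Q uQ eQ] := posdef_gram pT.
pose G := lin_change P (invmx Q) F.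
have VP := mulmxV uP; have PV := mulVmx uP; have VQ := mulmxV uQ; have QV := mulVmx uQ.
have je : jet_equiv N G F by apply: (jet_equiv_change VP PV QV).
have G2 : forall j, ordge 2 (G j) by apply: (jet_equiv_ordge _ je) => //; apply: leq_trans N3.
have hpG : (1 < p)%N \/ (0 < p)%N /\ forall j, ordge 3 (G j).
  by case: hp => [|[p0 F3]]; [left|right; split=> //; apply: (jet_equiv_ordge N3 je)].
have tG := tk je.
have conj A B : isym A B -> [/\ (P *m A *m invmx P)^T = - (P *m A *m invmx P),
    (Q *m B *m invmx Q)^T = - (Q *m B *m invmx Q) & eqv (P *m A *m invmx P) (Q *m B *m invmx Q) G].
  move=> [sA sB e]; split; first exact: skew_conj pS.1 uP eP sA.
    exact: skew_conj pT.1 uQ eQ sB.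
  exact: (eqv_change PV QV).
have inj m (U V A : 'M[R]_m) : V *m U = 1%:M -> U *m A *m V = 0 -> A = 0.
  move=> VU e; have UV := mulmx1C VU.
  by rewrite -[A]mul1mx -VU -[A]mulmx1 -VU !mulmxA -(mulmxA V U A) -(mulmxA V _ V) e mulmx0 mul0mx.
split=> [A B X Y /conj[sA sB e] /conj[sX sY e']|p1 A B /conj[sA sB e]].
  have [a [b [ab e1 e2]]] := real_sym_dependent realC realCE tG G2 pn hpG sA sB sX sY e e'.
  exists a, b; split=> //.
    by apply: (inj _ P (invmx P)) => //; rewrite mulmxDr mulmxDl -!scalemxAr -!scalemxAl.
  by apply: (inj _ Q (invmx Q)) => //; rewrite mulmxDr mulmxDl -!scalemxAr -!scalemxAl.
have [e1 e2] := real_sym_p1 realC tG G2 pn hpG p1 sA sB e.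
by split; [apply: (inj _ P (invmx P))|apply: (inj _ Q (invmx Q))].
Qed.

Definition isym_dependent := main.1.
Definition isym_p1 := main.2.
End Invariant.

Lemma ray_linsub n (K : comNzRingType) (c : 'M[K]_n) (v : 'rV[K]_n) P :
  ray v (msub (linsub c) P) = ray (v *m c) P.
Proof.
elim/mpoly_gen_ind: P => [a|i|P Q h1 h2|P Q h1 h2].
- by rewrite msubC /ray !mcurveC.
- rewrite msubX /linsub ray_sum rayX mxE scaler_suml; apply: eq_bigr => k _.
  by rewrite rayZ rayX scalerA mulrC.
- by rewrite [msub _ _]rmorphD !rayD h1 h2.
- by rewrite [msub _ _]rmorphM !rayM h1 h2.
Qed.

Lemma coef_ray_ordge n (K : comNzRingType) (v : 'rV[K]_n) d (P : {mpoly K[n]}) i :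
  ordge d P -> (i < d)%N -> (ray v P)`_i = 0.
Proof.
move=> oP lt; rewrite (mpolyE P) ray_sum coef_sum big_seq big1 // => m mP.
rewrite rayZ /ray mcurveXm; under eq_bigr do rewrite exprZn.
rewrite scaler_prod -expr_sum !coefZ coefXn -mdegE.
case: eqP => [e|_]; last by rewrite !mulr0.
by move: mP; rewrite mcoeff_msupp oP ?eqxx // -e.
Qed.

(** A linear substitution does not raise the degree, so a congruence modulo the degree bound of [F]
    is an equality; it is tested along rays. *)
Lemma linear_equivariant n p (K : numDomainType) N (F : 'I_p -> {mpoly K[n]}) (a : 'M[K]_n) (b : 'M[K]_p) :
  (forall j, (msize (F j) <= N)%N) ->
  (forall j, ordge N (msub (linsub a) (F j) - \sum_l b l j *: F l)) ->
  forall j, msub (linsub a) (F j) = \sum_l b l j *: F l.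
Proof.
move=> sF oD j; apply/eqP; rewrite -subr_eq0; apply/eqP/meval_eq0 => v.
set D := _ - _; pose x := \row_i v i.
have sx y G : (msize G <= N)%N -> (size (ray y G) <= N)%N by exact: size_ray.
have sD : (size (ray x D) <= N)%N.
  rewrite /D rayB ray_linsub; apply: leq_trans (size_polyD _ _) _.
  rewrite geq_max sx // size_polyN ray_sum; apply: leq_trans (size_sum _ _ _) _.
  by apply/bigmax_leqP => l _; rewrite rayZ; apply: (leq_trans (size_scale_leq _ _)); apply: sx.
have -> : D.@[v] = (ray x D).[1].
  by rewrite /ray horner_mcurve; apply: meval_eq => i; rewrite mxE hornerZ hornerX mulr1.
rewrite (_ : ray x D = 0) ?horner0 //; apply/polyP => i; rewrite coef0.
have [lt|ge] := ltnP i N; first exact: coef_ray_ordge (oD j) lt.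
by rewrite nth_default // (leq_trans sD).
Qed.

End JetAlgebra.
Import JetAlgebra.

From mathcomp Require Import all_classical all_reals all_analysis.
From mathcomp Require Import -(notations) mpoly.
From mathcomp Require Import complex.
Import numFieldNormedType.Exports.
Local Open Scope classical_set_scope.
Local Open Scope ring_scope.

(** * Algebraically independent reals *)

Section Generic.
Variable R : realType.

Definition enumerable (S : set R) := exists e : nat -> R, S `<=` range e.

Definition poly_values (S : set R) (a : R) : set R :=
  [set x | exists2 p : {poly R}, (forall i, S p`_i) & x = p.[a]].

Lemma real_not_enumerable (e : nat -> R) : exists a, ~ range e a.
Proof.
apply: contrapT => h.
have eT : range e = setT.
  by apply/seteqP; split=> // a _; apply: contrapT => na; apply: h; exists a.
have c0 : countable (range e) by apply: (sub_countable (card_image_le _ _)).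
have := countable_lebesgue_measure0 c0.
have h01 : (lebesgue_measure (`[0%R, 1%R]%classic : set R) <= lebesgue_measure (range e))%E.
  by apply: le_measure; rewrite ?inE ?eT //.
move=> e0; move: h01; rewrite e0 lebesgue_measure_itv /= lte01 sube0.
by rewrite leNgt lte01.
Qed.

Lemma poly_enum (S : set R) (e : nat -> R) : S `<=` range e ->
  forall p : {poly R}, (forall i, S p`_i) -> exists l, p = Poly (map e l).
Proof.
move=> Se p Sp; exists [seq xget 0%N [set k | e k = x] | x <- p : seq R].
rewrite -map_comp -[LHS]polyseqK; congr Poly; rewrite -[LHS]map_id; apply/eq_in_map => x.
move=> /(nthP 0)[i _ <-] /=; have [k _ ek] := Se _ (Sp i).
by have := @xgetPex _ 0%N [set k | e k = p`_i]; rewrite /=; move=> ->//; exists k.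
Qed.

Lemma enumerable_poly_values S a : enumerable S -> enumerable (poly_values S a).
Proof.
move=> [e Se]; exists (fun k => if unpickle k is Some l then (Poly (map e l)).[a] else 0).
move=> x [p Sp ->]; have [l ->] := poly_enum Se Sp.
by exists (pickle l) => //; rewrite pickleK.
Qed.

(** The real parts of the complex roots of nonzero polynomials over [S] lie in one sequence, and
    some real number is outside it. *)
Lemma exists_transcendental S : enumerable S ->
  exists a, forall p : {poly R}, (forall i, S p`_i) -> p.[a] = 0 -> p = 0.
Proof.
move=> [e Se].
pose C := (R[i] : numClosedFieldType).
pose rs (p : {poly R}) : seq C := sval (closed_field_poly_normal (map_poly (real_complex R) p)).
pose e' (k : nat) : R := if unpickle k is Some li then
   complex.Re ((rs (Poly (map e li.1)))`_(li.2)) else 0.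
have [a na] := real_not_enumerable e'.
exists a => p Sp pa; apply/eqP; apply: contraT => p0; exfalso; apply: na.
have [l el] := poly_enum Se Sp.
have ars : (a%:C)%C \in rs p.
  have : root (map_poly (real_complex R) p) (a%:C)%C.
    by rewrite /root horner_map pa rmorph0.
  rewrite /rs; case: closed_field_poly_normal => /= s {1}->.
  rewrite rootZ ?root_prod_XsubC // lead_coef_eq0 map_poly_eq0.
  exact: p0.
exists (pickle (l, index (a%:C)%C (rs p))) => //.
by rewrite /e' pickleK /= -el nth_index.
Qed.

(** The ring generated by [c] with the zero derivation, built from the integers by adjoining one
    element at a time. *)
Lemma constant_subring (c : seq R) : exists S, enumerable S /\ exists G : R -> R -> Prop,
  [/\ dual_subring G, forall a a', G a a' -> S a /\ a' = 0 & forall x, x \in c -> G x 0].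
Proof.
elim: c => [|x c [S [eS [G [dG GS Gc]]]]].
  exists (range (fun m : int => m%:~R)); split.
    exists (fun k => if unpickle k is Some m then (m : int)%:~R else 0) => _ [m _ <-].
    by exists (pickle m) => //; rewrite pickleK.
  exists (fun a a' => range (fun m : int => m%:~R) a /\ a' = 0); split => //.
  split; first by split => //; exists 1.
    move=> _ a' _ b' [[m _ <-] ->] [[k _ <-] ->]; rewrite subrr; split => //.
    by exists (m - k) => //; rewrite rmorphB.
  move=> _ a' _ b' [[m _ <-] ->] [[k _ <-] ->]; rewrite mul0r mulr0 addr0; split => //.
  by exists (m * k) => //; rewrite rmorphM.
exists (poly_values S x); split; first exact: enumerable_poly_values.
exists (adjoin G x 0); split.
- exact: adjoin_dual_subring.
- move=> _ _ [p [p1 [h -> ->]]]; split; first by exists p => // i; have [] := GS _ _ (h i).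
  have -> : p1 = 0 by apply/polyP => i; have [_ ->] := GS _ _ (h i); rewrite coef0.
  by rewrite horner0 mulr0 addr0.
move=> y; rewrite inE => /orP[/eqP ->|yc]; first exact: mem_adjoin.
by apply: sub_adjoin => //; apply: Gc.
Qed.

(** Each new [h i] is transcendental over the enumerable set [S] reached so far, so any value may be
    prescribed at it. [S] is fixed before [eta], because [h] must not depend on the values; only the
    graph [G] does. *)
Theorem generic_point (c : seq R) (s : nat) : exists h : nat -> R,
  forall eta : nat -> R, exists D : R -> R,
  [/\ derivation D, forall x, x \in c -> D x = 0 & forall i, (i < s)%N -> D (h i) = eta i].
Proof.
suff [h [S [_ H]]] : exists (h : nat -> R) S, enumerable S /\ forall eta : nat -> R, exists G,
   [/\ dual_subring G, functional G, forall a a', G a a' -> S a,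
      forall x, x \in c -> G x 0 & forall i, (i < s)%N -> G (h i) (eta i)].
  exists h => eta; have [G [dG fG _ Gc Gh]] := H eta.
  have [D dD hD] := derivation_extension dG fG; exists D; split => //.
    by move=> x /Gc /hD.
  by move=> i /Gh /hD.
elim: s => [|s [h [S [eS H]]]].
  have [S [eS [G [dG GS Gc]]]] := constant_subring c.
  exists (fun=> 0), S; split => // eta; exists G; split => //.
    by move=> b /GS[].
  by move=> a a' /GS[].
have [a ha] := exists_transcendental eS.
exists (fun i => if i == s then a else h i), (poly_values S a); split.
  exact: enumerable_poly_values.
move=> eta; have [G [dG fG GS Gc Gh]] := H eta.
exists (adjoin G a (eta s)); split.
- exact: adjoin_dual_subring.
- apply: adjoin_transcendental => // p p1 hp; apply: ha => i; exact: GS (hp i).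
- by move=> _ _ [p [p1 [hp -> _]]]; exists p => // i; apply: GS (hp i).
- by move=> x /Gc h'; apply: sub_adjoin.
move=> i; rewrite ltnS leq_eqVlt => /orP[/eqP ->|lt].
  by rewrite eqxx; apply: mem_adjoin.
by rewrite ltn_eqF //; apply: sub_adjoin => //; apply: Gh.
Qed.
End Generic.

(** * Taylor polynomials *)

Lemma near_ord (T : Type) (F : set_system T) {FF : Filter F} m (P : 'I_m -> T -> Prop) :
  (forall i, \forall x \near F, P i x) -> \forall x \near F, forall i, P i x.
Proof.
move=> h; have: \forall x \near F, forall i, i \in enum 'I_m -> P i x.
  elim: (enum 'I_m) => [|i s IH]; first by apply: nearW.
  near=> x => j; rewrite inE => /orP[/eqP ->|js]; last by move: j js; near: x.
  by near: x; apply: h.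
by apply: filterS => x hx i; apply: hx; rewrite mem_enum.
Unshelve. all: by end_near. Qed.

Section Antideriv.
Variables (K : numFieldType) (m : nat).

(* t |-> t P(t x) is the derivative of t |-> t (radial P)(t x) *)
Definition radial (P : mpoly m K) : mpoly m K :=
  \sum_(a <- msupp P) (mcoeff a P / (mdeg a).+1%:R) *: mpolyX K a.

Lemma deriv_radial (y : 'rV[K]_m) P : ('X * ray y (radial P))^`() = ray y P.
Proof.
have rX a : ray y (mpolyX K a) = (\prod_i y 0 i ^+ a i) *: 'X^(mdeg a).
  rewrite /ray mcurveXm; under eq_bigr do rewrite exprZn.
  by rewrite scaler_prod mdegE expr_sum.
rewrite {2}(mpolyE P) !ray_sum mulr_sumr raddf_sum /=; apply: eq_bigr => a _.
rewrite !rayZ rX -!scalerAr -exprS !derivZ derivXn /=.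
rewrite -(scaler_nat (mdeg a).+1 ('X^(mdeg a) : {poly K})) !scalerA; congr (_ *: _).
by field; rewrite addrC natr1 pnatr_eq0.
Qed.
End Antideriv.

Section Approx.
Variables (R : realType) (V : normedModType R) (m : nat).
Variables (e : 'I_m -> V) (l : 'I_m -> V -> R) (kap : R).
Hypotheses (el : forall x, x = \sum_i l i x *: e i) (l_scale : forall i t x, l i (t *: x) = t * l i x).
Hypotheses (kap0 : 0 <= kap) (l_bound : forall i x, `|l i x| <= kap * `|x|).

(** The condition f - P = o(|x|^N). In this form Taylor polynomials add, multiply and compose
    without reference to derivatives. *)
Definition approx N (f : V -> R) (P : mpoly m R) := forall eps, 0 < eps ->
  \forall x \near (0 : V), `|f x - meval (fun i => l i x) P| <= eps * `|x| ^+ N.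

Let row x : 'rV[R]_m := \row_i l i x.

Lemma meval_row x P t : meval (fun i => l i (t *: x)) P = (ray (row x) P).[t].
Proof.
rewrite /ray horner_mcurve; apply: meval_eq => i.
by rewrite hornerZ hornerX mxE l_scale mulrC.
Qed.

Section Taylor.
Variables (W : normedModType R) (f : V -> W) (lam : {linear W -> R}).
Hypotheses (fs : smooth_germ f) (lc : continuous lam).

Lemma lam_line_deriv (g : V -> W) x (t : R) : differentiable g (t *: x) ->
  is_derive t 1 (fun s : R => lam (g (s *: x))) (lam ('D_x g (t *: x))).
Proof.
move=> dg.
have d1 : differentiable (fun s : R => s *: x) t by [].
have dl : differentiable lam (g (t *: x)) by apply: linear_differentiable.
have dh : differentiable (g \o (fun s : R => s *: x)) t by apply: differentiable_comp.
have dk : differentiable (lam \o (g \o (fun s : R => s *: x))) t by apply: differentiable_comp.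
apply: DeriveDef; first exact: diff_derivable.
rewrite deriveE // (diff_comp dh dl) (diff_comp d1 dg) diff_lin //= deriveE //.
have cg u : u = x -> lam ('d g (t *: x) u) = lam ('d g (t *: x) x) by move=> ->.
apply: cg; have E : 'd (fun s : R => s *: x) t = (fun s : R => s *: x) :> (R -> V) by apply: diff_val.
by rewrite E scale1r.
Qed.

Lemma lam_derive_sum (g : V -> W) x y : differentiable g y ->
  lam ('D_x g y) = \sum_i l i x * lam ('D_(e i) g y).
Proof.
move=> dg; have lin z : 'd g y z = \sum_i l i z *: 'd g y (e i).
  by rewrite [in LHS](el z) linear_sum; apply: eq_bigr => i _; rewrite linearZ.
by rewrite deriveE // lin linear_sum; apply: eq_bigr => i _; rewrite linearZ /= deriveE.
Qed.

(** Induction on N for all iterated derivatives at once: the polynomials for the first derivatives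
    are integrated along rays by [radial], and the mean value theorem on the segment from 0 to x
    bounds the error. *)
Lemma taylor N vs : exists P, approx N (fun x => lam (iter_derive vs f x)) P.
Proof.
elim: N vs => [|N IH] vs; set g := iter_derive vs f.
  exists (mpolyC m (lam (g 0))) => eps eps0.
  have dg : differentiable g 0 by have := nbhs_singleton fs; apply.
  have cg : {for 0, continuous (lam \o g)}.
    by apply: continuous_comp; [exact: differentiable_continuous|exact: lc].
  move: cg => /cvgr_dist_le /(_ _ eps0); apply: filterS => x.
  by rewrite mevalC expr0 mulr1 distrC.
have [P hP] := @boolp.choice _ _ (fun i => approx N (fun x => lam ('D_(e i) g x)))
  (fun i => IH (e i :: vs)).
pose Q : mpoly m R := mpolyC m (lam (g 0)) + \sum_i mpolyX R (mnm1 i) * radial (P i).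
exists Q => eps eps0.
(* The final error is at most m terms kap |x| del |x|^N, and this choice keeps their sum below eps
   |x|^(N+1). *)
pose del := eps / (m.+1%:R * (kap + 1)).
have k1 : 0 < kap + 1 by rewrite ltr_wpDl.
have del0 : 0 < del by rewrite divr_gt0 ?mulr_gt0.
have /nbhs_norm0P[r /= r0 hr] : \forall x \near (0 : V), differentiable g x /\
   forall i, `|lam ('D_(e i) g x) - meval (fun j => l j x) (P i)| <= del * `|x| ^+ N.
  apply: filterI; first by apply: filterS fs => x; apply.
  by apply: near_ord => i; apply: hP.
apply/nbhs_norm0P; exists r => //= x xr.
pose h (t : R) := lam (g (t *: x)) - (ray (row x) Q).[t].
pose dh (t : R) := \sum_i l i x * (lam ('D_(e i) g (t *: x)) - (ray (row x) (P i)).[t]).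
have small (t : R) : 0 <= t <= 1 -> `|t *: x| <= `|x|.
  by move=> /andP[t0 t1]; rewrite normrZ ger0_norm // ler_piMl.
have Hder (t : R) : 0 <= t <= 1 -> is_derive t (1 : R) h (dh t).
  move=> t01; have [dg _] := hr _ (le_lt_trans (small _ t01) xr).
  have d1 := lam_line_deriv dg.
  have d2 := is_derive_poly (ray (row x) Q) t.
  apply: is_derive_eq.
  rewrite (lam_derive_sum _ dg) /dh; under [RHS]eq_bigr do rewrite mulrBr.
  rewrite sumrB; congr (_ - _); rewrite /Q rayD.
  have -> : ray (row x) (mpolyC m (lam (g 0))) = (lam (g 0))%:P by rewrite /ray mcurveC.
  rewrite derivD derivC add0r ray_sum raddf_sum /= horner_sum; apply: eq_bigr => i _.
  rewrite rayM rayX mxE -scalerAl derivZ deriv_radial.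
  by rewrite hornerZ.
have [||c c01] := @MVT_segment R h dh 0 1 ler01.
- move=> t; rewrite in_itv /= => /andP[t0 t1]; apply: Hder.
  by rewrite (ltW t0) (ltW t1).
- apply: derivable_within_continuous => t; rewrite in_itv /= => t01.
  by have := Hder _ t01 => -[].
rewrite subr0 mulr1 /h scale1r scale0r.
have -> : (ray (row x) Q).[0] = lam (g 0).
  rewrite -meval_row scale0r /Q mevalD mevalC (raddf_sum (meval _)) big1 ?addr0 // => i _ /=.
  rewrite mevalM mevalXU; have := l_scale i 0 0; rewrite scale0r mul0r => ->.
  by rewrite mul0r.
rewrite subrr subr0 -meval_row scale1r => ->.
move: c01; rewrite in_itv /= => c01; have [_ hP'] := hr _ (le_lt_trans (small _ c01) xr).
have xN : `|c *: x| ^+ N <= `|x| ^+ N by rewrite lerXn2r ?nnegrE ?small.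
apply: (@le_trans _ _ (\sum_(i < m) (kap * `|x| * (del * `|x| ^+ N)))).
  apply: le_trans (ler_norm_sum _ _ _) _; apply: ler_sum => i _.
  rewrite normrM; apply: ler_pM => //.
  rewrite -meval_row; apply: le_trans (hP' i) _.
  by apply: ler_wpM2l => //; apply: ltW.
rewrite sumr_const card_ord -mulr_natl.
have -> : m%:R * (kap * `|x| * (del * `|x| ^+ N)) = (m%:R * kap * del) * `|x| ^+ N.+1.
  by rewrite exprS; ring.
apply: ler_wpM2r; first by rewrite exprn_ge0.
rewrite /del mulrCA -[X in _ <= X]mulr1; apply: ler_wpM2l; first exact: ltW.
rewrite ler_pdivrMr ?mulr_gt0 // mul1r; apply: ler_pM => //.
  by rewrite ler_nat.
by rewrite lerDl.
Qed.
End Taylor.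
End Approx.

(** Letting t tend to 0 kills the constant term; dividing by t then lowers N by one. *)
Lemma horner_small (R : realType) (q : {poly R}) N : (size q <= N.+1)%N ->
  (forall eps, 0 < eps -> exists2 r, 0 < r & forall t, 0 < t < r -> `|q.[t]| <= eps * t ^+ N) ->
  q = 0.
Proof.
elim: N q => [|N IH] q sz h.
  have qE := size1_polyC sz; rewrite qE; congr (_%:P); apply/eqP; rewrite -normr_le0.
  apply/ler_addgt0Pl => eps e0; have [r r0 hr] := h _ e0.
  have := hr (r / 2); rewrite divr_gt0 // ltr_pdivrMr // ltr_pMr // ltr1n => /(_ isT).
  by rewrite qE hornerC coefC eqxx mulr1 addr0.
pose q' := \poly_(i < size q) q`_i.+1.
have q'E i : q'`_i = q`_i.+1.
  by rewrite coef_poly; case: ltnP => // le; rewrite nth_default // leqW.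
have qE : q = q' * 'X + (q`_0)%:P.
  by apply/polyP => -[|i]; rewrite coefD coefMX coefC /= ?add0r // addr0 q'E.
have qt t : q.[t] = q'.[t] * t + q`_0 by rewrite {1}qE hornerD hornerMX hornerC.
have sz' : (size q' <= N.+1)%N.
  by apply/leq_sizeP => i le; rewrite q'E nth_default // (leq_trans sz).
pose B := \sum_(i < size q') `|q'`_i|.
have B0 : 0 <= B by apply: sumr_ge0.
have hB t : 0 < t < 1 -> `|q'.[t]| <= B.
  move=> /andP[t0 t1]; rewrite horner_coef; apply: le_trans (ler_norm_sum _ _ _) _.
  apply: ler_sum => i _; rewrite normrM normrX (gtr0_norm t0).
  by apply: ler_piMr => //; apply: exprn_ile1 => //; apply: ltW.
have q0 : q`_0 = 0.
  apply/eqP; rewrite -normr_le0; apply/ler_addgt0Pl => eps e0.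
  have e2 : 0 < eps / 2 by rewrite divr_gt0.
  have [r r0 hr] := h _ e2.
  pose s := Num.min (Num.min 1 r) (eps / 2 / (B + 1)).
  have s0 : 0 < s by rewrite !lt_min ltr01 r0 /= divr_gt0 // ltr_wpDl.
  pose u := s / 2; have t0 : 0 < u by rewrite divr_gt0.
  have ts : u < s by rewrite ltr_pdivrMr // ltr_pMr // ltr1n.
  have /and3P[t1 tr tB] : [&& u < 1, u < r & u < eps / 2 / (B + 1)].
    by move: ts; rewrite /s !lt_min -andbA.
  have -> : q`_0 = q.[u] - q'.[u] * u by rewrite qt addrC addKr.
  rewrite addr0 (splitr eps); apply: le_trans (ler_normB _ _) (lerD _ _).
    have := hr u; rewrite t0 tr => /(_ isT) /le_trans; apply.
    by rewrite ler_piMr ?exprn_ile1 // ltW.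
  rewrite normrM (gtr0_norm t0); apply: (@le_trans _ _ ((B + 1) * (eps / 2 / (B + 1)))).
    apply: ler_pM => //; rewrite ?ltW //; apply: le_lt_trans (hB u _) _; last by rewrite ltrDl.
    by rewrite t0 t1.
  by rewrite mulrC divfK // gt_eqF // ltr_wpDl.
suff q'0 : q' = 0 by rewrite qE q'0 q0 mul0r addr0.
apply: IH => // eps e0; have [r r0 hr] := h _ e0; exists r => // t /andP[t0 tr].
have := hr t; rewrite t0 tr qt q0 addr0 => /(_ isT).
by rewrite normrM (gtr0_norm t0) exprSr mulrA ler_pM2r.
Qed.

(** A basis with dual coordinates and a bound on them, so that row vectors and pairs of row vectors
    are treated alike. *)
Definition coordinates (R : realType) (V : normedModType R) m (e : 'I_m -> V) (l : 'I_m -> V -> R) :=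
  [/\ forall x, x = \sum_i l i x *: e i,
      forall (v : 'I_m -> R) i, l i (\sum_j v j *: e j) = v i &
      exists2 k : R, 0 <= k & forall i x, `|l i x| <= k * `|x|].

(** * Calculus of approximating polynomials *)

Section Coordinates.
Variables (R : realType) (V : normedModType R) (m : nat) (e : 'I_m -> V) (l : 'I_m -> V -> R).
Hypothesis cl : coordinates e l.

Lemma coordinates_linear i : linear (l i).
Proof.
case: cl => el le _ a x y.
rewrite {1}(el x) {1}(el y) scaler_sumr -big_split /=.
rewrite (eq_bigr (fun j => (a * l j x + l j y) *: e j)); first by rewrite le.
by move=> j _; rewrite scalerDl scalerA.
Qed.

Lemma coordinatesZ i t x : l i (t *: x) = t * l i x.
Proof.
have l0 : l i 0 = 0.
  have := coordinates_linear i 1 0 0; rewrite scaler0 addr0 scale1r => /eqP.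
  by rewrite -subr_eq0 opprD addrA subrr sub0r oppr_eq0 => /eqP.
by have := coordinates_linear i t x 0; rewrite addr0 l0 addr0.
Qed.

Lemma coordinates0 i : l i 0 = 0.
Proof. by rewrite -(scale0r (0 : V)) coordinatesZ mul0r. Qed.

Lemma approxC N c : approx l N (fun=> c) (mpolyC m c).
Proof. by move=> eps e0; apply: nearW => x; rewrite mevalC subrr normr0 mulr_ge0 // ltW. Qed.

Lemma approxX N i : approx l N (l i) (mpolyX R (mnm1 i)).
Proof. by move=> eps e0; apply: nearW => x; rewrite mevalXU subrr normr0 mulr_ge0 // ltW. Qed.

Lemma approxD N f g P Q : approx l N f P -> approx l N g Q ->
  approx l N (fun x => f x + g x) (P + Q).
Proof.
move=> hf hg eps e0; have e2 : 0 < eps / 2 by rewrite divr_gt0.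
near=> x; rewrite mevalD opprD addrACA [in X in _ <= X](splitr eps) mulrDl.
apply: le_trans (ler_normD _ _) (lerD _ _).
  by near: x; apply: hf.
by near: x; apply: hg.
Unshelve. all: by end_near. Qed.

Lemma approxZ N c f P : approx l N f P -> approx l N (fun x => c * f x) (c *: P).
Proof.
move=> hf eps e0; have d0 : 0 < eps / (`|c| + 1) by rewrite divr_gt0 // ltr_wpDl.
apply: filterS (hf _ d0) => x hx; rewrite mevalZ -mulrBr normrM.
apply: le_trans (ler_wpM2l (normr_ge0 c) hx) _.
rewrite mulrA; apply: ler_wpM2r; first by rewrite exprn_ge0.
rewrite mulrCA ler_piMr // ?ltW // ltr_pdivrMr ?ltr_wpDl // mul1r ltrDl //.
Qed.

Lemma approxB N f g P Q : approx l N f P -> approx l N g Q ->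
  approx l N (fun x => f x - g x) (P - Q).
Proof.
move=> hf hg; have := approxD hf (approxZ (-1) hg); rewrite scaleN1r.
by congr (approx l N _ _); apply: funext => x; rewrite mulN1r.
Qed.

Lemma approx_eq N f g P : (\forall x \near 0, f x = g x) -> approx l N f P -> approx l N g P.
Proof. by move=> fg hf eps e0; apply: filterS2 fg (hf _ e0) => x ->. Qed.

Lemma meval_bound d (P : mpoly m R) : ordge d P ->
  exists2 C : R, 0 <= C & forall x : V, `|x| <= 1 -> `|meval (fun i => l i x) P| <= C * `|x| ^+ d.
Proof.
case: cl => _ _ [k k0 lk] hP.
exists (\sum_(a <- msupp P) `|mcoeff a P| * k ^+ mdeg a).
  by apply: sumr_ge0 => a _; rewrite mulr_ge0 ?exprn_ge0.
move=> x x1; rewrite {1}(mpolyE P) (raddf_sum (meval _)) /= mulr_suml.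
apply: le_trans (ler_norm_sum _ _ _) _; rewrite big_seq [leRHS]big_seq.
apply: ler_sum => a aP; rewrite mevalZ normrM -mulrA; apply: ler_wpM2l => //.
rewrite mevalX normr_prod mdegE.
apply: (@le_trans _ _ (\prod_i (k * `|x|) ^+ a i)).
  apply: ler_prod => i _; rewrite normr_ge0 normrX /=.
  by apply: lerXn2r; rewrite ?nnegrE ?mulr_ge0.
rewrite -expr_sum exprMn; apply: ler_wpM2l; first by rewrite exprn_ge0.
apply: ler_wiXn2l => //; rewrite -mdegE leqNgt; apply/negP => /hP /eqP.
by rewrite mcoeff_eq0 aP.
Qed.

Lemma approx_ordge N P : ordge N.+1 P -> approx l N (fun=> 0) P.
Proof.
move=> hP eps e0; have [C C0 hC] := meval_bound hP.
have d0 : 0 < eps / (C + 1) by rewrite divr_gt0 // ltr_wpDl.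
have : \forall x \near (0 : V), `|x| < Num.min 1 (eps / (C + 1)).
  by apply/nbhs_norm0P; exists (Num.min 1 (eps / (C + 1))) => //=; rewrite lt_min ltr01.
apply: filterS => x; rewrite lt_min => /andP[x1 x2].
rewrite sub0r normrN; apply: le_trans (hC _ (ltW x1)) _.
rewrite exprS mulrA; apply: ler_wpM2r; first by rewrite exprn_ge0.
apply: (@le_trans _ _ ((C + 1) * (eps / (C + 1)))); last first.
  by rewrite mulrC divfK // gt_eqF // ltr_wpDl.
by apply: ler_pM => //; rewrite ?lerDl ?ltW.
Qed.

Lemma approx_congr N f P Q : approx l N f P -> ordge N.+1 (P - Q) -> approx l N f Q.
Proof.
move=> hf /approx_ordge h; have := approxB hf h.
by rewrite subKr; apply: approx_eq; apply: nearW => x; rewrite subr0.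
Qed.

Lemma approx_bounded N f P : approx l N f P ->
  exists2 C : R, 0 <= C & \forall x \near 0, `|f x| <= C.
Proof.
move=> hf; have [C C0 hC] := meval_bound (ordge0n P).
exists (C + 1); first by rewrite addr_ge0.
have : \forall x \near (0 : V), `|x| < 1 by apply/nbhs_norm0P; exists 1 => //=.
apply: filterS2 (hf 1 ltr01) => x hx x1.
rewrite -(subrK (meval (fun i => l i x) P) (f x)) addrC.
apply: le_trans (ler_normD _ _) (lerD _ _).
  by have := hC _ (ltW x1); rewrite expr0 mulr1.
by apply: le_trans hx _; rewrite mul1r exprn_ile1 // ltW.
Qed.

Lemma approxM N f g P Q : approx l N f P -> approx l N g Q ->
  approx l N (fun x => f x * g x) (P * Q).
Proof.
move=> hf hg; have [C C0 hC] := approx_bounded hf.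
have hQ : approx l N (fun x => meval (fun i => l i x) Q) Q.
  by move=> eps e0; apply: nearW => x; rewrite subrr normr0 mulr_ge0 // ltW.
have [D D0 hD] := approx_bounded hQ.
move=> eps e0; have K0 : 0 < C + D + 1 by rewrite ltr_wpDl ?addr_ge0.
have d0 : 0 < eps / (C + D + 1) by rewrite divr_gt0.
near=> x; rewrite mevalM.
have E (a b u v : R) : a * b - u * v = a * (b - v) + v * (a - u) by ring.
rewrite E.
apply: (@le_trans _ _ (C * (eps / (C + D + 1) * `|x| ^+ N) + D * (eps / (C + D + 1) * `|x| ^+ N))).
  apply: le_trans (ler_normD _ _) (lerD _ _); rewrite normrM; apply: ler_pM => //.
  - by near: x.
  - by near: x; apply: hg.
  - by near: x.
  - by near: x; apply: hf.
rewrite -mulrDl mulrA; apply: ler_wpM2r; first by rewrite exprn_ge0.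
rewrite mulrCA ler_piMr // ?ltW // ltr_pdivrMr // mul1r ltrDl //.
Unshelve. all: by end_near. Qed.

Lemma approx_meval N r (f : 'I_r -> V -> R) (Q : 'I_r -> mpoly m R) (P : mpoly r R) :
  (forall i, approx l N (f i) (Q i)) ->
  approx l N (fun x => meval (fun i => f i x) P) (msub Q P).
Proof.
move=> h; elim/mpoly_gen_ind: P => [c|i|P1 P2 h1 h2|P1 P2 h1 h2].
- rewrite msubC; apply: approx_eq (approxC _ c); apply: nearW => x.
  by rewrite mevalC.
- rewrite msubX; apply: approx_eq (h i); apply: nearW => x.
  by rewrite mevalXU.
- rewrite rmorphD /=; apply: approx_eq (approxD h1 h2); apply: nearW => x.
  by rewrite mevalD.
- rewrite rmorphM /=; apply: approx_eq (approxM h1 h2); apply: nearW => x.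
  by rewrite mevalM.
Qed.

Lemma approx0_ordge1 N f P : approx l N f P -> f 0 = 0 -> ordge 1 P.
Proof.
move=> h f0; apply/ordge1E; apply/eqP; rewrite -normr_le0; apply/ler_addgt0Pl => eps e0.
have := nbhs_singleton (h _ e0); rewrite f0 sub0r normrN addr0 normr0.
have -> : meval (fun i => l i 0) P = meval (fun=> 0) P by apply: meval_eq => i; apply: coordinates0.
rewrite -mcoeff0E => /le_trans; apply.
by rewrite expr0n; case: eqP => _; rewrite ?mulr1 ?mulr0 // ltW.
Qed.

(** Smallness on each ray separately, with no uniformity in the direction, suffices: a polynomial is
    determined by its restrictions to rays, and [horner_small] applies to each. *)
Lemma approx_line N f P :
  (forall x eps, 0 < eps -> exists2 r, 0 < r & forall t, 0 < t < r -> `|f (t *: x)| <= eps * t ^+ N) ->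
  approx l N f P -> ordge N.+1 P.
Proof.
move=> small hP; pose D := mtrunc N.+1 P.
have hD : approx l N f D by apply: (approx_congr hP); apply: ordge_trunc.
suff D0 : D = 0 by rewrite -[P]subr0 -D0; apply: ordge_trunc.
case: cl => _ le _; apply: meval_eq0 => v.
pose x := \sum_j v j *: e j.
have -> : meval v D = (ray (\row_i v i) D).[1].
  by rewrite /ray horner_mcurve; apply: meval_eq => i; rewrite mxE hornerZ hornerX mulr1.
rewrite (@horner_small _ (ray (\row_i v i) D) N) ?horner0 //.
  exact: size_ray (msize_trunc _ _).
move=> eps e0; have e2 : 0 < eps / 2 by rewrite divr_gt0.
have d0 : 0 < eps / 2 / (`|x| ^+ N + 1) by rewrite divr_gt0 // ltr_wpDl // exprn_ge0.
have /nbhs_norm0P[r /= r0 hr] := hD _ d0.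
have [r' r'0 hr'] := small x _ e2.
exists (Num.min r' (r / (`|x| + 1))) => [|t /andP[t0]].
  by rewrite lt_min r'0 divr_gt0 // ltr_wpDl.
rewrite lt_min => /andP[tr' tr].
have xr : `|t *: x| < r.
  rewrite normrZ gtr0_norm //; apply: (@le_lt_trans _ _ (t * (`|x| + 1))).
    by rewrite ler_pM2l // lerDl.
  by rewrite -ltr_pdivlMr // ltr_wpDl.
have -> : (ray (\row_i v i) D).[t] = meval (fun i => l i (t *: x)) D.
  rewrite /ray horner_mcurve; apply: meval_eq => i.
  by rewrite mxE hornerZ hornerX coordinatesZ le mulrC.
rewrite -[meval _ D](subKr (f (t *: x))) [eps in leRHS]splitr mulrDl.
apply: le_trans (ler_normB _ _) (lerD _ _); first by apply: hr'; rewrite t0.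
apply: le_trans (hr _ xr) _.
rewrite normrZ gtr0_norm // exprMn mulrCA mulrC; apply: ler_wpM2r; first by rewrite exprn_ge0 ?ltW.
rewrite mulrAC ler_pdivrMr ?ltr_wpDl ?exprn_ge0 //; apply: ler_wpM2l; first exact: ltW.
by rewrite lerDl.
Qed.

Lemma approx_uniq N f P Q : approx l N f P -> approx l N f Q -> ordge N.+1 (P - Q).
Proof.
move=> hP hQ; apply: (@approx_line _ (fun=> 0)).
  move=> x eps e0; exists 1 => // t /andP[t0 _].
  by rewrite normr0 mulr_ge0 ?exprn_ge0 // ltW.
by apply: approx_eq (approxB hP hQ); apply: nearW => x; rewrite subrr.
Qed.

Lemma approxW M N f P : (M <= N)%N -> approx l N f P -> approx l M f P.
Proof.
move=> MN hP eps e0.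
have : \forall x \near (0 : V), `|x| < 1 by apply/nbhs_norm0P; exists 1 => //=.
apply: filterS2 (hP _ e0) => x hx x1; apply: le_trans hx _.
by apply: ler_wpM2l; [exact: ltW|apply: ler_wiXn2l => //; apply: ltW].
Qed.

Lemma approx_linear_bound N f P : (0 < N)%N -> f 0 = 0 -> approx l N f P ->
  exists2 C : R, 0 <= C & \forall x \near 0, `|f x| <= C * `|x|.
Proof.
move=> N0 f0 hf; have [C C0 hC] := meval_bound (approx0_ordge1 hf f0).
exists (C + 1); first by rewrite addr_ge0.
have : \forall x \near (0 : V), `|x| < 1 by apply/nbhs_norm0P; exists 1 => //=.
apply: filterS2 (hf 1 ltr01) => x hx x1.
rewrite -(subrK (meval (fun i => l i x) P) (f x)) addrC mulrDl.
apply: le_trans (ler_normD _ _) (lerD _ _).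
  by have := hC _ (ltW x1); rewrite expr1.
by apply: le_trans hx _; rewrite !mul1r -[leRHS]expr1 ler_wiXn2l // ltW.
Qed.
End Coordinates.

Section Compose.
Variables (R : realType) (V W : normedModType R) (m r : nat).
Variables (e : 'I_m -> V) (l : 'I_m -> V -> R) (e' : 'I_r -> W) (l' : 'I_r -> W -> R).
Hypotheses (cl : coordinates e l) (cl' : coordinates e' l').

(** For N > 0 there is a bound |G x| <= C |x| near 0, which turns the error of F at G x into
    o(|x|^N). *)
Lemma approx_comp N (F : W -> R) (G : V -> W) P (Q : 'I_r -> mpoly m R) :
  (0 < N)%N -> G 0 = 0 -> (forall i, approx l N (fun x => l' i (G x)) (Q i)) ->
  approx l' N F P -> approx l N (F \o G) (msub Q P).
Proof.
move=> N0 G0 hG hF.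
have [C C0 hC] : exists2 C : R, 0 <= C & \forall x \near 0, `|G x| <= C * `|x|.
  have h i : exists C : R, 0 <= C /\ \forall x \near 0, `|l' i (G x)| <= C * `|x|.
    have l0 : l' i (G 0) = 0 by rewrite G0 (coordinates0 cl').
    by have [C C0 hC] := approx_linear_bound cl N0 l0 (hG i); exists C.
  have [C hC] := boolp.choice h.
  exists (\sum_i C i * `|e' i|).
    by apply: sumr_ge0 => i _; rewrite mulr_ge0 //; case: (hC i).
  have : \forall x \near (0 : V), forall i, `|l' i (G x)| <= C i * `|x|.
    by apply: near_ord => i; case: (hC i).
  apply: filterS => x hx; case: cl' => el _ _; rewrite {1}(el (G x)) mulr_suml.
  apply: le_trans (ler_norm_sum _ _ _) _; apply: ler_sum => i _.
  by rewrite normrZ mulrAC; apply: ler_wpM2r.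
have G_cvg : G x @[x --> (0 : V)] --> (0 : W).
  apply/cvgr0Pnorm_le => eps e0.
  have d0 : 0 < eps / (C + 1) by rewrite divr_gt0 // ltr_wpDl.
  have : \forall x \near (0 : V), `|x| <= eps / (C + 1).
    by apply/nbhs_norm0P; exists (eps / (C + 1)) => //= x /ltW.
  apply: filterS2 hC => x /le_trans hx xd; apply: hx.
  apply: (@le_trans _ _ ((C + 1) * (eps / (C + 1)))).
    by apply: ler_pM => //; rewrite lerDl.
  by rewrite mulrC divfK // gt_eqF // ltr_wpDl.
suff h : approx l N (fun x => F (G x) - meval (fun i => l' i (G x)) P) 0.
  have := approxD h (approx_meval cl P hG).
  by rewrite add0r; apply: approx_eq; apply: nearW => x; rewrite subrK.
move=> eps e0; have d0 : 0 < eps / (C ^+ N + 1) by rewrite divr_gt0 // ltr_wpDl // exprn_ge0.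
near=> x; rewrite meval0 subr0.
apply: (@le_trans _ _ (eps / (C ^+ N + 1) * `|G x| ^+ N)).
  by near: x; apply: (G_cvg _ (hF _ d0)).
apply: (@le_trans _ _ (eps / (C ^+ N + 1) * (C * `|x|) ^+ N)).
  apply: ler_wpM2l; first exact: ltW.
  by apply: lerXn2r; rewrite ?nnegrE ?mulr_ge0 //; near: x.
rewrite exprMn mulrA; apply: ler_wpM2r; first by rewrite exprn_ge0.
rewrite mulrAC ler_pdivrMr ?ltr_wpDl ?exprn_ge0 //; apply: ler_wpM2l; first exact: ltW.
by rewrite lerDl.
Unshelve. all: by end_near. Qed.

Lemma taylor_coordinates N (F : V -> W) i : smooth_germ F ->
  exists P, approx l N (fun x => l' i (F x)) P.
Proof.
move=> Fs; case: (cl) => el le [k k0 lk].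
have lin' := coordinates_linear cl' i.
pose lam : {linear W -> R} := HB.pack (l' i) (GRing.isLinear.Build _ _ _ _ (l' i) lin').
have lc : continuous lam.
  apply/linear_bounded_continuous/linear_boundedP; case: cl' => _ _ [k' k'0 lk'].
  exists k'; split; first exact: ger0_real.
  by move=> M kM x; apply: le_trans (lk' i x) _; apply: ler_wpM2r => //; apply: ltW.
exact: (taylor el (coordinatesZ cl) k0 lk Fs lc N [::]).
Qed.
End Compose.

(** * Contact equivalence of germs *)

Section Germs.
Variable R : realType.

Lemma near_comp (V W : normedModType R) (G : V -> W) (P : W -> Prop) :
  {for 0, continuous G} -> G 0 = 0 -> (\forall y \near 0, P y) -> \forall x \near 0, P (G x).
Proof. by move=> cG G0 hP; apply: cG; rewrite G0. Qed.

Lemma smooth_germ_continuous (V W : normedModType R) (G : V -> W) :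
  smooth_germ G -> {for 0, continuous G}.
Proof. by move=> /nbhs_singleton /(_ [::]) /differentiable_continuous. Qed.

Lemma pair_continuous0 (U V W : normedModType R) (g : U -> V) (h : U -> W) :
  {for 0, continuous g} -> {for 0, continuous h} -> {for 0, continuous (fun x => (g x, h x))}.
Proof.
move=> gc hc.
have e := @cvg_pair U V W (nbhs 0) (nbhs (g 0)) (nbhs (h 0)) _ _ _ g h gc hc.
exact: (e (nbhs_filter _) (nbhs_filter _) (nbhs_filter _)).
Qed.

Definition rvc n (i : 'I_n) (x : 'rV[R]_n) : R := x 0 i.

Definition prc n p (k : 'I_(n + p)) (z : 'rV[R]_n * 'rV[R]_p) : R :=
  pair_sub (fun i => rvc i z.1) (fun j => rvc j z.2) k.

Lemma rv_coordinates n : coordinates (fun i => delta_mx 0 i : 'rV[R]_n) (@rvc n).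
Proof.
split=> [x|v i|]; first by rewrite {1}[x]row_sum_delta.
  rewrite /rvc summxE (bigD1 i) //= big1 => [|j ji].
    by rewrite !mxE !eqxx mulr1 addr0.
  by rewrite !mxE eqxx eq_sym (negPf ji) mulr0.
exists 1 => // i x; rewrite mul1r /rvc /Num.Def.normr /= mx_normrE.
exact: (@le_bigmax _ _ _ 0 (fun k : 'I_1 * 'I_n => `|x k.1 k.2|) (0, i)).
Qed.

Lemma pr_coordinates n p : coordinates
  (pair_sub (fun i => (delta_mx 0 i, 0)) (fun j => (0, delta_mx 0 j)) : 'I_(n + p) -> 'rV[R]_n * 'rV[R]_p)
  (@prc n p).
Proof.
have [e1 l1 [k1 k10 b1]] := rv_coordinates n; have [e2 l2 [k2 k20 b2]] := rv_coordinates p.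
have Z a b c : (a *: (b, c) : 'rV[R]_n * 'rV[R]_p) = (a *: b, a *: c) by [].
have S I (r : seq I) (F : I -> 'rV[R]_n * 'rV[R]_p) :
    \sum_(i <- r) F i = (\sum_(i <- r) (F i).1, \sum_(i <- r) (F i).2).
  by elim: r => [|i r IH]; rewrite ?big_nil // !big_cons IH.
have D (v : 'I_(n + p) -> R) :
    \sum_k v k *: pair_sub (fun i => (delta_mx 0 i, 0)) (fun j => (0, delta_mx 0 j)) k
    = (\sum_i v (lshift p i) *: delta_mx 0 i, \sum_j v (rshift n j) *: delta_mx 0 j)
    :> 'rV[R]_n * 'rV[R]_p.
  rewrite big_split_ord /= !S /=; congr (_, _).
    by rewrite [X in _ + X]big1 ?addr0 => [|j _]; rewrite ?pair_subr ?scaler0 //; apply: eq_bigr => i _; rewrite pair_subl.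
  by rewrite [X in X + _]big1 ?add0r => [|j _]; rewrite ?pair_subl ?scaler0 //; apply: eq_bigr => i _; rewrite pair_subr.
split=> [[x y]|v k|].
- rewrite D {1}(e1 x) {1}(e2 y).
  by congr (_, _); apply: eq_bigr => i _; rewrite /prc ?pair_subl ?pair_subr.
- rewrite D /prc; case: (split_ordP k) => i ->; rewrite ?pair_subl ?pair_subr /=.
    by rewrite l1.
  by rewrite l2.
- exists (k1 + k2); first by rewrite addr_ge0.
  move=> k z; rewrite /prc prod_normE; case: (split_ordP k) => i ->; rewrite ?pair_subl ?pair_subr.
    apply: le_trans (b1 _ _) _; apply: ler_pM => //; rewrite ?lerDl //.
    by rewrite le_max lexx.
  apply: le_trans (b2 _ _) _; apply: ler_pM => //; rewrite ?lerDr //.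
  by rewrite le_max lexx orbT.
Qed.

Section Contact.
Variables (n p : nat).
Notation V := 'rV[R]_n.
Notation VW := ('rV[R]_n * 'rV[R]_p)%type.

(** [contact_group] states the vanishing on y = 0 for [H] alone. For the inverse it follows from
    H'(h x, 0) = (x, 0) by substituting the inverse of the source germ h. *)
Lemma contact_inverse_base (H H' : VW -> VW) : contact_group H -> smooth_germ0 H' ->
  inverse_germs H H' -> \forall x \near (0 : V), (H' (x, 0)).2 = 0.
Proof.
move=> [[Hs _] [[hs h0] [h' [h's h'0] [h'h hh']]] H1 H2] [H's H'0] [HH' _].
have c0 : {for 0, continuous (fun x : V => (x, 0) : VW)}.
  exact: (@pair_continuous0 _ _ _ id (fun=> 0) (@cvg_id _ _) (@cst_continuous _ _ _ _)).
have a : \forall x \near (0 : V), H' (source_germ H x, 0) = (x, 0).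
  have := near_comp c0 erefl HH'; apply: filterS2 H2 => x e2 /= <-.
  by congr (H' _); rewrite [RHS]surjective_pairing e2.
have := near_comp (smooth_germ_continuous h's) h'0 a.
by apply: filterS2 hh' => x /= -> ->.
Qed.

(** Each hypothesis of [jet_equiv_of_graph] is an identity of germs read on Taylor polynomials
    through [approx_uniq]. *)
Lemma jet_equiv_of_contact N (f g : V -> 'rV[R]_p) H (F G : 'I_p -> mpoly n R) :
  (0 < N)%N -> contact_group H -> contact_act H f g -> f 0 = 0 -> g 0 = 0 ->
  (forall j, approx (@rvc n) N (fun x => rvc j (f x)) (F j)) ->
  (forall j, approx (@rvc n) N (fun x => rvc j (g x)) (G j)) ->
  {for 0, continuous g} ->
  jet_equiv N F G.
Proof.
move=> N0 HK Hact f0 g0 hF hG gc.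
have [[[Hs H0] [H' [H's H'0] Hinv]] [[hs h0] [h' [h's h'0] [h'h hh']]] H1 H2] := HK.
have H'2 := contact_inverse_base HK (conj H's H'0) Hinv.
pose h := source_germ H.
have rvco := rv_coordinates n; have rvpo := rv_coordinates p; have prco := pr_coordinates n p.
have [Phi hPhi] := boolp.choice (fun i => taylor_coordinates rvco rvco N i hs).
have [Psi hPsi] := boolp.choice (fun i => taylor_coordinates rvco rvco N i h's).
have [S hS] := boolp.choice (fun i => taylor_coordinates prco prco N i Hs).
have [S' hS'] := boolp.choice (fun i => taylor_coordinates prco prco N i H's).
have l0 i : rvc i (0 : V) = 0 by rewrite /rvc mxE.
have lp0 i : rvc i (0 : 'rV[R]_p) = 0 by rewrite /rvc mxE.
have prc0 i : prc i (0 : VW) = 0 by rewrite (coordinates0 prco).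
have pair_approx (a : V -> V) (b : V -> 'rV[R]_p) A B :
    (forall i, approx (@rvc n) N (fun x => rvc i (a x)) (A i)) ->
    (forall i, approx (@rvc n) N (fun x => rvc i (b x)) (B i)) ->
    forall k, approx (@rvc n) N (fun x => prc k (a x, b x)) (pair_sub A B k).
  move=> ha hb k; case: (split_ordP k) => i ->; rewrite ?pair_subl ?pair_subr.
    rewrite [X in approx _ _ X](_ : _ = fun x => rvc i (a x)) //; apply: funext => x.
    by rewrite /prc pair_subl.
  rewrite [X in approx _ _ X](_ : _ = fun x => rvc i (b x)) //; apply: funext => x.
  by rewrite /prc pair_subr.
have zero_approx j : approx (@rvc n) N (fun x : V => rvc j ((fun=> 0 : 'rV[R]_p) x)) 0.
  rewrite [X in approx _ _ X](_ : _ = fun=> 0); first exact: (approx_ordge rvco (@ordge0 _ _ _)).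
  by apply: funext => x; rewrite lp0.
have base_approx (Q : VW -> VW) (P : 'I_(n + p) -> mpoly (n + p) R) j :
    (forall i, approx (@prc n p) N (fun z => prc i (Q z)) (P i)) ->
    (\forall x \near (0 : V), (Q (x, 0)).2 = 0) ->
    ordge N.+1 (msub (pair_sub (fun i => mpolyX R (mnm1 i)) (fun=> 0)) (P (rshift n j))).
  move=> hP hQ; rewrite -[msub _ _]subr0; apply: (approx_uniq rvco) (zero_approx j).
  have := approx_comp rvco prco N0 _ (pair_approx id (fun=> 0) _ _ (@approxX _ _ _ (@rvc n) N) zero_approx) (hP (rshift n j)).
  move=> /(_ erefl); apply: approx_eq; apply: filterS hQ => x e /=.
  by rewrite /prc pair_subr e.
apply: (@jet_equiv_of_graph _ _ _ _ Phi Psi F G (fun i => S (lshift p i)) (fun j => S (rshift n j))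
  (fun j => S' (rshift n j))) => //.
- move=> i; split.
  + by apply: (approx0_ordge1 rvco (hPhi i)); rewrite h0.
  + by apply: (approx0_ordge1 rvco (hPsi i)); rewrite h'0.
  + by apply: (approx0_ordge1 prco (hS _)); rewrite H0.
- move=> i; split.
  + by apply: (approx0_ordge1 rvco (hF i)); rewrite f0.
  + by apply: (approx0_ordge1 rvco (hG i)); rewrite g0.
  + by apply: (approx0_ordge1 prco (hS _)); rewrite H0.
- move=> i; apply: (approx_uniq rvco) (@approxX _ _ _ (@rvc n) N i).
  have := approx_comp rvco rvco N0 h'0 hPsi (hPhi i).
  by apply: approx_eq; apply: filterS hh' => x /= ->.
- by move=> j; split; [exact: base_approx hS H2|exact: base_approx hS' H'2].
- move=> j; apply: (approx_uniq rvco); first exact: (approx_comp rvco rvco N0 h0 hPhi (hF j)).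
  have := approx_comp rvco prco N0 _ (pair_approx id g _ _ (@approxX _ _ _ (@rvc n) N) hG) (hS (rshift n j)).
  rewrite g0 => /(_ erefl); apply: approx_eq; apply: filterS Hact => x /= <-.
  by rewrite /prc pair_subr.
- move=> j; apply: (approx_uniq rvco) (hG j) _.
  have hFP i : approx (@rvc n) N (fun x => rvc i (f (h x))) (msub Phi (F i)).
    exact: (approx_comp rvco rvco N0 h0 hPhi (hF i)).
  have := approx_comp rvco prco N0 _ (pair_approx h (f \o h) _ _ hPhi hFP) (hS' (rshift n j)).
  rewrite /= /h h0 f0 => /(_ erefl); apply: approx_eq.
  have cg : {for 0, continuous (fun x : V => (x, g x) : VW)}.
    exact: (@pair_continuous0 _ _ _ id g (@cvg_id _ _) gc).
  have hi := near_comp cg _ Hinv.1; move: hi; rewrite g0 => /(_ erefl).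
  by apply: filterS2 Hact => x /= -> ->; rewrite /prc pair_subr.
- move=> j; apply: (approx_uniq prco) (@approxX _ _ _ (@prc n p) N (rshift n j)) _.
  have := approx_comp prco prco N0 H0 hS (hS' (rshift n j)).
  rewrite (eq_msub (h' := pair_sub (fun i => S (lshift p i)) (fun j => S (rshift n j)))) => [|k].
    by apply: approx_eq; apply: filterS Hinv.1 => x /= ->.
  by case: (split_ordP k) => i ->; rewrite ?pair_subl ?pair_subr.
Qed.
End Contact.
End Germs.

(** * Polynomial perturbations *)

Lemma near_eq_differentiable (R : realType) (V W : normedModType R) (f g : V -> W) x :
  (\forall y \near x, f y = g y) -> differentiable f x -> differentiable g x.
Proof.
move=> fg /diff_locallyP[cf /eqaddoP hf].
have h : g \o shift x = cst (g x) + 'd f x +o_ 0 id.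
  apply/eqaddoP => eps e0; have fx := nbhs_singleton fg.
  have fg0 : \forall y \near (0 : V), f (y + x) = g (y + x).
    by move: fg; rewrite (near_shift 0) subr0.
  by apply: filterS2 (hf _ e0) fg0 => y; rewrite /= !fctE /= => h <-; rewrite -fx.
by apply/diff_locallyP; rewrite (diff_unique cf h).
Qed.

Section Sums.
Variables (R : realType) (V W : normedModType R).

Lemma smooth_germ_all (f : V -> W) :
  (forall x vs, differentiable (iter_derive vs f) x) -> smooth_germ f.
Proof. by move=> h; apply: nearW. Qed.

Lemma iter_deriveD (f g : V -> W) : smooth_germ f -> smooth_germ g ->
  \forall x \near (0 : V), forall vs, iter_derive vs (f + g) x
    = iter_derive vs f x + iter_derive vs g x.
Proof.
move=> fs gs; pose A := [set x : V | (forall vs, differentiable (iter_derive vs f) x)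
  /\ (forall vs, differentiable (iter_derive vs g) x)].
(* An open set is needed, since the induction hypothesis is differentiated and must hold near each
   of its points. *)
have : nbhs (0 : V) A^° by apply: nbhs_interior; apply: filterI.
apply: filterS => x xA vs; elim: vs x xA => //= v vs IH x xA.
have -> : 'D_v (iter_derive vs (f + g)) x = 'D_v (iter_derive vs f + iter_derive vs g) x.
  apply: near_eq_derive; have : nbhs x A^° by apply: open_nbhs_nbhs; split=> //; apply: open_interior.
  by apply: filterS => y yA; rewrite IH.
have [hf hg] := interior_subset xA.
by rewrite deriveD //; apply: diff_derivable.
Qed.

Lemma smooth_germD (f g : V -> W) : smooth_germ f -> smooth_germ g -> smooth_germ (f + g).
Proof.
move=> fs gs; have h := iter_deriveD fs gs.
have := nbhs_interior h; apply: filterS3 (fs) (gs) => x fx gx hx vs.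
apply: (@near_eq_differentiable _ _ _ (iter_derive vs f + iter_derive vs g)); last first.
  by apply: differentiableD; [exact: fx|exact: gx].
have : nbhs x ([set x | forall vs, iter_derive vs (f + g) x
    = iter_derive vs f x + iter_derive vs g x])^°.
  by apply: open_nbhs_nbhs; split=> //; apply: open_interior.
by apply: filterS => y /interior_subset ->.
Qed.

End Sums.

Section Jets.
Variables (R : realType) (n p : nat).
Notation V := 'rV[R]_n.
Notation W := 'rV[R]_p.

Definition pfun (P : 'I_p -> mpoly n R) (x : V) : W :=
  \sum_j meval (fun i => rvc i x) (P j) *: delta_mx 0 j.

Lemma rvc_pfun P x j : rvc j (pfun P x) = meval (fun i => rvc i x) (P j).
Proof. by have [_ le _] := rv_coordinates R p; rewrite le. Qed.

Definition pderiv (v : V) (P : mpoly n R) := \sum_i v 0 i *: mderiv i P.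

Lemma meval_derive P (x v : V) : differentiable (fun x : V => meval (fun i => rvc i x) P) x /\
  'D_v (fun x : V => meval (fun i => rvc i x) P) x = meval (fun i => rvc i x) (pderiv v P).
Proof.
elim/mpoly_gen_ind: P => [c|i|P Q [dP eP] [dQ eQ]|P Q [dP eP] [dQ eQ]].
- have -> : (fun x : V => meval (fun i => rvc i x) (mpolyC n c)) = cst c.
    by apply: funext => y; rewrite mevalC.
  split=> //; rewrite derive_cst /pderiv big1 ?meval0 // => i _.
  by rewrite mderivC scaler0.
- have -> : (fun x : V => meval (fun i => rvc i x) (mpolyX R (mnm1 i))) = fun x : V => x 0 i.
    by apply: funext => y; rewrite mevalXU.
  have dc : differentiable (fun x : V => x 0 i) x by exact: differentiable_coord.
  split=> //.
  have lin : linear (fun x : V => x 0 i) by move=> a y z; rewrite !mxE.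
  pose c : {linear V -> R} := HB.pack (fun x : V => x 0 i) (GRing.isLinear.Build _ _ _ _ (fun x : V => x 0 i) lin).
  have cc : continuous c by exact: coord_continuous.
  have e := diff_lin x cc.
  rewrite deriveE // [LHS](congr1 (fun g : V -> R => g v) e) /=.
  rewrite /pderiv (raddf_sum (meval _)) /= (bigD1 i) //= big1 => [|k ki].
    rewrite mevalZ mderivX mnm1E eqxx scale1r.
    have -> : mnm_sub (mnm1 i) (mnm1 i) = @mnm0 n by apply/mnmP => k; rewrite mnmBE subnn mnm0E.
    by rewrite mpolyX0 meval1 mulr1 addr0.
  by rewrite mevalZ mderivX mnm1E eq_sym (negPf ki) scale0r meval0 mulr0.
- have -> : (fun x : V => meval (fun i => rvc i x) (P + Q)) =
    (fun x : V => meval (fun i => rvc i x) P) + (fun x : V => meval (fun i => rvc i x) Q).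
    by apply: funext => y; rewrite mevalD.
  split; first exact: differentiableD.
  rewrite deriveD; [|exact: diff_derivable|exact: diff_derivable].
  rewrite eP eQ -mevalD; congr meval; rewrite /pderiv -big_split.
  by apply: eq_bigr => i _; rewrite /= mderivD scalerDr.
- have -> : (fun x : V => meval (fun i => rvc i x) (P * Q)) =
    (fun x : V => meval (fun i => rvc i x) P) * (fun x : V => meval (fun i => rvc i x) Q).
    by apply: funext => y; rewrite mevalM.
  split; first exact: differentiableM.
  rewrite deriveM; [|exact: diff_derivable|exact: diff_derivable].
  rewrite eP eQ /GRing.scale /= -!mevalM -mevalD; congr meval.
  rewrite /pderiv !mulr_sumr -big_split; apply: eq_bigr => i _ /=.
  by rewrite mderivM scalerDr addrC -!scalerAr [mderiv i P * Q]mulrC.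
Qed.

Lemma pfunE P : pfun P = \sum_j (fun x : V => meval (fun i => rvc i x) (P j) *: (delta_mx 0 j : W)).
Proof. by apply: funext => y; rewrite fct_sumE. Qed.

Lemma pfun_differentiable P x : differentiable (pfun P) x.
Proof.
rewrite pfunE; apply: differentiable_sum => j; apply: differentiableZl.
by case: (meval_derive (P j) x 0).
Qed.

Lemma pfun_deriv P v : 'D_v (pfun P) = pfun (fun j => pderiv v (P j)).
Proof.
apply: funext => x; rewrite deriveE; last exact: pfun_differentiable.
have dP j : differentiable (fun x : V => meval (fun i => rvc i x) (P j)) x by case: (meval_derive (P j) x 0).
have dZ j : differentiable (fun x : V => meval (fun i => rvc i x) (P j) *: (delta_mx 0 j : W)) x.
  exact: differentiableZl.
rewrite pfunE -deriveE; last by apply: differentiable_sum.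
rewrite derive_sum => [|j]; last exact: diff_derivable.
apply: eq_bigr => j _; rewrite deriveE // diffZl //.
by have [_ <-] := meval_derive (P j) x v; rewrite deriveE.
Qed.

Lemma iter_derive_pfun P vs : iter_derive vs (pfun P) = pfun (fun j => foldr pderiv (P j) vs).
Proof. by elim: vs => //= v vs ->; rewrite pfun_deriv. Qed.

Lemma ordge_pderiv d v P : ordge d.+1 P -> ordge d (pderiv v P).
Proof. by move=> h; apply: ordge_sum => i _; apply: ordgeZ; apply: ordge_mderiv. Qed.

Lemma smooth_pfun P : smooth_germ (pfun P).
Proof. by apply: smooth_germ_all => x vs; rewrite iter_derive_pfun; apply: pfun_differentiable. Qed.

(** At most k derivatives lower the order of [P] by at most k, so they still vanish at 0. *)
Lemma jet_add_pfun (f : V -> W) P k : smooth_germ f -> (forall j, ordge k.+1 (P j)) ->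
  jet k (f + pfun P) = jet k f.
Proof.
move=> fs hP; apply: funext => x; rewrite /jet; apply: eq_bigr => -[i /= ik] _; congr (_ *: _).
rewrite (nbhs_singleton (iter_deriveD fs (smooth_pfun P))) iter_derive_pfun.
rewrite [X in _ + X](_ : _ = 0) ?addr0 // /pfun big1 // => j _.
rewrite (_ : meval _ _ = 0) ?scale0r //.
have o : ordge 1 (foldr pderiv (P j) (nseq i x)).
  suff o : forall m, (m <= k)%N -> ordge (k.+1 - m) (foldr pderiv (P j) (nseq m x)).
    have i1 : (1 <= k.+1 - i)%N. rewrite subn_gt0; exact: ik.
    exact: (ordgeW i1 (o i ik)).
  elim=> [|m IH] mk; first by rewrite subn0; exact: hP.
  apply: ordge_pderiv; rewrite subSS -subSn ?(ltnW mk) //; exact: IH (ltnW mk).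
have := o; rewrite (ordge1E) mcoeff0E => <-; apply: meval_eq => a; by rewrite /rvc mxE.
Qed.
End Jets.

Lemma derive_small (R : realType) (h : R -> R) : is_derive (0 : R) 1 h 0 -> h 0 = 0 ->
  forall eps, 0 < eps -> exists2 r, 0 < r & forall t, 0 < t < r -> `|h t| <= eps * t.
Proof.
move=> [dh e] h0 eps e0.
have : (fun t : R => t^-1 *: (h (t *: 1 + 0) - h 0)) @ 0^' --> 'D_1 h 0 by exact: dh.
rewrite e => /cvgr0Pnorm_le /(_ _ e0) /nbhs_norm0P[r /= r0 hr]; exists r => // t /andP[t0 tr].
have := hr t; rewrite /= gtr0_norm // => /(_ tr (lt0r_neq0 t0)).
rewrite h0 subr0 addr0 [t *: 1]mulr1 normrM normfV (gtr0_norm t0) mulrC.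
by rewrite ler_pdivrMr.
Qed.

Lemma jet2E (R : realType) (V W : normedModType R) (f : V -> W) x :
  jet 2 f x = f 0 + ('D_x f 0 + 2%:R^-1 *: 'D_x ('D_x f) 0).
Proof.
rewrite /jet big_ord_recl big_ord_recl big_ord1 /=.
by rewrite !fact0 factS fact0 !muln1 invr1 !scale1r.
Qed.

Section Determined.
Variables (R : realType) (n p : nat).
Notation V := 'rV[R]_n.
Notation W := 'rV[R]_p.

Lemma rvc_linear m i : linear (@rvc R m i).
Proof. by move=> a x y; rewrite /rvc !mxE. Qed.

HB.instance Definition _ m i := GRing.isLinear.Build R 'rV[R]_m R _ (@rvc R m i) (rvc_linear i).

Lemma rvc_continuous m i : continuous (@rvc R m i).
Proof. exact: coord_continuous. Qed.

(** On each ray f(t x) has derivative 0 at t = 0, hence is o(t), and [approx_line] gives the order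
    of [F]. *)
Lemma critical_order2 (f : V -> W) N (F : 'I_p -> mpoly n R) : (0 < N)%N ->
  smooth_germ0 f -> (forall v : V, 'd f 0 v = 0) ->
  (forall j, approx (@rvc R n) N (fun x => rvc j (f x)) (F j)) -> forall j, ordge 2 (F j).
Proof.
move=> N0 [fs f0] df0 hF j; have rvco := rv_coordinates R n.
have ad := approxW N0 (hF j).
apply: (approx_line rvco _ ad) => x eps e0.
have dfx : differentiable f ((0 : R) *: x) by rewrite scale0r; exact: (nbhs_singleton fs [::]).
have dl := lam_line_deriv (lam := @rvc R p j) (@rvc_continuous p j) dfx; move: dl => /=.
rewrite [X in is_derive _ _ _ X](_ : _ = 0); last first.
  by rewrite deriveE // scale0r df0 /rvc mxE.
move=> /derive_small; rewrite scale0r f0 => /(_ _ _ e0)[|r r0 hr]; first by rewrite /rvc mxE.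
by exists r => // t ht; rewrite expr1; apply: hr.
Qed.

(** On each ray the derivative of f(t x) is o(t), because the second derivative at 0 is read off the
    2-jet as 0; the mean value theorem then gives f(t x) = o(t^2). *)
Lemma critical_order3 (f : V -> W) N (F : 'I_p -> mpoly n R) : (1 < N)%N ->
  smooth_germ0 f -> (forall v : V, 'd f 0 v = 0) -> jet 2 f = jet 2 (fun=> 0) ->
  (forall j, approx (@rvc R n) N (fun x => rvc j (f x)) (F j)) -> forall j, ordge 3 (F j).
Proof.
move=> N1 [fs f0] df0 j2 hF j; have rvco := rv_coordinates R n.
have ad := approxW N1 (hF j).
apply: (approx_line rvco _ ad) => x eps e0.
have df1 : differentiable f 0 by exact: (nbhs_singleton fs [::]).
have df2 : differentiable ('D_x f) 0 by exact: (nbhs_singleton fs [:: x]).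
have D2 : 'D_x ('D_x f) 0 = 0.
  have D0 : 'D_x (fun=> 0 : W) = (fun=> 0 : W) :> (V -> W).
    by apply: funext => y; exact: derive_cst.
  have D1 : 'D_x f 0 = 0 by rewrite deriveE // df0.
  have := congr1 (fun g : V -> W => g x) j2; rewrite !jet2E f0 D1 D0 /=.
  have -> : 'D_x (fun=> 0 : W) (0 : V) = 0 by exact: derive_cst.
  rewrite scaler0 !add0r => /eqP.
  by rewrite scaler_eq0 invr_eq0 pnatr_eq0 /= => /eqP.
have df2x : differentiable ('D_x f) ((0 : R) *: x) by rewrite scale0r.
have dl := lam_line_deriv (lam := @rvc R p j) (@rvc_continuous p j) df2x; move: dl => /=.
rewrite [X in is_derive _ _ _ X](_ : _ = 0); last by rewrite scale0r D2 /rvc mxE.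
have psi0 : rvc j ('D_x f ((0 : R) *: x)) = 0 by rewrite scale0r deriveE // df0 /rvc mxE.
move=> /derive_small /(_ psi0 _ e0)[r r0 hr].
have /nbhs_norm0P[s /= s0 hs] := fs.
exists (Num.min r (s / (`|x| + 1))) => [|t /andP[t0]].
  by rewrite lt_min r0 divr_gt0 // ltr_wpDl.
rewrite lt_min => /andP[tr ts].
have dfu (u : R) : 0 <= u <= t -> is_derive u 1 (fun s : R => rvc j (f (s *: x))) (rvc j ('D_x f (u *: x))).
  move=> /andP[u0 ut]; apply: lam_line_deriv; first exact: rvc_continuous.
  apply: (hs _ _ [::]); rewrite /= normrZ ger0_norm //.
  apply: (@le_lt_trans _ _ (t * (`|x| + 1))); first by apply: ler_pM => //; rewrite lerDl.
  by rewrite -ltr_pdivlMr // ltr_wpDl.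
have [||c c01] := @MVT_segment R (fun s : R => rvc j (f (s *: x))) (fun u => rvc j ('D_x f (u *: x))) 0 t (ltW t0).
- move=> u; rewrite in_itv /= => /andP[u0 ut]; apply: dfu.
  by rewrite (ltW u0) (ltW ut).
- apply: derivable_within_continuous => u; rewrite in_itv /= => u01.
  by have := dfu _ u01 => -[].
rewrite scale0r f0 (_ : rvc j (0 : W) = 0) ?subr0; last by rewrite /rvc mxE.
move=> ->; rewrite normrM (gtr0_norm t0) expr2 mulrA; apply: ler_wpM2r; first exact: ltW.
move: c01; rewrite in_itv /= => /andP[]; rewrite le_eqVlt => /orP[/eqP <- _|c0 ct].
  by rewrite psi0 normr0 mulr_ge0 // ltW.
apply: le_trans (hr c _) _; first by rewrite c0 (le_lt_trans ct).
by apply: ler_wpM2l => //; exact: ltW.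
Qed.

(** A perturbation of degree N > k keeps the k-jet, so f + h is contact equivalent to f, and its jet
    is equivalent to [F] and to [Fhat]. All jets equivalent to [F] are covered because the result is
    used after linearizing the group and changing bases. *)
Lemma TK_of_determined (f : V -> W) : smooth_germ0 f -> finitely_K_determined f ->
  exists k, forall N (F : 'I_p -> mpoly n R), (k < N)%N ->
    (forall j, approx (@rvc R n) N (fun x => rvc j (f x)) (F j)) ->
    forall Fhat : 'I_p -> mpoly n R, jet_equiv N Fhat F -> TK N Fhat.
Proof.
move=> [fs f0] [k fdet]; exists k => N F kN hF Fhat je.
have N0 : (0 < N)%N by apply: leq_ltn_trans kN.
have [h [oh hTK]] := generic_perturbation N Fhat F (@generic_point R).
apply: hTK; apply: jet_equiv_trans je _.
have gs : smooth_germ (f + pfun h) by apply: smooth_germD => //; apply: smooth_pfun.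
have g0 : (f + pfun h) 0 = 0.
  rewrite fctE /= f0 add0r; apply: big1 => j _; rewrite (_ : meval _ _ = 0) ?scale0r //.
  have : ordge 1 (h j) by apply: ordgeW (oh j).
  rewrite ordge1E mcoeff0E => <-; apply: meval_eq => i; by rewrite /rvc mxE.
have [|H' H'K H'act] := fdet (f + pfun h) (conj gs g0).
  by apply: jet_add_pfun => // j; apply: ordgeW (oh j).
apply: (jet_equiv_of_contact N0 H'K H'act) => //; last exact: smooth_germ_continuous.
move=> j; have rvco := rv_coordinates R n.
have hh : approx (@rvc R n) N (fun x : V => meval (fun i => rvc i x) (h j)) (h j).
  by have := approx_meval rvco (h j) (@approxX _ _ _ (@rvc R n) N); rewrite msub_id.
have := approxD (hF j) hh; congr (approx _ _ _ _); apply: funext => x.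
by rewrite fctE linearD /= rvc_pfun.
Qed.
End Determined.

(** * Invariant forms of compact groups *)

Section Fro.
Variable R : realFieldType.

(** The squared Frobenius norm. *)
Definition fro m n (A : 'M[R]_(m, n)) := \sum_i \sum_k A i k ^+ 2.

Lemma fro_ge0 m n (A : 'M[R]_(m, n)) : 0 <= fro A.
Proof. by apply: sumr_ge0 => i _; apply: sumr_ge0 => k _; apply: sqr_ge0. Qed.

Lemma fro_entry m n (A : 'M[R]_(m, n)) i k : A i k ^+ 2 <= fro A.
Proof.
rewrite /fro (bigD1 i) //= (bigD1 k) //= -!addrA lerDl addr_ge0 //.
  by apply: sumr_ge0 => *; apply: sqr_ge0.
by apply: sumr_ge0 => *; apply: sumr_ge0 => *; apply: sqr_ge0.
Qed.

Lemma fro_gt0 m n (A : 'M[R]_(m, n)) : A != 0 -> 0 < fro A.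
Proof.
move=> A0; rewrite lt_neqAle fro_ge0 andbT eq_sym; apply: contraNneq A0 => e.
apply/eqP/matrixP => i k; rewrite mxE; apply/eqP; rewrite -sqrf_eq0 eq_le sqr_ge0 andbT -e.
exact: fro_entry.
Qed.

Lemma fro_tr m n (A : 'M[R]_(m, n)) : fro A^T = fro A.
Proof. by rewrite /fro exchange_big; apply: eq_bigr => i _; apply: eq_bigr => k _; rewrite mxE. Qed.

(** The parallelogram law; the last term makes [fro] strictly convex. *)
Lemma fro_mid m n (A B : 'M[R]_(m, n)) :
  fro (2^-1 *: (A + B)) = (fro A + fro B) / 2 - fro (A - B) / 4.
Proof.
rewrite /fro !(mulrDl, mulr_suml) -!big_split -sumrB; apply: eq_bigr => i _ /=.
rewrite !(mulrDl, mulr_suml) -!big_split -sumrB; apply: eq_bigr => k _ /=.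
by rewrite !mxE; field.
Qed.

Lemma sum_cauchy_schwarz n (a b : 'I_n -> R) :
  (\sum_i a i * b i) ^+ 2 <= (\sum_i a i ^+ 2) * (\sum_i b i ^+ 2).
Proof.
rewrite -subr_ge0.
have e : 2 * ((\sum_i a i ^+ 2) * (\sum_i b i ^+ 2) - (\sum_i a i * b i) ^+ 2) =
   \sum_i \sum_k (a i * b k - a k * b i) ^+ 2.
  transitivity (\sum_i \sum_k (a i ^+ 2 * b k ^+ 2 + a k ^+ 2 * b i ^+ 2 - 2 * ((a i * b i) * (a k * b k)))).
    have A (x y : 'I_n -> R) : (\sum_i x i) * (\sum_i y i) = \sum_i \sum_k x i * y k.
      by rewrite mulr_suml; apply: eq_bigr => i _; rewrite mulr_sumr.
    rewrite [RHS](eq_bigr (fun i => \sum_k a i ^+ 2 * b k ^+ 2 + \sum_k a k ^+ 2 * b i ^+ 2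
      - \sum_k 2 * ((a i * b i) * (a k * b k)))) => [|i _]; last by rewrite sumrB big_split.
    rewrite sumrB big_split /= -A [X in _ + X - _]exchange_big /= -A.
    under [X in _ - X]eq_bigr do rewrite -mulr_sumr.
    by rewrite -mulr_sumr -A; ring.
  by apply: eq_bigr => i _; apply: eq_bigr => k _; ring.
have : 0 <= \sum_i \sum_k (a i * b k - a k * b i) ^+ 2.
  by apply: sumr_ge0 => *; apply: sumr_ge0 => *; apply: sqr_ge0.
by rewrite -e pmulr_rge0.
Qed.

Lemma fro_mul m n r (A : 'M[R]_(m, n)) (B : 'M[R]_(n, r)) : fro (A *m B) <= fro A * fro B.
Proof.
rewrite -(fro_tr B) /fro mulr_suml; apply: ler_sum => i _.
rewrite mulr_sumr; apply: ler_sum => k _; rewrite mxE.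
rewrite [X in _ <= _ * X](eq_bigr (fun j => B j k ^+ 2)) => [|j _]; last by rewrite mxE.
exact: sum_cauchy_schwarz.
Qed.

Definition qf n (X : 'M[R]_n) (v : 'rV[R]_n) := (v *m X *m v^T) 0 0.

Lemma qf_congr n (X c : 'M[R]_n) v : qf (c *m X *m c^T) v = qf X (v *m c).
Proof. by rewrite /qf trmx_mul !mulmxA. Qed.

Lemma qf_scalar n t (v : 'rV[R]_n) : qf t%:M v = t * fro v.
Proof.
rewrite /qf mul_mx_scalar -scalemxAl mxE; congr (_ * _); rewrite mxE /fro big_ord1.
by apply: eq_bigr => k _; rewrite mxE.
Qed.

Lemma qf_mid n (X Y : 'M[R]_n) v : qf (2^-1 *: (X + Y)) v = (qf X v + qf Y v) / 2.
Proof. by rewrite /qf -scalemxAr -scalemxAl mulmxDr mulmxDl !mxE mulrC. Qed.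
End Fro.

Section MxContinuous.
Variables (R : realType) (T : topologicalType).

Definition mx_continuous m n (A : T -> 'M[R]_(m, n)) := forall i k, continuous (fun t => A t i k).

Lemma sum_continuous m (f : 'I_m -> T -> R) : (forall i, continuous (f i)) ->
  continuous (fun t => \sum_i f i t).
Proof.
move=> h; rewrite (_ : (fun t => _) = \sum_i f i); last by apply: funext => t; rewrite fct_sumE.
by elim/big_ind: _ => // [|f1 f2 h1 h2] t; [exact: cst_continuous|exact: continuousD (h1 t) (h2 t)].
Qed.

Lemma mx_continuous_mul m n r (A : T -> 'M[R]_(m, n)) (B : T -> 'M[R]_(n, r)) :
  mx_continuous A -> mx_continuous B -> mx_continuous (fun t => A t *m B t).
Proof.
move=> cA cB i k; rewrite (_ : (fun t => _) = fun t => \sum_j A t i j * B t j k); last first.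
  by apply: funext => t; rewrite mxE.
by apply: sum_continuous => j t; apply: continuousM; [exact: cA|exact: cB].
Qed.

Lemma mx_continuous_cst m n (A : 'M[R]_(m, n)) : mx_continuous (fun=> A).
Proof. by move=> i k; apply: cst_continuous. Qed.

Lemma mx_continuous_tr m n (A : T -> 'M[R]_(m, n)) : mx_continuous A -> mx_continuous (fun t => (A t)^T).
Proof. by move=> cA i k; rewrite (_ : (fun t => _) = fun t => A t k i) //; apply: funext => t; rewrite mxE. Qed.

Lemma fro_continuous m n (A : T -> 'M[R]_(m, n)) : mx_continuous A -> continuous (fun t => fro (A t)).
Proof.
move=> cA; apply: sum_continuous => i; apply: sum_continuous => k t.
by apply: continuousM; exact: cA.
Qed.

Lemma closed_le_fun (f g : T -> R) : continuous f -> continuous g -> closed [set t | f t <= g t].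
Proof.
move=> cf cg; rewrite (_ : [set t | _] = (f - g) @^-1` [set x | x <= 0]).
  by apply: preimage_closed; [move=> t _|exact: closed_le]; apply: continuousB; [exact: cf|exact: cg].
by apply/seteqP; split => t /=; rewrite -[(f - g) t]/(f t - g t) subr_le0.
Qed.

Lemma closed_forall (I : Type) (D : set I) (P : I -> T -> Prop) :
  (forall i, D i -> closed [set t | P i t]) -> closed [set t | forall i, D i -> P i t].
Proof. exact: closed_bigI. Qed.
End MxContinuous.

Section InvariantForm.
Variables (R : realType) (n : nat) (C : set 'M[R]_n).
Hypotheses (C_unit : forall c, C c -> c \in unitmx) (C1 : C 1%:M).
Hypotheses (CM : forall c d, C c -> C d -> C (c *m d)) (CV : forall c, C c -> C (invmx c)).
Hypothesis C_compact : compact C.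

(** Symmetric forms all of whose translates under [C] dominate the standard one: a closed convex set
    of positive definite forms, stable under [C]. *)
Let K (X : 'M[R]_n) := X^T = X /\ forall c, C c -> forall v, fro v <= qf X (v *m c).
(** The number q bounds [fro] on the whole orbit of X; the least such bound over [K] is what
    [minimizer] attains. *)
Let L q (X : 'M[R]_n) := forall c, C c -> fro (c *m X *m c^T) <= q.

Let coordC : mx_continuous (fun c : 'M[R]_n => c).
Proof. by move=> i k; apply: coord_continuous. Qed.

Let K_mid X Y : K X -> K Y -> K (2^-1 *: (X + Y)).
Proof.
move=> [sX hX] [sY hY]; split; first by rewrite linearZ linearD /= sX sY.
move=> c Cc v; rewrite qf_mid ler_pdivlMr // mulr_natr mulr2n.
by apply: lerD; [exact: hX|exact: hY].
Qed.

Let K_congr X c : C c -> K X -> K (c *m X *m c^T).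
Proof.
move=> Cc [sX hX]; split; first by rewrite !trmx_mul trmxK sX mulmxA.
by move=> d Cd v; rewrite qf_congr -mulmxA; apply: hX; apply: CM.
Qed.

Let L_congr q X c : C c -> L q X -> L q (c *m X *m c^T).
Proof.
move=> Cc hX d Cd; have := hX _ (CM Cd Cc).
by rewrite trmx_mul !mulmxA.
Qed.

(** The form and its bound are packed into one row vector; there the conditions cut out a closed
    bounded set, on which q has a minimum. *)
Let minimizer : exists X q, [/\ K X, L q X & forall Y r, K Y -> L r Y -> q <= r].
Proof.
have [c0 C0 c0_max] := @compact_EVT_max _ _ (fun c : 'M[R]_n => fro c) C
  (ex_intro _ _ C1) C_compact (continuous_subspaceT (fro_continuous coordC)).
(* Since v = (v c) c^-1 and t bounds [fro] on [C], the form t times the identity lies in [K]. *)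
pose t := fro c0; have ht c : C c -> fro c <= t by move=> Cc; apply: c0_max; rewrite inE.
have t0 : 0 <= t by apply: fro_ge0.
have K0 : K t%:M.
  split=> [|c Cc v]; first exact: tr_scalar_mx.
  rewrite qf_scalar mulrC -{1}[v](mulmxK (C_unit Cc)).
  apply: le_trans (fro_mul _ _) _; apply: ler_wpM2l; first exact: fro_ge0.
  exact: ht (CV Cc).
pose q0 := t * (fro (t%:M : 'M[R]_n) * t).
have L0 : L q0 t%:M.
  move=> c Cc; rewrite -mulmxA; apply: le_trans (fro_mul _ _) _.
  apply: ler_pM; rewrite ?fro_ge0 ?ht //; apply: le_trans (fro_mul _ _) _.
  by apply: ler_pM; rewrite ?fro_ge0 // fro_tr ht.
pose q (w : 'rV[R]_(1 + n * n)) := w 0 (lshift _ 0).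
pose X (w : 'rV[R]_(1 + n * n)) : 'M[R]_n := \matrix_(i, j) w 0 (rshift 1 (mxvec_index i j)).
pose W r (Y : 'M[R]_n) : 'rV[R]_(1 + n * n) := row_mx r%:M (mxvec Y).
have qW r Y : q (W r Y) = r by rewrite /q /W row_mxEl mxE eqxx.
have XW r Y : X (W r Y) = Y by apply/matrixP => i j; rewrite mxE row_mxEr mxvecE.
have cq : continuous q by exact: coord_continuous.
have cX : mx_continuous X.
  move=> i j; rewrite (_ : (fun w => _) = fun w : 'rV[R]_(1 + n * n) => w 0 (rshift 1 (mxvec_index i j))).
    exact: coord_continuous.
  by apply: funext => w; rewrite mxE.
pose A1 := [set w | forall i, setT i -> forall j, setT j -> X w j i <= X w i j].
pose A2 := [set w | forall c, C c -> forall v, setT v -> fro v <= qf (X w) (v *m c)].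
pose A3 := [set w | forall c, C c -> fro (c *m X w *m c^T) <= q w].
pose A := A1 `&` (A2 `&` (A3 `&` [set w | q w <= q0])).
have AP w : A w <-> [/\ K (X w), L (q w) (X w) & q w <= q0].
  split=> [[h1 [h2 [h3 h4]]]|[[sX h2] h3 h4]].
    split=> //; split; last by move=> c Cc v; apply: h2.
    by apply/matrixP => i j; rewrite mxE; apply/eqP; rewrite eq_le h1 // h1.
  split; last by split=> [c Cc v _|]; [exact: h2|split].
  by move=> i _ j _; have /matrixP /(_ i j) := sX; rewrite mxE => ->.
have clA : closed A.
  apply: closedI; [|apply: closedI; [|apply: closedI]].
  - by apply: closed_forall => i _; apply: closed_forall => j _; apply: closed_le_fun; exact: cX.
  - apply: closed_forall => c Cc; apply: closed_forall => v _.
    apply: closed_le_fun; first exact: cst_continuous.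
    by apply: mx_continuous_mul; [apply: mx_continuous_mul|]; [exact: mx_continuous_cst|exact: cX|exact: mx_continuous_cst].
  - apply: closed_forall => c Cc; apply: closed_le_fun => //.
    by apply: fro_continuous; apply: mx_continuous_mul; [apply: mx_continuous_mul|]; [exact: mx_continuous_cst|exact: cX|exact: mx_continuous_cst].
  - by apply: closed_le_fun => //; exact: cst_continuous.
have bA : bounded_set A.
  have q00 : 0 <= q0 by rewrite mulr_ge0 // mulr_ge0 ?fro_ge0.
  exists (q0 + 1); split; first by rewrite ger0_real // addr_ge0.
  move=> M qM w /AP[_ hL hq]; apply: le_trans (ltW qM).
  have := hL _ C1; rewrite trmx1 mulmx1 mul1mx => hL1.
  have b k : `|w 0 k| <= q0 + 1.
    case: (split_ordP k) => j ->.
      rewrite ord1 -/(q w) ger0_norm; first by apply: le_trans hq _; rewrite lerDl.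
      by apply: le_trans hL1; apply: fro_ge0.
    case/mxvec_indexP: j => i j.
    have : X w i j ^+ 2 <= q0 by apply: le_trans (fro_entry _ _ _) (le_trans hL1 hq).
    rewrite mxE; set x := w 0 _ => hx; rewrite ler_norml; apply/andP; split; nra.
  rewrite /Num.Def.normr /= mx_normrE; apply/bigmax_leP; split; first by rewrite addr_ge0.
  by move=> [i k] _; rewrite ord1; apply: b.
have A0 : A (W q0 t%:M) by apply/AP; rewrite qW XW.
have [w Aw wmin] := @compact_EVT_min _ _ q A (ex_intro _ _ A0) (bounded_closed_compact bA clA) (continuous_subspaceT cq).
move: Aw; rewrite inE => /AP[Kw Lw qw]; exists (X w), (q w); split=> // Y r KY LY.
have [rq|/ltW qr] := leP r q0; last exact: le_trans qw qr.
by have := wmin (W r Y); rewrite inE qW; apply; apply/AP; rewrite qW XW.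
Qed.

(** Strict convexity takes the place of averaging over the group: if c S c^T differed from the
    minimizer S, their midpoint would lie in [K] and have a strictly smaller bound on its orbit. *)
Theorem invariant_form : exists2 S : 'M[R]_n, posdef S & forall c, C c -> c *m S *m c^T = S.
Proof.
have [S [q [[sS hS] LS qmin]]] := minimizer; have KS : K S by split.
exists S.
  split=> // v v0; have := hS _ C1 v; rewrite mulmx1; apply: lt_le_trans; exact: fro_gt0.
move=> c Cc; apply/eqP/negPn/negP => ne; set S' := c *m S *m c^T in ne.
have D0 : S - S' != 0 by rewrite subr_eq0 eq_sym.
have cD : continuous (fun a : 'M[R]_n => fro (a *m (S - S') *m a^T)).
  apply: fro_continuous; apply: mx_continuous_mul; last exact: mx_continuous_tr.
  by apply: mx_continuous_mul => //; exact: mx_continuous_cst.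
(* The gain is uniform over [C], since a (S - S') a^T has a positive minimal norm on a compact
   set. *)
have [a aC amin] := @compact_EVT_min _ _ _ C (ex_intro _ _ C1) C_compact (continuous_subspaceT cD).
move: aC; rewrite inE => aC.
have d0 : 0 < fro (a *m (S - S') *m a^T).
  apply: fro_gt0; apply: contraNneq D0 => e; have ua := C_unit aC.
  have uat : a^T \in unitmx by rewrite unitmx_tr.
  by rewrite -[S - S'](mulKmx ua) -[a *m _](mulmxK uat) e mul0mx mulmx0.
have := qmin (2^-1 *: (S + S')) (q - fro (a *m (S - S') *m a^T) / 4) (K_mid KS (K_congr Cc KS)).
have : L (q - fro (a *m (S - S') *m a^T) / 4) (2^-1 *: (S + S')).
  move=> b Cb; rewrite -scalemxAr -scalemxAl mulmxDr mulmxDl fro_mid.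
  have h1 := LS b Cb; have h2 := L_congr Cc LS Cb.
  have := amin b; rewrite inE => /(_ Cb).
  have -> : b *m (S - S') *m b^T = b *m S *m b^T - b *m S' *m b^T by rewrite mulmxBr mulmxBl.
  by move: h2; rewrite -/S' => h2 h3; lra.
by move=> hL /(_ hL); lra.
Qed.
End InvariantForm.

(** * Linearizing a compact symmetry group *)

Section Linearize.
Variables (R : realType) (n p : nat).
Notation V := 'rV[R]_n.
Notation W := 'rV[R]_p.
Notation VW := ('rV[R]_n * 'rV[R]_p)%type.

Lemma mulmx_pfun (c : 'M[R]_(n, p)) : (fun x : V => x *m c) = pfun (linsub c).
Proof.
apply: funext => x; apply/rowP => j; rewrite -[RHS]/(rvc j (pfun (linsub c) x)) rvc_pfun meval_linsub mxE.
by [].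
Qed.

Lemma mulmx_continuous0 (c : 'M[R]_(n, p)) : {for 0, continuous (fun x : V => x *m c)}.
Proof. by rewrite mulmx_pfun; apply: smooth_germ_continuous; apply: smooth_pfun. Qed.
End Linearize.

Section Representative.
Variables (R : realType) (n p : nat).
Notation V := 'rV[R]_n.
Notation W := 'rV[R]_p.
Notation VW := ('rV[R]_n * 'rV[R]_p)%type.
Variables (f : V -> W) (F F' : VW -> VW).
Hypotheses (fs : smooth_germ0 f) (FK : contact_group F) (F'K : contact_group F').
Hypothesis FF' : inverse_germs F F'.

Let F0 := source_germ F.

Let gam (x : V) := F' (F0 x, f (F0 x)).

(** Its graph is the preimage under [F] of the graph of [f]; the conjugated group acts on it
    linearly. *)
Definition linearized (x : V) : W := (gam x).2.

Lemma base_germ (G : VW -> VW) : contact_group G ->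
  \forall x \near (0 : V), G (x, 0) = (source_germ G x, 0).
Proof.
move=> [_ _ _ h]; near=> x; rewrite [LHS]surjective_pairing; congr (_, _).
by near: x; exact: h.
Unshelve. all: by end_near. Qed.

Lemma contact_continuous (G : VW -> VW) : contact_group G ->
  [/\ {for 0, continuous G}, G 0 = 0, {for 0, continuous (source_germ G)} & source_germ G 0 = 0].
Proof.
move=> [[[Gs G0] _] [[gs g0] _] _ _]; split.
- exact: smooth_germ_continuous Gs.
- exact: G0.
- exact: smooth_germ_continuous gs.
- exact: g0.
Qed.

Lemma source_inverse (G G' : VW -> VW) : contact_group G -> contact_group G' ->
  germ_eq (G' \o G) id -> \forall x \near (0 : V), source_germ G' (source_germ G x) = x.
Proof.
move=> GK G'K GG'.
have c0 : {for 0, continuous (fun x : V => (x, 0) : VW)}.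
  exact: (@pair_continuous0 _ _ _ _ id (fun=> 0) (@cvg_id _ _) (@cst_continuous _ _ _ _)).
have := near_comp c0 erefl GG'; apply: filterS2 (base_germ GK) => x e /= e'.
by rewrite {1}/source_germ -e e'.
Qed.

Let fc : {for 0, continuous f}. Proof. by apply: smooth_germ_continuous; case: fs. Qed.
Let f0 : f 0 = 0. Proof. by case: fs. Qed.

Let graph_cont : {for 0, continuous (fun x => (F0 x, f (F0 x)) : VW)} /\ (F0 0, f (F0 0)) = 0 :> VW.
Proof.
have [_ _ c0 e0] := contact_continuous FK.
split; last by rewrite /F0 e0 f0.
apply: (pair_continuous0 c0); apply: (@continuous_comp _ _ _ (source_germ F) f 0 c0).
by rewrite e0; exact: fc.
Qed.

Lemma linearized0 : linearized 0 = 0.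
Proof.
have [_ e _ _] := contact_continuous F'K.
by rewrite /linearized /gam graph_cont.2 e.
Qed.

Lemma linearized_continuous : {for 0, continuous linearized}.
Proof.
have [c e _ _] := contact_continuous F'K.
have h : {for 0, continuous gam}.
  by apply: (continuous_comp graph_cont.1); rewrite graph_cont.2.
apply: (continuous_comp h); exact: cvg_snd.
Qed.

Lemma linearized_act : contact_act F' linearized f.
Proof.
have c : {for 0, continuous (fun x => (x, f x) : VW)} by exact: (@pair_continuous0 _ _ _ _ id f (@cvg_id _ _) fc).
have [_ _ h _] := F'K; have h' := near_comp c (congr1 (pair 0) f0) h.
apply: filterS2 h' (source_inverse F'K FK FF'.2) => x /= e1 e2.
by rewrite /linearized /gam /F0 e2 -e1 -surjective_pairing.
Qed.

Let gamE : \forall x \near (0 : V), gam x = (x, linearized x).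
Proof.
have [_ _ h _] := F'K; have h' := near_comp graph_cont.1 graph_cont.2 h.
apply: filterS2 h' (source_inverse FK F'K FF'.1) => x /= e1 e2.
by rewrite [LHS]surjective_pairing; congr (_, _); rewrite -[RHS]e2 -e1.
Qed.

(** The conjugated map preserves the graph of [f], so the linear map preserves the graph of
    [linearized]. *)
Lemma linearized_equivariant (c : 'M[R]_n * 'M[R]_p) : contact_act (F \o linear_germ c \o F') f f ->
  \forall x \near (0 : V), linearized (x *m c.1) = linearized x *m c.2.
Proof.
move=> act.
have [_ _ cF0 eF0] := contact_continuous FK.
have c0 : {for 0, continuous (fun x : V => (x, 0) : VW)}.
  exact: (@pair_continuous0 _ _ _ _ id (fun=> 0) (@cvg_id _ _) (@cst_continuous _ _ _ _)).
have lc : {for 0, continuous (fun x : V => (x *m c.1, linearized x *m c.2) : VW)}.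
  apply: pair_continuous0; first exact: mulmx_continuous0.
  apply: (@continuous_comp _ _ _ linearized (fun y : W => y *m c.2) 0); first exact: linearized_continuous.
  by rewrite linearized0; exact: mulmx_continuous0.
have l0 : (0 *m c.1, linearized 0 *m c.2) = 0 :> VW by rewrite linearized0 !mul0mx.
have a1 := near_comp cF0 eF0 act.
have a2 := near_comp c0 erefl FF'.1.
have a3 := near_comp lc l0 FF'.1.
near=> x.
have E : (F0 (x *m c.1), f (F0 (x *m c.1))) = F (x *m c.1, linearized x *m c.2).
  have : ((fun x => (x, f x)) \o source_germ (F \o linear_germ c \o F')) (F0 x) =
    ((F \o linear_germ c \o F') \o (fun x => (x, f x))) (F0 x) by near: x.
  rewrite /= -/(gam x) (_ : gam x = (x, linearized x)); last by near: x; exact: gamE.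
  rewrite [linear_germ c _]/=.
  suff -> : source_germ (F \o linear_germ c \o F') (F0 x) = F0 (x *m c.1) by [].
  rewrite /source_germ /=.
  have -> : F' (F0 x, 0) = (x, 0).
    have <- : F (x, 0) = (F0 x, 0) by near: x; exact: base_germ.
    by near: x.
  by rewrite /linear_germ /= mul0mx.
have e3 : F' (F (x *m c.1, linearized x *m c.2)) = (x *m c.1, linearized x *m c.2) by near: x.
by rewrite {1}/linearized /gam E e3.
Unshelve. all: by end_near. Qed.

(** The Taylor polynomials of the source germ of [F], of [f] and of [F'] are composed; smoothness of
    the composite is not at issue. *)
Lemma linearized_approx N : (0 < N)%N -> forall j, exists P : mpoly n R,
  approx (@rvc R n) N (fun x => rvc j (linearized x)) P.
Proof.
move=> N0 j.
have rvco := rv_coordinates R n; have rvpo := rv_coordinates R p; have prco := pr_coordinates R n p.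
have [_ [[F0s F00] _] _ _] := FK; have [[[F's F'0'] _] _ _ _] := F'K.
have [Phi hPhi] := boolp.choice (fun i => taylor_coordinates rvco rvco N i F0s).
have [G hG] := boolp.choice (fun i => taylor_coordinates rvco rvpo N i fs.1).
have [S hS] := taylor_coordinates prco prco N (rshift n j) F's.
have hFP i : approx (@rvc R n) N (fun x => rvc i (f (F0 x))) (msub Phi (G i)).
  exact: (approx_comp rvco rvco N0 F00 hPhi (hG i)).
have hp k : approx (@rvc R n) N (fun x => prc k (F0 x, f (F0 x))) (pair_sub Phi (fun i => msub Phi (G i)) k).
  case: (split_ordP k) => i ->; rewrite ?pair_subl ?pair_subr.
    rewrite [X in approx _ _ X](_ : _ = fun x => rvc i (F0 x)); first exact: hPhi.
    by apply: funext => x; rewrite /prc pair_subl.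
  rewrite [X in approx _ _ X](_ : _ = fun x => rvc i (f (F0 x))); first exact: hFP.
  by apply: funext => x; rewrite /prc pair_subr.
have := approx_comp rvco prco N0 graph_cont.2 hp hS.
exists (msub (pair_sub Phi (fun i => msub Phi (G i))) S).
rewrite [X in approx _ _ X](_ : _ = (fun x => prc (rshift n j) (F' x)) \o (fun x => (F0 x, f (F0 x)))) //.
by apply: funext => x; rewrite /= /prc pair_subr.
Qed.
End Representative.

(** * Tangent vectors *)

Section Derive.
Variable R : realType.

Lemma derive_unique (f g : R -> R) df dg : (\forall s \near (0 : R), f s = g s) ->
  is_derive (0 : R) 1 f df -> is_derive (0 : R) 1 g dg -> df = dg.
Proof. by move=> fg [_ <-] [_ <-]; apply: near_eq_derive. Qed.

Lemma sum_is_derive m (h dh : 'I_m -> R -> R) : (forall i, is_derive (0 : R) 1 (h i) (dh i 0)) ->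
  is_derive (0 : R) 1 (fun s => \sum_i h i s) (\sum_i dh i 0).
Proof.
move=> H; rewrite (_ : (fun s => _) = \sum_i h i); last by apply: funext => s; rewrite fct_sumE.
exact: is_derive_sum.
Qed.

Definition mx_derive m n (A : R -> 'M[R]_(m, n)) (dA : 'M[R]_(m, n)) :=
  forall i j, is_derive (0 : R) 1 (fun s => A s i j) (dA i j).

Lemma mx_derive_mul m n r (A : R -> 'M[R]_(m, n)) (B : R -> 'M[R]_(n, r)) dA dB :
  mx_derive A dA -> mx_derive B dB -> mx_derive (fun s => A s *m B s) (A 0 *m dB + dA *m B 0).
Proof.
move=> hA hB i j; rewrite (_ : (fun s => _) = fun s => \sum_k A s i k * B s k j); last first.
  by apply: funext => s; rewrite mxE.
rewrite (_ : _ i j = \sum_k (fun s : R => A 0 i k * dB k j + dA i k * B 0 k j) 0); last first.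
  by rewrite !mxE -big_split.
apply: (sum_is_derive (dh := fun k _ => A 0 i k * dB k j + dA i k * B 0 k j)) => k.
apply: (is_derive_eq (is_deriveM (hA i k) (hB k j))).
by rewrite [dA i k * _]mulrC.
Qed.

Lemma mx_derive_cst m n (A : 'M[R]_(m, n)) : mx_derive (fun=> A) 0.
Proof. by move=> i j; rewrite mxE; exact: is_derive_cst. Qed.

Lemma mx_derive_tr m n (A : R -> 'M[R]_(m, n)) dA : mx_derive A dA -> mx_derive (fun s => (A s)^T) dA^T.
Proof.
move=> h i j; rewrite mxE (_ : (fun s => _) = fun s => A s j i) //.
by apply: funext => s; rewrite mxE.
Qed.

Lemma mx_derive_unique m n (A B : R -> 'M[R]_(m, n)) dA dB : (\forall s \near (0 : R), A s = B s) ->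
  mx_derive A dA -> mx_derive B dB -> dA = dB.
Proof.
move=> AB hA hB; apply/matrixP => i j; apply: derive_unique (hA i j) (hB i j).
by apply: filterS AB => s ->.
Qed.

Lemma meval_is_derive n (P : mpoly n R) (y : 'I_n -> R -> R) dy :
  (forall i, is_derive (0 : R) 1 (y i) (dy i)) ->
  is_derive (0 : R) 1 (fun s => meval (fun i => y i s) P)
    (\sum_i meval (fun i => y i 0) (mderiv i P) * dy i).
Proof.
move=> hy; elim/mpoly_gen_ind: P => [c|i|P Q hP hQ|P Q hP hQ].
- rewrite (_ : (fun s => _) = cst c); last by apply: funext => s; rewrite mevalC.
  rewrite big1 => [|i _]; first exact: is_derive_cst.
  by rewrite mderivC meval0 mul0r.
- rewrite (_ : (fun s => _) = y i); last by apply: funext => s; rewrite mevalXU.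
  rewrite (bigD1 i) //= big1 => [|k ki]; last first.
    by rewrite mderivX mnm1E eq_sym (negPf ki) scale0r meval0 mul0r.
  rewrite mderivX mnm1E eqxx scale1r.
  have -> : mnm_sub (mnm1 i) (mnm1 i) = @mnm0 n by apply/mnmP => k; rewrite mnmBE subnn mnm0E.
  by rewrite mpolyX0 meval1 mul1r addr0.
- rewrite (_ : (fun s => _) = (fun s => meval (fun i => y i s) P) + (fun s => meval (fun i => y i s) Q)).
    apply: (is_derive_eq (is_deriveD hP hQ)).
    rewrite -big_split; apply: eq_bigr => i _ /=.
    by rewrite mderivD mevalD mulrDl.
  by apply: funext => s; rewrite mevalD.
- rewrite (_ : (fun s => _) = (fun s => meval (fun i => y i s) P) * (fun s => meval (fun i => y i s) Q)).
    apply: (is_derive_eq (is_deriveM hP hQ)).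
    rewrite /GRing.scale /= !mulr_sumr -big_split; apply: eq_bigr => i _ /=.
    by rewrite mderivM mevalD !mevalM; ring.
  by apply: funext => s; rewrite mevalM.
Qed.
End Derive.

Lemma diff_right_inverse (R : realType) (V : normedModType R) (Phi Q : V -> V) u :
  differentiable Q 0 -> differentiable Phi (Q 0) -> germ_eq (Phi \o Q) id -> 'd Q (0 : V) u = 0 -> u = 0.
Proof.
move=> dQ dP PQ Zu.
have e : 'D_u (Phi \o Q) 0 = 'D_u id 0 by apply: near_eq_derive; exact: PQ.
move: e; rewrite derive_id => <-; rewrite deriveE; last exact: differentiable_comp.
by rewrite diff_comp //= Zu linear0.
Qed.

Section Tangent.
Variables (R : realType) (n p : nat).
Notation M2 := ('M[R]_n * 'M[R]_p)%type.
Variables (Phi : M2 -> M2) (U : {vspace M2}) (C : set M2).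
Hypotheses (PhiK : diffeo_germ Phi) (CU : \forall X \near (0 : M2), C ((1%:M, 1%:M) + X) <-> Phi X \in U).

(** The inverse Q of the chart sends the lines s u, for u in [U], to curves in [C] through the
    identity. Z is the differential of Q at 0, injective because Phi is a left inverse of Q. *)
Lemma tangent_vectors : exists Z : {linear M2 -> M2}, injective Z /\
  forall u, u \in U -> exists X : R -> M2,
  [/\ mx_derive (fun s => 1%:M + (X s).1) (Z u).1, mx_derive (fun s => 1%:M + (X s).2) (Z u).2,
      X 0 = 0 & \forall s \near (0 : R), C ((1%:M, 1%:M) + X s)].
Proof.
have [[Ps P0] [Q [Qs Q0] [QP PQ]]] := PhiK.
have dP : differentiable Phi (Q 0) by rewrite Q0; exact: (nbhs_singleton Ps [::]).
have dQ : differentiable Q 0 by exact: (nbhs_singleton Qs [::]).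
exists ('d Q (0 : M2)); split.
  apply: raddf_inj => u Zu.
  exact: (diff_right_inverse dQ dP PQ Zu).
move=> u uU; exists (fun s => Q (s *: u)).
have dQu : differentiable Q ((0 : R) *: u) by rewrite scale0r.
have der (lam : {linear M2 -> R}) : continuous lam -> is_derive (0 : R) 1 (fun s : R => lam (Q (s *: u))) (lam ('d Q (0 : M2) u)).
  move=> lc; have dl := lam_line_deriv lc dQu; apply: (is_derive_eq dl).
  by rewrite scale0r deriveE.
split; last 2 first.
- by rewrite scale0r.
- have sc : {for 0, continuous (fun s : R => s *: u)}.
    have ds : differentiable (fun s : R => s *: u) 0 by [].
    exact: differentiable_continuous.
  have s0 : (0 : R) *: u = 0 by rewrite scale0r.
  have a1 := near_comp sc s0 (near_comp (smooth_germ_continuous Qs) Q0 CU).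
  have a2 := near_comp sc s0 PQ.
  by apply: filterS2 a1 a2 => s /= h1 h2; apply/h1; rewrite h2 memvZ.
- move=> i j.
  have lin : linear (fun z : M2 => z.1 i j) by move=> a y z; rewrite !mxE.
  pose lam : {linear M2 -> R} := HB.pack (fun z : M2 => z.1 i j) (GRing.isLinear.Build _ _ _ _ (fun z : M2 => z.1 i j) lin).
  have lc : continuous lam.
    by move=> z; apply: (@continuous_comp _ _ _ (fst : M2 -> _) (fun x : 'M[R]_n => x i j) z); [exact: cvg_fst|exact: coord_continuous].
  have := is_deriveD (is_derive_cst ((1%:M : 'M[R]_n) i j) (0 : R) (1 : R)) (der lam lc).
  rewrite add0r; congr (is_derive _ _ _ _); apply: funext => s.
  by rewrite [RHS]mxE.
- move=> i j.
  have lin : linear (fun z : M2 => z.2 i j) by move=> a y z; rewrite !mxE.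
  pose lam : {linear M2 -> R} := HB.pack (fun z : M2 => z.2 i j) (GRing.isLinear.Build _ _ _ _ (fun z : M2 => z.2 i j) lin).
  have lc : continuous lam.
    by move=> z; apply: (@continuous_comp _ _ _ (snd : M2 -> _) (fun x : 'M[R]_p => x i j) z); [exact: cvg_snd|exact: coord_continuous].
  have := is_deriveD (is_derive_cst ((1%:M : 'M[R]_p) i j) (0 : R) (1 : R)) (der lam lc).
  rewrite add0r; congr (is_derive _ _ _ _); apply: funext => s.
  by rewrite [RHS]mxE.
Qed.

(** The identities c.1 S c.1^T = S, c.2 T c.2^T = T and F(x c.1) = F(x) c.2 are differentiated along
    the curve at s = 0. *)
Lemma tangent_isym (F : 'I_p -> mpoly n R) (S : 'M[R]_n) (T : 'M[R]_p) A B (X : R -> M2) :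
  (forall c, C c -> [/\ c.1 *m S *m c.1^T = S, c.2 *m T *m c.2^T = T &
     forall j, msub (linsub c.1) (F j) = \sum_l c.2 l j *: F l]) ->
  mx_derive (fun s => 1%:M + (X s).1) A -> mx_derive (fun s => 1%:M + (X s).2) B ->
  X 0 = 0 -> (\forall s \near (0 : R), C ((1%:M, 1%:M) + X s)) -> isym F S T A B.
Proof.
move=> hC dA dB X0 hX.
have form m (a : R -> 'M[R]_m) da G : a 0 = 1%:M -> mx_derive a da ->
    (\forall s \near (0 : R), a s *m G *m (a s)^T = G) -> da *m G + G *m da^T = 0.
  move=> a0 ha hG.
  have h := mx_derive_mul (mx_derive_mul ha (mx_derive_cst G)) (mx_derive_tr ha).
  have := mx_derive_unique hG h (mx_derive_cst G).
  by rewrite a0 mulmx0 add0r mul1mx trmx1 mulmx1 addrC.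
have X1 : 1%:M + (X 0).1 = 1%:M :> 'M[R]_n by rewrite X0 addr0.
have X2 : 1%:M + (X 0).2 = 1%:M :> 'M[R]_p by rewrite X0 addr0.
split.
- by apply: form X1 dA _; apply: filterS hX => s /hC[].
- by apply: form X2 dB _; apply: filterS hX => s /hC[].
- move=> j; apply/eqP; rewrite -subr_eq0; apply/eqP/meval_eq0 => v.
  rewrite mevalB; apply/eqP; rewrite subr_eq0; apply/eqP.
  pose x : 'rV[R]_n := \row_i v i.
  pose y i s := (x *m (1%:M + (X s).1)) 0 i.
  have hy i : is_derive (0 : R) 1 (y i) ((x *m A) 0 i).
    by have := mx_derive_mul (mx_derive_cst x) dA 0 i; rewrite mul0mx addr0.
  have y0 i : y i 0 = v i by rewrite /y X1 mulmx1 mxE.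
  have h1 := meval_is_derive (F j) hy.
  have h2 : is_derive (0 : R) 1 (fun s => \sum_l (1%:M + (X s).2) l j * meval v (F l)) (\sum_l B l j * meval v (F l)).
    apply: (sum_is_derive (dh := fun l _ => B l j * meval v (F l))) => l.
    apply: (is_derive_eq (is_deriveM (dB l j) (is_derive_cst (meval v (F l)) (0 : R) (1 : R)))).
    by rewrite scaler0 add0r /GRing.scale /= mulrC.
  have : \sum_i meval (fun i => y i 0) (mderiv i (F j)) * (x *m A) 0 i = \sum_l B l j * meval v (F l).
    apply: (derive_unique _ h1 h2); apply: filterS hX => s /hC[_ _ /(_ j)] /(congr1 (meval v)).
    rewrite meval_msub (raddf_sum (meval v)) /= => e.
    transitivity (\sum_l meval v (((1%:M, 1%:M) + X s).2 l j *: F l)).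
      rewrite -e; apply: meval_eq => i; rewrite meval_linsub /y mxE.
      by apply: eq_bigr => k _; rewrite mxE.
    by apply: eq_bigr => l _; rewrite mevalZ.
  move=> e; rewrite [RHS](raddf_sum (meval v)) /=.
  under [RHS]eq_bigr do rewrite mevalZ.
  rewrite -e /lie (raddf_sum (meval v)) /=; apply: eq_bigr => i _.
  rewrite mevalM mulrC; congr (_ * _); first by apply: meval_eq => k; rewrite y0.
  rewrite (raddf_sum (meval v)) mxE /=; apply: eq_bigr => k _.
  by rewrite mevalZ mevalXU mxE mulrC.
Qed.
End Tangent.

(** * From the compact group to infinitesimal symmetries of a jet *)

Lemma linearized_jet (R : realType) (n p N : nat) (f : 'rV[R]_n -> 'rV[R]_p) F F' (G : 'I_p -> mpoly n R) :
  (0 < N)%N -> smooth_germ0 f -> contact_group F -> contact_group F' -> inverse_germs F F' ->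
  (forall j, approx (@rvc R n) N (fun x => rvc j (f x)) (G j)) ->
  exists Fhat : 'I_p -> mpoly n R, jet_equiv N Fhat G /\
    forall c, contact_act (F \o linear_germ c \o F') f f ->
      forall j, msub (linsub c.1) (Fhat j) = \sum_l c.2 l j *: Fhat l.
Proof.
move=> N0 fs FK F'K FF' hG; have rvco := rv_coordinates R n.
have [P hP] := boolp.choice (linearized_approx fs FK F'K N0).
pose Fhat j := mtrunc N.+1 (P j).
have hF j : approx (@rvc R n) N (fun x => rvc j (linearized f F F' x)) (Fhat j).
  by apply: (approx_congr rvco (hP j)); apply: ordge_trunc.
exists Fhat; split.
  apply: (jet_equiv_of_contact N0 F'K (linearized_act fs FK F'K FF')) => //.
  - exact: linearized0.
  - by case: fs.
  - by apply: smooth_germ_continuous; case: fs.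
(* The jet is truncated at degree N, so the congruence obtained from the germ is an exact identity
   of polynomials. *)
move=> c act; apply: (@linear_equivariant _ _ _ N.+1) => [j|j]; first exact: msize_trunc.
have hc i : approx (@rvc R n) N (fun x => rvc i (x *m c.1)) (linsub c.1 i).
  rewrite (_ : (fun x => _) = fun x : 'rV[R]_n => meval (fun i => rvc i x) (linsub c.1 i)); last first.
    by apply: funext => x; rewrite meval_linsub /rvc mxE.
  by have := approx_meval rvco (linsub c.1 i) (@approxX _ _ _ (@rvc R n) N); rewrite msub_id.
have h1 := approx_comp rvco rvco N0 (mul0mx _ c.1) hc (hF j).
apply: (approx_uniq rvco h1).
have h2 : approx (@rvc R n) N (fun x => \sum_l c.2 l j * rvc l (linearized f F F' x)) (\sum_l c.2 l j *: Fhat l).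
  have := approx_meval rvco (\sum_l c.2 l j *: mpolyX R (mnm1 l)) hF.
  rewrite msub_sum; under [X in approx _ _ _ X]eq_bigr do rewrite msubZ msubX.
  congr (approx _ _ _ _); apply: funext => x; rewrite (raddf_sum (meval _)) /=.
  by apply: eq_bigr => l _; rewrite mevalZ mevalXU.
apply: approx_eq h2; have := linearized_equivariant fs FK F'K FF' act.
apply: filterS => x /= ->; rewrite /rvc mxE.
by apply: eq_bigr => l _; rewrite mulrC.
Qed.

(** Both projections of [C] are compact groups, and [invariant_form] applies to each. *)
Lemma compact_group_forms (R : realType) (n p : nat) (C : set ('M[R]_n * 'M[R]_p)) :
  compact_linear_group C -> exists (S : 'M[R]_n) (T : 'M[R]_p),
  [/\ posdef S, posdef T & forall c, C c -> c.1 *m S *m c.1^T = S /\ c.2 *m T *m c.2^T = T].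
Proof.
move=> [CU C1 CM CV Cc].
have [|||||S pS hS] := @invariant_form R n (fst @` C).
- by move=> _ [c Cc' <-]; case: (CU c Cc').
- by exists (1%:M, 1%:M).
- by move=> _ _ [c Cc' <-] [d Cd <-]; exists (c.1 *m d.1, c.2 *m d.2) => //; apply: CM.
- by move=> _ [c Cc' <-]; exists (invmx c.1, invmx c.2) => //; apply: CV.
- by apply: continuous_compact => //; apply: continuous_subspaceT => z; exact: cvg_fst.
have [|||||T pT hT] := @invariant_form R p (snd @` C).
- by move=> _ [c Cc' <-]; case: (CU c Cc').
- by exists (1%:M, 1%:M).
- by move=> _ _ [c Cc' <-] [d Cd <-]; exists (c.1 *m d.1, c.2 *m d.2) => //; apply: CM.
- by move=> _ [c Cc' <-]; exists (invmx c.1, invmx c.2) => //; apply: CV.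
- by apply: continuous_compact => //; apply: continuous_subspaceT => z; exact: cvg_snd.
by exists S, T; split=> // c Cc'; split; [apply: hS|apply: hT]; exists c.
Qed.

Lemma dim_le1 (K : fieldType) (V : vectType K) (U : {vspace V}) :
  (forall u v, u \in U -> v \in U -> exists a b : K, (a != 0 \/ b != 0) /\ a *: u + b *: v = 0) ->
  (\dim U <= 1)%N.
Proof.
move=> h; have [u0|u0] := eqVneq (vpick U) 0.
  by move/eqP: u0; rewrite vpick0 => /eqP ->; rewrite dimv0.
apply: (@leq_trans (\dim <[vpick U]>)); last by rewrite dim_vline; case: (_ != 0).
apply: dimvS; apply/subvP => v vU; have [a [b [ab e]]] := h _ _ (memv_pick U) vU.
have b0 : b != 0.
  case: ab => // a0; apply: contraNneq a0 => b0.
  by move/eqP: e; rewrite b0 scale0r addr0 scaler_eq0 (negPf u0) orbF.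
apply/vlineP; exists (- a / b); apply: (scalerI b0).
rewrite scalerA mulrCA mulfV // mulr1 scaleNr; apply/eqP.
by rewrite -addr_eq0 addrC e.
Qed.

Lemma germ_eq_refl (R : realType) (V W : normedModType R) (g : V -> W) : germ_eq g g.
Proof. exact: nearW. Qed.

Theorem theorem41 (R : realType) (n p : nat) (f : 'rV[R]_n -> 'rV[R]_p)
  (f_germ : smooth_germ0 f) (f_det : finitely_K_determined f)
  (lt_pn : (p < n)%N)
  (df0 : forall v : 'rV[R]_n, 'd f (0 : 'rV[R]_n) v = 0)
  (hp : (1 < p)%N \/ (p = 1%N /\ jet 2 f = jet 2 (fun=> 0)))
  (MC : set ('rV[R]_n * 'rV[R]_p -> 'rV[R]_n * 'rV[R]_p))
  (MC_max : maximal_compact f MC) :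
  (forall d : nat, compact_subgroup_dim MC d -> (d <= 1)%N) /\
  (p = 1%N -> forall d : nat, compact_subgroup_dim MC d -> d = 0%N).
Proof.
have [_ MCf _] := MC_max.
have [k detk] := TK_of_determined f_germ f_det.
(* N > k for determinacy, and N >= 2 so that the jet shows the terms of degree at most 2 that the
   hypotheses on [f] exclude. *)
pose N := k.+3; have N0 : (0 < N)%N by [].
have rvco := rv_coordinates R n; have rvpo := rv_coordinates R p.
have [G hG] := boolp.choice (fun j => taylor_coordinates rvco rvpo N j f_germ.1).
have tkG := detk N G (leqW (leqW (ltnSn k))) hG.
have G2 := critical_order2 N0 f_germ df0 hG.
have hpG : (1 < p)%N \/ (0 < p)%N /\ forall j, ordge 3 (G j).
  case: hp => [|[p1 j2]]; [by left|right; split; first by rewrite p1].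
  exact: (critical_order3 (isT : (1 < N)%N) f_germ df0 j2 hG).
suff main d : compact_subgroup_dim MC d -> (d <= 1)%N /\ (p = 1%N -> d = 0%N).
  by split=> [d /main[]|p1 d /main[_ h]] //; exact: h.
move=> [C [Cgrp [F [F' [FK F'K FF' MCE]]] Cdim]].
have [Fhat [je eqF]] := linearized_jet N0 f_germ FK F'K FF' hG.
have [S [T [pS pT hST]]] := compact_group_forms Cgrp.
have hC c : C c -> [/\ c.1 *m S *m c.1^T = S, c.2 *m T *m c.2^T = T &
     forall j, msub (linsub c.1) (Fhat j) = \sum_l c.2 l j *: Fhat l].
  move=> Cc; have [h1 h2] := hST c Cc; split=> //; apply: eqF.
  have [|_ act] := MCf (F \o linear_germ c \o F'); last exact: act.
  by rewrite MCE; exists (linear_germ c); [exists c|exact: germ_eq_refl].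
have C1 : C (1%:M, 1%:M) by case: Cgrp.
(* The dimension is read off at the identity: d is the dimension of [U], which Z embeds linearly
   into the symmetries of [Fhat]. *)
have [Phi [U [PhiK dimU CU]]] := Cdim _ C1.
have [Z [Zinj Zt]] := tangent_vectors PhiK CU.
have Zsym u : u \in U -> isym Fhat S T (Z u).1 (Z u).2.
  by move=> /Zt[X [h1 h2 X0 hX]]; exact: tangent_isym hC h1 h2 X0 hX.
have tkF H : jet_equiv N H Fhat -> TK N H by move=> jeH; apply: tkG; exact: jet_equiv_trans jeH je.
have F2 : forall j, ordge 2 (Fhat j) by apply: jet_equiv_ordge je _.
have hpF : (1 < p)%N \/ (0 < p)%N /\ forall j, ordge 3 (Fhat j).
  by case: hpG => [|[p0 G3]]; [left|right; split=> //; apply: jet_equiv_ordge je _].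
have N3 : (3 <= N.+1)%N by [].
rewrite -dimU; split.
  apply: dim_le1 => u v uU vU.
  have [a [b [ab e1 e2]]] := isym_dependent N3 F2 lt_pn tkF hpF pS pT (Zsym u uU) (Zsym v vU).
  exists a, b; split=> //; apply: Zinj; rewrite linearD !linearZ linear0.
  by rewrite [LHS]surjective_pairing /= e1 e2.
move=> p1; apply/eqP; rewrite dimv_eq0 -vpick0; apply/eqP; apply: Zinj.
have [e1 e2] := isym_p1 N3 F2 lt_pn tkF hpF pS pT p1 (Zsym _ (memv_pick U)).
by rewrite linear0 [LHS]surjective_pairing e1 e2.
Qed.
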